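(* Let $N\ge3$, $p\in(1,p_N)$, and let $\Omega=\mathbb{D}_N$ be a ball in $\mathbb{R}^N$ of unit volume, with radius $R_N$. Then for every $I>0$ there exists a unique solution $(\gamma,\mathrm{v})$ of $(\mathbf{F}_I)$, and for every $\lambda>0$ a unique solution $(\alpha_\lambda,\psi_\lambda)$ of $(\mathbf{P}_\lambda)$. Furthermore (with $I=\lambda^{p/(p-1)}$): the solution is positive (i.e. $\alpha_\lambda>0$) $\iff\gamma>0\iff I<I^*(\mathbb{D}_N,p)\iff\lambda<\lambda^*(\mathbb{D}_N,p)$; the free boundary is nonempty (i.e. $\{\mathrm{v}>0\}\ne\Omega$) $\iff\gamma<0\iff I>I^*(\mathbb{D}_N,p)\iff\lambda>\lambda^*(\mathbb{D}_N,p)$; and $$\alpha_\lambda=c_N\lambda\left(1-\left(\frac{\lambda}{\lambda^*(\mathbb{D}_N,p)}\right)^{\frac{p}{p_N-p}}\right)\quad\forall\lambda>\lambda^*(\mathbb{D}_N,p),\qquad c_N=\frac1{N(N-2)\omega_NR_N^{N-2}}.$$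
   Context: $p_N=\frac N{N-2}$, $[t]_+=\max\{t,0\}$, $\omega_N=|B_1|$. Problem $(\mathbf{F}_I)$: find $(\gamma,\mathrm{v})\in\mathbb{R}\times C^{2,\beta}(\overline\Omega)$ with $-\Delta\mathrm{v}=[\mathrm{v}]_+^p$ in $\Omega$, $\mathrm{v}=\gamma$ on $\partial\Omega$, $\int_\Omega[\mathrm{v}]_+^p=I$. Problem $(\mathbf{P}_\lambda)$: find $(\alpha,\psi)$ with $-\Delta\psi=[\alpha+\lambda\psi]_+^p$ in $\Omega$, $\psi=0$ on $\partial\Omega$, $\int_\Omega[\alpha+\lambda\psi]_+^p=1$; the two are equivalent via $I=\lambda^{p/(p-1)}$, $\gamma=\lambda^{1/(p-1)}\alpha$, $\mathrm{v}=\lambda^{1/(p-1)}(\alpha+\lambda\psi)$. Let $u$ be the unique positive solution of $-\Delta u=u^p$ in $B_1(0)$, $u=0$ on $\partial B_1(0)$, $I_p=\int_{B_1(0)}u^p$, $I^*(\mathbb{D}_N,p)=I_p/R_N^{\frac2{p-1}-N+2}$ and $\lambda^*(\mathbb{D}_N,p)=I^*(\mathbb{D}_N,p)^{\frac{p-1}p}$ (this is the notation used here for this specific number). *)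

(* Defs.v *)
From HB Require Import structures.
From mathcomp Require Import all_boot all_order all_algebra.
From mathcomp Require Import all_classical all_reals all_analysis.
Set Implicit Arguments. Unset Strict Implicit. Unset Printing Implicit Defensive.
Import Order.TTheory GRing.Theory Num.Theory.
Import numFieldNormedType.Exports.
Local Open Scope classical_set_scope.
Local Open Scope ring_scope.

Section Defs.
Variables (R : realType) (N : nat).

Definition enorm (x : 'rV[R]_N) : R := Num.sqrt (\sum_(i < N) x 0 i ^+ 2).

Definition eball (c : 'rV[R]_N) (r : R) : set 'rV[R]_N := [set x | enorm (x - c) < r].
Definition ecball (c : 'rV[R]_N) (r : R) : set 'rV[R]_N := [set x | enorm (x - c) <= r].
Definition esphere (c : 'rV[R]_N) (r : R) : set 'rV[R]_N := [set x | enorm (x - c) = r].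

Definition evec (i : 'I_N) : 'rV[R]_N := delta_mx 0 i.

Definition pd (i : 'I_N) (f : 'rV[R]_N -> R) : 'rV[R]_N -> R := 'D_(evec i) f.

Definition lap (f : 'rV[R]_N -> R) (x : 'rV[R]_N) : R := \sum_(i < N) pd i (pd i f) x.

Definition holder_on (beta : R) (A : set 'rV[R]_N) (g : 'rV[R]_N -> R) : Prop :=
  exists C : R, forall x y, A x -> A y -> `|g x - g y| <= C * enorm (x - y) `^ beta.

(* f belongs to C^{2,beta} of the closed ball (center c, radius r):
   f is continuous on the closed ball, twice differentiable in the open ball,
   and f, its first and second partial derivatives are (uniformly) beta-Hoelder
   in the open ball (hence extend to the closure). *)
Definition C2beta (beta : R) (c : 'rV[R]_N) (r : R) (f : 'rV[R]_N -> R) : Prop :=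
  [/\ {within ecball c r, continuous f},
      (forall x, eball c r x -> differentiable f x /\
                 forall i, differentiable (pd i f) x),
      holder_on beta (eball c r) f,
      (forall i, holder_on beta (eball c r) (pd i f)) &
      (forall i j, holder_on beta (eball c r) (pd j (pd i f)))].

(* N-dimensional integral, as the iterated one-dimensional Lebesgue integral
   over the coordinates (all integrands used below are bounded, measurable,
   compactly supported, so this is the Lebesgue integral on R^N by Fubini). *)
Fixpoint iint (n : nat) (F : seq R -> R) : R :=
  match n with
  | 0 => F [::]
  | n'.+1 => Rintegral (@lebesgue_measure R) setT (fun t => iint n' (fun s => F (t :: s)))
  end.

Definition integralN (f : 'rV[R]_N -> R) : R :=
  iint N (fun s => f (\row_(i < N) nth 0 s i)).

Definition integral_on (A : set 'rV[R]_N) (f : 'rV[R]_N -> R) : R :=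
  integralN (fun x => if `[< A x >] then f x else 0).

Definition volume (A : set 'rV[R]_N) : R := integral_on A (fun _ => 1).

Definition pospow (p t : R) : R := (Num.max t 0) `^ p.

Definition solFI (beta p I : R) (c : 'rV[R]_N) (r : R)
    (gamma : R) (v : 'rV[R]_N -> R) : Prop :=
  [/\ C2beta beta c r v,
      (forall x, eball c r x -> - lap v x = pospow p (v x)),
      (forall x, esphere c r x -> v x = gamma) &
      integral_on (eball c r) (fun x => pospow p (v x)) = I].

Definition solPlam (beta p lambda : R) (c : 'rV[R]_N) (r : R)
    (alpha : R) (psi : 'rV[R]_N -> R) : Prop :=
  [/\ C2beta beta c r psi,
      (forall x, eball c r x -> - lap psi x = pospow p (alpha + lambda * psi x)),
      (forall x, esphere c r x -> psi x = 0) &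
      integral_on (eball c r) (fun x => pospow p (alpha + lambda * psi x)) = 1].

Definition LaneEmden (beta p : R) (u : 'rV[R]_N -> R) : Prop :=
  [/\ C2beta beta 0 1 u,
      (forall x, eball 0 1 x -> 0 < u x),
      (forall x, eball 0 1 x -> - lap u x = u x `^ p) &
      (forall x, esphere 0 1 x -> u x = 0)].

End Defs.

(* Main.v *)
(* Every solution v of the boundary value problem on a ball is radial: with
   f(t) = [t]_+^p nondecreasing and locally Lipschitz, the method of moving planes
   applies to v - gamma, and since the reflected difference is positive on the
   spherical part of a cap, only maximum principles in thin strips are needed.

   The profile of v solves the singular ODE V'' + (N-1)/s V' = -[V]_+^p, whose
   initial value problem is uniquely solvable.  The profile of the Lane-Emden
   solution u, continued harmonically (U = -const (1 - s^(2-N))) beyond its zero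
   s = 1, is a solution U on the whole half-line, so by scaling every solution is
   v(x) = (rho/R)^(2/(p-1)) U(rho |x - c| / R) for some rho > 0.  Its mass is a
   constant times (rho/R)^(2/(p-1)-N+2) M(rho), where the flux
   M(s) = -s^(N-1) U'(s) is nondecreasing and constant for s >= 1.  Since p < p_N
   the mass is a strictly increasing bijection of rho in (0,oo), with value I^* at
   rho = 1; this gives existence, uniqueness and the trichotomy, and for rho > 1
   everything is explicit. *)
Require Import Defs.
From HB Require Import structures.
From mathcomp Require Import all_boot all_order all_algebra.
From mathcomp Require Import all_classical all_reals all_analysis.
From mathcomp Require Import measurable_realfun ring lra.
Import Order.TTheory GRing.Theory Num.Theory.
Import numFieldNormedType.Exports.
Local Open Scope classical_set_scope.
Local Open Scope ring_scope.
Set Implicit Arguments.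
Unset Strict Implicit.
Unset Printing Implicit Defensive.

(** * Euclidean norm on row vectors *)

Section Euclid.
Context {R : realType} {N : nat}.
Implicit Types (c x y z e h : 'rV[R]_N) (a b r s : R).

(** Three obstacles shape the argument. The integral is an iterated one-dimensional one, so polar
    coordinates are replaced by squeezing a radial integrand between constants on thin shells;
    monotonicity of the profile makes every partial integral measurable and makes the errors of the
    squeeze telescope. Moving planes compares a solution with its reflection, so the Laplacian is
    carried by symmetric second differences, which reflect by conjugating a matrix instead of by a
    second-order chain rule. The radial equation degenerates at the centre: there the profile and
    its Hoelder regularity are taken over from [u], and only uniqueness from the value at 0 is
    proved. Away from the centre everything is Lipschitz by the equation itself, and the two regions
    are glued across the shell between the radii 1/2 and 1. At the radius 1 the slope needed for the
    harmonic continuation is obtained as the limit of the monotone, bounded flux. *)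

Definition dot x y : R := \sum_(i < N) x 0 i * y 0 i.

Lemma dotC x y : dot x y = dot y x.
Proof. by apply: eq_bigr => i _; rewrite mulrC. Qed.

Lemma dotDl x y z : dot (x + y) z = dot x z + dot y z.
Proof. by rewrite /dot -big_split; apply: eq_bigr => i _; rewrite mxE mulrDl. Qed.

Lemma dotZl a x y : dot (a *: x) y = a * dot x y.
Proof. by rewrite /dot mulr_sumr; apply: eq_bigr => i _; rewrite mxE mulrA. Qed.

Lemma dotNl x y : dot (- x) y = - dot x y.
Proof. by rewrite -scaleN1r dotZl mulN1r. Qed.

Lemma dotBl x y z : dot (x - y) z = dot x z - dot y z.
Proof. by rewrite dotDl dotNl. Qed.

Lemma dotDr x y z : dot x (y + z) = dot x y + dot x z.
Proof. by rewrite dotC dotDl !(dotC x). Qed.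

Lemma dotZr a x y : dot x (a *: y) = a * dot x y.
Proof. by rewrite dotC dotZl dotC. Qed.

Lemma dotNr x y : dot x (- y) = - dot x y.
Proof. by rewrite dotC dotNl dotC. Qed.

Lemma dotBr x y z : dot x (y - z) = dot x y - dot x z.
Proof. by rewrite dotDr dotNr. Qed.

Lemma dot0l x : dot 0 x = 0.
Proof. by rewrite -(scale0r 0) dotZl mul0r. Qed.

Definition dotE := (dotDl, dotDr, dotBl, dotBr, dotNl, dotNr, dotZl, dotZr).

Lemma dot_ge0 x : 0 <= dot x x.
Proof. by apply: sumr_ge0 => i _; rewrite -expr2 sqr_ge0. Qed.

Lemma dot_eq0 x : dot x x = 0 -> x = 0.
Proof.
move=> x0; apply/rowP => i; rewrite mxE; apply/eqP; rewrite -sqrf_eq0 expr2.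
by rewrite (psumr_eq0P _ x0) // => j _; rewrite -expr2 sqr_ge0.
Qed.

Lemma enormE x : enorm x = Num.sqrt (dot x x).
Proof. by congr Num.sqrt; apply: eq_bigr => i _; rewrite expr2. Qed.

Lemma enorm_ge0 x : 0 <= enorm x.
Proof. exact: sqrtr_ge0. Qed.

Lemma sqr_enorm x : enorm x ^+ 2 = dot x x.
Proof. by rewrite enormE sqr_sqrtr ?dot_ge0. Qed.

Lemma enorm_le x a : 0 <= a -> (enorm x <= a) = (dot x x <= a ^+ 2).
Proof. by move=> a0; rewrite -sqr_enorm ler_pXn2r ?nnegrE ?enorm_ge0. Qed.

Lemma enorm_lt x a : 0 <= a -> (enorm x < a) = (dot x x < a ^+ 2).
Proof. by move=> a0; rewrite -sqr_enorm ltr_pXn2r ?nnegrE ?enorm_ge0. Qed.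

Lemma enorm_eq x y : (enorm x = enorm y) <-> (dot x x = dot y y).
Proof. by split; [rewrite -!sqr_enorm => -> | rewrite !enormE => ->]. Qed.

Lemma CauchySchwarz x y : dot x y ^+ 2 <= dot x x * dot y y.
Proof.
have [y0|y0] := eqVneq (dot y y) 0.
  by rewrite (dot_eq0 y0) dotC dot0l expr0n /= mulr_ge0 ?dot_ge0.
have yp : 0 < dot y y by rewrite lt_neqAle eq_sym y0 dot_ge0.
have := dot_ge0 (dot y y *: x - dot x y *: y).
rewrite !dotE (dotC y x) => H.
rewrite -subr_ge0 -(pmulr_rge0 _ yp); apply: le_trans H _.
by rewrite le_eqVlt; apply/orP; left; apply/eqP; ring.
Qed.

Lemma dot_le x y : dot x y <= enorm x * enorm y.
Proof.
apply: le_trans (ler_norm _) _.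
rewrite -(ler_pXn2r (n := 2)) ?nnegrE ?normr_ge0 ?mulr_ge0 ?enorm_ge0 //.
by rewrite real_normK ?num_real // exprMn !sqr_enorm CauchySchwarz.
Qed.

Lemma enormN x : enorm (- x) = enorm x.
Proof. by apply/enorm_eq; rewrite !dotE opprK. Qed.

Lemma norm_dot_le x y : `|dot x y| <= enorm x * enorm y.
Proof. by rewrite ler_norml lerNl -dotNl dot_le -(enormN x) dot_le. Qed.

Lemma enormD x y : enorm (x + y) <= enorm x + enorm y.
Proof.
rewrite enorm_le ?addr_ge0 ?enorm_ge0 // !dotE (dotC y x) sqrrD !sqr_enorm.
by have := dot_le x y; lra.
Qed.

Lemma enormB x y : enorm (x - y) = enorm (y - x).
Proof. by rewrite -enormN opprB. Qed.

Lemma enormZ a x : enorm (a *: x) = `|a| * enorm x.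
Proof. by rewrite !enormE dotZl dotZr mulrA -expr2 sqrtrM ?sqr_ge0 // sqrtr_sqr. Qed.

Lemma enorm0 : enorm (0 : 'rV[R]_N) = 0.
Proof. by rewrite enormE dot0l sqrtr0. Qed.

Lemma enorm_eq0 x : (enorm x == 0) = (x == 0).
Proof.
apply/eqP/eqP => [x0|->]; last exact: enorm0.
by apply: dot_eq0; rewrite -sqr_enorm x0 expr0n.
Qed.

Lemma enorm_gt0 x : (0 < enorm x) = (x != 0).
Proof. by rewrite lt_neqAle eq_sym enorm_eq0 enorm_ge0 andbT. Qed.

Lemma enorm_dist x y : `|enorm x - enorm y| <= enorm (x - y).
Proof.
rewrite ler_norml; apply/andP; split.
  by have := enormD (y - x) x; rewrite subrK enormB; lra.
by have := enormD (x - y) y; rewrite subrK; lra.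
Qed.

Lemma coord_le_enorm x i : `|x 0 i| <= enorm x.
Proof.
rewrite -(ler_pXn2r (n := 2)) ?nnegrE ?normr_ge0 ?enorm_ge0 // sqr_enorm.
rewrite real_normK ?num_real // /dot (bigD1 i) //= -expr2 lerDl.
by apply: sumr_ge0 => j _; rewrite -expr2 sqr_ge0.
Qed.

Lemma norm_le_enorm x : `|x| <= enorm x.
Proof.
have [->|x0] := eqVneq x 0; first by rewrite normr0 enorm_ge0.
have [[i j] /= ->] : exists i, `|x| = `|x i.1 i.2|.
  by apply: (@mx_norm_neq0 R 1 N x); rewrite -[mx_norm _]/(`|x|) normr_eq0.
by rewrite (ord1 i) coord_le_enorm.
Qed.

Lemma coord_le_norm x i : `|x 0 i| <= `|x|.
Proof.
rewrite [X in _ <= X]mx_normrE.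
by apply: le_trans (le_bigmax _ _ (0, i)).
Qed.

Lemma enorm_le_norm x : enorm x <= N%:R * `|x|.
Proof.
rewrite enorm_le ?mulr_ge0 //.
apply: (@le_trans _ _ (\sum_(i < N) `|x| ^+ 2)).
  apply: ler_sum => i _; rewrite -expr2 -[X in X <= _]real_normK ?num_real //.
  by rewrite ler_pXn2r ?nnegrE // coord_le_norm.
rewrite sumr_const card_ord exprMn -[leLHS]mulr_natl; apply: ler_wpM2r; rewrite ?sqr_ge0 //.
by rewrite -natrX ler_nat; case: (N) => // n; rewrite expnS leq_pmulr // expn1.
Qed.

(** Row vectors carry the sup-norm topology, and [enorm] lies between the sup norm and [N] times it.
    Dividing by [N + 1] instead of [N] avoids a division by zero when [N = 0]. *)
Lemma nbhs_eballP (x : 'rV[R]_N) (A : set 'rV[R]_N) :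
  nbhs x A <-> exists2 d, 0 < d & eball x d `<=` A.
Proof.
split.
  move=> /nbhs_ballP[d /= d0 dA]; exists d => // y; rewrite /eball /= => xy.
  apply: dA; rewrite -ball_normE /ball_ /=.
  by apply: le_lt_trans (norm_le_enorm _) _; rewrite enormB.
move=> [d d0 dA]; apply/nbhs_ballP; exists (d / (N%:R + 1)) => /=.
  by rewrite divr_gt0 // ltr_wpDl.
move=> y; rewrite -ball_normE /ball_ /= => xy; apply: dA; rewrite /eball /= enormB.
apply: le_lt_trans (enorm_le_norm _) _.
have [->|n0] := eqVneq (`|x - y|) 0; first by rewrite mulr0.
have {}n0 : 0 < `|x - y| by rewrite lt_neqAle eq_sym n0 normr_ge0.
move: xy; rewrite ltr_pdivlMr ?ltr_wpDl // mulrDr mulr1 (mulrC N%:R) => xy.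
by apply: lt_trans xy; rewrite ltrDl.
Qed.

Lemma dot_continuous e : continuous (fun x => dot x e).
Proof.
move=> x; apply/(@cvgrPdist_lt _ _ _ (nbhs x)) => d d0; apply/nbhs_eballP.
exists (d / (enorm e + 1)); first by rewrite divr_gt0 // ltr_wpDl ?enorm_ge0.
move=> y; rewrite /eball /= => xy; rewrite -dotBl.
apply: le_lt_trans (norm_dot_le _ _) _; rewrite enormB.
have [->|n0] := eqVneq (enorm (y - x)) 0; first by rewrite mul0r.
have {}n0 : 0 < enorm (y - x) by rewrite lt_neqAle eq_sym n0 enorm_ge0.
move: xy; rewrite ltr_pdivlMr ?ltr_wpDl ?enorm_ge0 // mulrDr mulr1 => xy.
by apply: lt_trans xy; rewrite ltrDl.
Qed.

Lemma enorm_sub_continuous c : continuous (fun x : 'rV[R]_N => enorm (x - c)).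
Proof.
move=> x; apply/(@cvgrPdist_lt _ _ _ (nbhs x)) => e e0; apply/nbhs_eballP.
exists e => // y /= xy; apply: le_lt_trans (enorm_dist _ _) _.
by rewrite [X in enorm X](_ : _ = x - y) 1?enormB // opprB addrA subrK.
Qed.

Lemma closed_le (T : topologicalType) (f g : T -> R) :
  continuous f -> continuous g -> closed [set t | f t <= g t].
Proof.
move=> cf cg.
rewrite [X in closed X](_ : _ = (fun t => g t - f t) @^-1` [set y | 0 <= y]); last first.
  by apply/seteqP; split => t /=; rewrite subr_ge0.
apply: closed_comp; last exact: closed_ge.
by move=> t _; apply: cvgB; [exact: cg | exact: cf].
Qed.

Lemma open_lt (T : topologicalType) (f g : T -> R) :
  continuous f -> continuous g -> open [set t | f t < g t].
Proof.
move=> cf cg.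
rewrite (_ : mkset _ = ~` [set t | g t <= f t]); last first.
  by apply/seteqP; split => t /=; [move=> H /le_lt_trans/(_ H); rewrite ltxx
    | move/negP; rewrite -ltNge].
by apply/closed_openC/closed_le.
Qed.

Lemma open_eball c r : open (eball c r).
Proof. by apply: open_lt; [exact: enorm_sub_continuous | exact: cst_continuous]. Qed.

Lemma compact_ecball c r : compact (ecball c r).
Proof.
apply: bounded_closed_compact; last first.
  by apply: closed_le; [exact: enorm_sub_continuous | exact: cst_continuous].
exists (r + enorm c); split; first exact: num_real.
move=> M rM x; rewrite /ecball /= => xr.
apply: le_trans (norm_le_enorm _) _.
by have := enormD (x - c) c; rewrite subrK; lra.
Qed.

End Euclid.

(** * The Laplacian through second differences *)

Section HasLap.
Context {R : realType} {N : nat}.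
Implicit Types (c x y z e h : 'rV[R]_N) (a b r s L : R) (f g : 'rV[R]_N -> R).

Lemma diff_pd f x h : differentiable f x -> 'd f x h = \sum_i h 0 i * pd i f x.
Proof.
move=> df; rewrite {1}(row_sum_delta h) linear_sum; apply: eq_bigr => i _.
by rewrite linearZ /pd deriveE.
Qed.

Lemma diff_eps f x eps : differentiable f x -> 0 < eps ->
  exists2 d, 0 < d & forall h, enorm h < d ->
    `|f (x + h) - f x - \sum_i h 0 i * pd i f x| <= eps * enorm h.
Proof.
move=> df e0; have /eqaddoP/(_ eps e0)/nbhs_eballP[d d0 dP] := diff_locally df.
exists d => // h hd; have /dP : eball 0 d h by rewrite /eball /= subr0.
rewrite /= !fctE /= -(diff_pd _ df) (addrC x) opprD addrA => H.
apply: le_trans H _; rewrite ler_pM2l //; exact: norm_le_enorm.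
Qed.

Lemma line_derive f x h (t : R) : differentiable f (x + t *: h) ->
  is_derive t 1 (fun s => f (x + s *: h)) (\sum_i h 0 i * pd i f (x + t *: h)).
Proof.
move=> df.
have dl : is_diff t (fun s : R => x + s *: h) ( *:%R ^~ h).
  have dd : is_diff t (cst x + ( *:%R ^~ h : R -> 'rV[R]_N)) (0 + ( *:%R ^~ h)).
    exact: is_diffD.
  by rewrite add0r in dd; exact: dd.
have dc := is_diff_comp dl (differentiableP df).
have dd : differentiable (f \o (fun s : R => x + s *: h)) t by apply: ex_diff.
apply: DeriveDef; first exact: diff_derivable.
by rewrite deriveE // diff_val /= scale1r diff_pd.
Qed.

(* The Hessian [H] only has to describe the symmetric second differences of [f]
   at [x]: this is stable under affine reflections and is all that the maximum
   principle needs. *)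
Definition has_lap f x L := exists H : 'M[R]_N, \tr H = L /\
  forall eps, 0 < eps -> exists2 d, 0 < d & forall h, enorm h < d ->
    `|f (x + h) + f (x - h) - 2 * f x - dot (h *m H) h| <= eps * dot h h.

Lemma has_lapD f g x L L' : has_lap f x L -> has_lap g x L' ->
  has_lap (fun y => f y + g y) x (L + L').
Proof.
move=> [H [<- Hf]] [K [<- Kf]]; exists (H + K); split; first exact: linearD.
move=> eps e0; have e2 : 0 < eps / 2 by rewrite divr_gt0.
have [d d0 dP] := Hf _ e2; have [d' d'0 d'P] := Kf _ e2.
exists (Num.min d d'); first by rewrite lt_min d0.
move=> h; rewrite lt_min => /andP[/dP A /d'P B].
rewrite mulmxDr dotDl [X in `|X|](_ : _ =
  (f (x + h) + f (x - h) - 2 * f x - dot (h *m H) h) +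
  (g (x + h) + g (x - h) - 2 * g x - dot (h *m K) h)); last by ring.
by apply: le_trans (ler_normD _ _) _; lra.
Qed.

Lemma has_lapZ f x L a : has_lap f x L -> has_lap (fun y => a * f y) x (a * L).
Proof.
move=> [H [<- Hf]]; exists (a *: H); split; first exact: linearZ.
move=> eps e0; have e2 : 0 < eps / (`|a| + 1) by rewrite divr_gt0 // ltr_wpDl.
have [d d0 dP] := Hf _ e2; exists d => // h /dP A.
rewrite -scalemxAr dotZl [X in `|X|](_ : _ =
  a * (f (x + h) + f (x - h) - 2 * f x - dot (h *m H) h)); last by ring.
rewrite normrM; apply: (@le_trans _ _ (`|a| * (eps / (`|a| + 1) * dot h h))).
  by apply: ler_wpM2l.
rewrite mulrA; apply: ler_wpM2r; first exact: dot_ge0.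
by rewrite mulrCA ger_pMr // ler_pdivrMr ?ltr_wpDl // mul1r lerDl.
Qed.

Lemma has_lapN f x L : has_lap f x L -> has_lap (fun y => - f y) x (- L).
Proof.
move=> /(has_lapZ (-1)); rewrite mulN1r.
by congr has_lap; apply/funext => y; rewrite mulN1r.
Qed.

Lemma has_lapB f g x L L' : has_lap f x L -> has_lap g x L' ->
  has_lap (fun y => f y - g y) x (L - L').
Proof. by move=> Hf Hg; apply: has_lapD => //; exact: has_lapN. Qed.

Lemma has_lap_affine x e a : has_lap (fun y => dot y e + a) x 0.
Proof.
exists 0; split; first exact: mxtrace0.
move=> eps e0; exists 1 => // h _; rewrite mulmx0 dot0l !dotE.
rewrite [X in `|X|](_ : _ = 0) ?normr0 ?mulr_ge0 ?dot_ge0 ?(ltW e0) //; ring.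
Qed.

Lemma mul_row_rank1 h e e' : h *m (e^T *m e') = dot h e *: e'.
Proof.
rewrite mulmxA; apply/rowP => j; rewrite !mxE big_ord1 mxE; congr (_ * _).
by apply: eq_bigr => i _; rewrite mxE.
Qed.

Lemma tr_rank1 e e' : \tr (e^T *m e') = dot e e'.
Proof. by apply: eq_bigr => i _; rewrite mxE big_ord1 mxE. Qed.

Lemma has_lap_sqr x e a : has_lap (fun y => (dot y e - a) ^+ 2) x (2 * dot e e).
Proof.
exists (2 *: (e^T *m e)); split; first by rewrite linearZ /= tr_rank1.
move=> eps e0; exists 1 => // h _.
rewrite -scalemxAr mul_row_rank1 !dotE (dotC e h).
rewrite [X in `|X|](_ : _ = 0) ?normr0 ?mulr_ge0 ?dot_ge0 ?(ltW e0) //; ring.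
Qed.

(** For a unit vector [e] this is the reflection in the hyperplane [dot x e = l]. *)
Definition refl e (l : R) x := x - (2 * (dot x e - l)) *: e.

(** The sign of the last term is the geometry behind moving planes: for [l >= 0], a point beyond the
    plane is reflected to a point no farther from the origin. *)
Lemma refl_sqr e l x : dot e e = 1 ->
  dot (refl e l x) (refl e l x) = dot x x - 4 * l * (dot x e - l).
Proof. by move=> e1; rewrite /refl !dotE (dotC e x) e1; ring. Qed.

(** The Householder matrix [S] is a symmetric involution, so [S H S] has the trace of [H] and [h S]
    has the norm of [h]; the radius [d] valid at the reflected point serves unchanged. *)
Lemma has_lap_refl f e l x L : dot e e = 1 -> has_lap f (refl e l x) L ->
  has_lap (fun y => f (refl e l y)) x L.
Proof.
move=> e1 [H [<- Hf]]; pose S : 'M[R]_N := 1%:M - 2 *: (e^T *m e).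
have hS h : h *m S = h - (2 * dot h e) *: e.
  by rewrite mulmxBr mulmx1 -scalemxAr mul_row_rank1 scalerA.
have SS : S *m S = 1%:M.
  apply/row_matrixP => i; rewrite !rowE mulmx1 mulmxA !hS !dotE e1 mulr1.
  rewrite -addrA -opprD -scalerDl [X in X *: e](_ : _ = 0) ?scale0r ?subr0 //; ring.
have sS h k : dot (h *m S) k = dot h (k *m S).
  by rewrite !hS !dotE (dotC e k); ring.
exists (S *m H *m S); split; first by rewrite mxtrace_mulC mulmxA SS mul1mx.
move=> eps /Hf[d d0 dP]; exists d => // h hd.
have nS : dot (h *m S) (h *m S) = dot h h by rewrite sS -mulmxA SS mulmx1.
have := dP (h *m S); rewrite enormE nS -enormE => /(_ hd).
have -> : dot (h *m (S *m H *m S)) h = dot (h *m S *m H) (h *m S).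
  by rewrite !mulmxA sS.
have -> : refl e l (x + h) = refl e l x + h *m S.
  by rewrite hS /refl !dotE; apply/rowP => i; rewrite !mxE; ring.
have -> : refl e l (x - h) = refl e l x - h *m S.
  by rewrite hS /refl !dotE; apply/rowP => i; rewrite !mxE; ring.
by [].
Qed.

Lemma has_lap_shift f c x L :
  has_lap f (x + c) L -> has_lap (fun y => f (y + c)) x L.
Proof.
move=> [H [HL Hf]]; exists H; split => // eps /Hf[d d0 dP]; exists d => // h /dP.
by rewrite !(addrAC x _ c).
Qed.

Lemma near_has_lap f g x L :
  (\forall y \near x, f y = g y) -> has_lap f x L -> has_lap g x L.
Proof.
move=> /nbhs_eballP[r r0 rP] [H [HL Hf]]; exists H; split => // eps /Hf[d d0 dP].
exists (Num.min d r); first by rewrite lt_min d0.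
move=> h; rewrite lt_min => /andP[hd hr].
rewrite -!rP; first exact: dP; rewrite /eball /= ?subrr ?enorm0 //.
- by rewrite [X in enorm X](_ : _ = - h) ?enormN //; apply/rowP => i; rewrite !mxE; ring.
- by rewrite [X in enorm X](_ : _ = h) //; apply/rowP => i; rewrite !mxE; ring.
Qed.

Lemma dot_delta h i : dot h (evec R i) = h 0 i.
Proof.
rewrite /dot (bigD1 i) //= mxE !eqxx mulr1 big1 ?addr0 // => j ji.
by rewrite mxE (negbTE ji) andbF mulr0.
Qed.

(** Along each coordinate axis the second difference at a minimum is nonnegative, so every diagonal
    entry of [H] is at least [- eps] for all [eps]. *)
Lemma has_lap_min f x L :
  has_lap f x L -> (\forall y \near x, f x <= f y) -> 0 <= L.
Proof.
move=> [H [<- Hf]] /nbhs_eballP[r r0 rP]; apply: sumr_ge0 => i _.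
apply/ler_addgt0Pr => eps /Hf[d d0 dP]; rewrite addrC.
pose t := Num.min d r / 2; have m0 : 0 < Num.min d r by rewrite lt_min d0.
have t0 : 0 < t by rewrite divr_gt0.
have ei : dot (evec R i) (evec R i) = 1 by rewrite dot_delta mxE !eqxx.
have en : enorm (t *: evec R i) = t.
  by rewrite enormZ enormE ei sqrtr1 mulr1 gtr0_norm.
have tm : t < Num.min d r by rewrite /t ltr_pdivrMr // mulr_natr mulr2n ltrDl.
move: (tm); rewrite lt_min => /andP[td tr].
have := dP (t *: evec R i); rewrite en => /(_ td).
have A : f x <= f (x + t *: evec R i) by apply: rP; rewrite /eball /= addrAC subrr add0r en.
have B : f x <= f (x - t *: evec R i).
  by apply: rP; rewrite /eball /= addrAC subrr add0r enormN en.
rewrite -scalemxAl !dotE ei dot_delta -rowE mxE mulr1 ler_norml => /andP[_ C].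
rewrite -(pmulr_rge0 _ (mulr_gt0 t0 t0)) mulrDr; lra.
Qed.

(** One mean value theorem in [t] reduces the second difference to first-order expansions of the
    partial derivatives at [x]. A possible asymmetry of the matrix is harmless, since
    [dot (h *m H) h] sees only its symmetric part. *)
Lemma C2_has_lap f (A : set 'rV[R]_N) x : open A -> A x ->
  (forall y, A y -> differentiable f y /\ forall i, differentiable (pd i f) y) ->
  has_lap f x (lap f x).
Proof.
move=> oA Ax C2; exists (\matrix_(i, j) pd j (pd i f) x); split.
  by apply: eq_bigr => i _; rewrite mxE.
move=> eps e0.
have [r r0 rA] : exists2 d, 0 < d & eball x d `<=` A.
  by apply/nbhs_eballP; exact: open_nbhs_nbhs.
have [d d0 dP] : exists2 d, 0 < d & forall h i, enorm h < d ->
    `|pd i f (x + h) - pd i f x - \sum_j h 0 j * pd j (pd i f) x|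
     <= eps / (2 * (N%:R + 1)) * enorm h.
  have e1 : 0 < eps / (2 * (N%:R + 1)) by rewrite divr_gt0 // mulr_gt0 // ltr_wpDl.
  have H i := diff_eps ((C2 x Ax).2 i) e1.
  have /choice[F FP] : forall i : 'I_N, exists d, 0 < d /\ forall h, enorm h < d ->
    `|pd i f (x + h) - pd i f x - \sum_j h 0 j * pd j (pd i f) x|
     <= eps / (2 * (N%:R + 1)) * enorm h.
    by move=> i; have [d d0 dP] := H i; exists d.
  exists (\big[Num.min/1]_i F i); first by apply: lt_bigmin => // i _; exact: (FP i).1.
  move=> h i hd; apply: (FP i).2; apply: lt_le_trans hd _; exact: bigmin_le.
exists (Num.min r d); first by rewrite lt_min r0.
move=> h; rewrite lt_min => /andP[hr hd].
set Q := dot _ h.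
(* Subtracting [Q t^2] makes [k 1 - k 0] exactly the quantity to be bounded. *)
pose k (t : R) := f (x + t *: h) + f (x + t *: (- h)) - Q * t ^+ 2.
pose k' (t : R) := \sum_i h 0 i * pd i f (x + t *: h) +
  \sum_i (- h) 0 i * pd i f (x + t *: (- h)) - Q * (2 * t).
have inA (t : R) (h' : 'rV[R]_N) : 0 <= t <= 1 -> enorm h' < r -> A (x + t *: h').
  move=> /andP[t0 t1] h'r; apply: rA; rewrite /eball /= addrAC subrr add0r enormZ.
  by rewrite ger0_norm //; apply: le_lt_trans h'r; rewrite ler_piMl ?enorm_ge0.
have kD (t : R) : 0 <= t <= 1 -> is_derive t 1 k (k' t).
  move=> t01; apply: is_deriveB; first apply: is_deriveD.
  - by apply: line_derive; apply: (C2 _ _).1; exact: inA.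
  - by apply: line_derive; apply: (C2 _ _).1; apply: inA; rewrite ?enormN.
  - by apply: is_derive_eq; rewrite /GRing.scale /=; ring.
have [||t0] := @MVT_segment _ k k' 0 1 ler01.
- by move=> t; rewrite in_itv /= => /andP[t0 t1]; apply: kD; rewrite !ltW.
- apply: derivable_within_continuous => t; rewrite in_itv /= => t01.
  by have := kD t t01 => -[].
rewrite in_itv /= => t01 kE.
move: kE; rewrite subr0 mulr1 /k !scale1r !scale0r !addr0 expr1n expr0n /= mulr0 mulr1 subr0 => kE.
rewrite (_ : _ - Q = k' t0); last by rewrite -kE; ring.
have [t0p t01'] := andP t01.
pose D i h' := pd i f (x + h') - pd i f x - \sum_j h' 0 j * pd j (pd i f) x.
have -> : k' t0 = \sum_i h 0 i * (D i (t0 *: h) - D i (t0 *: - h)).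
  have QE : Q = \sum_i h 0 i * \sum_j h 0 j * pd j (pd i f) x.
    rewrite /Q /dot; under eq_bigr do rewrite mxE mulr_suml.
    rewrite exchange_big; apply: eq_bigr => i _; rewrite mulr_sumr.
    by apply: eq_bigr => j _; rewrite mxE; ring.
  have Dl i (h' : 'rV[R]_N) : \sum_j (t0 *: h') 0 j * pd j (pd i f) x =
      t0 * \sum_j h' 0 j * pd j (pd i f) x.
    by rewrite mulr_sumr; apply: eq_bigr => j _; rewrite mxE mulrA.
  have Nl i : \sum_j (- h) 0 j * pd j (pd i f) x = - \sum_j h 0 j * pd j (pd i f) x.
    by rewrite -sumrN; apply: eq_bigr => j _; rewrite mxE mulNr.
  rewrite /k' QE mulr_suml -big_split -sumrB; apply: eq_bigr => i _ /=.
  by rewrite /D !Dl Nl mxE; ring.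
have bD i h' : enorm h' = enorm h ->
   `|D i (t0 *: h')| <= eps / (2 * (N%:R + 1)) * enorm h.
  move=> hh; have hle : enorm (t0 *: h') <= enorm h.
    by rewrite enormZ ger0_norm // hh ler_piMl ?enorm_ge0.
  apply: le_trans (dP _ i (le_lt_trans hle hd)) _.
  apply: ler_wpM2l hle; by rewrite divr_ge0 // ?ltW // mulr_gt0 // ltr_wpDl.
apply: le_trans (ler_norm_sum _ _ _) _.
apply: (@le_trans _ _ (\sum_(i < N) (eps / (N%:R + 1) * dot h h))).
  apply: ler_sum => i _; rewrite normrM.
  apply: (@le_trans _ _ (enorm h * (eps / (N%:R + 1) * enorm h))).
    apply: ler_pM => //; first exact: coord_le_enorm.
    apply: le_trans (ler_normB _ _) _.
    apply: le_trans (lerD (bD i h erefl) (bD i (- h) (enormN h))) _.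
    rewrite -mulrDl; apply: ler_wpM2r; first exact: enorm_ge0.
    rewrite le_eqVlt; apply/orP; left; apply/eqP; field.
    by rewrite lt0r_neq0 // ltr_wpDl.
  by rewrite -sqr_enorm le_eqVlt; apply/orP; left; apply/eqP; ring.
rewrite sumr_const card_ord -mulrnAl; apply: ler_wpM2r; first exact: dot_ge0.
rewrite -mulr_natl mulrA ler_pdivrMr ?ltr_wpDl //; lra.
Qed.

End HasLap.

(** * Radial functions *)

Section Radial.
Context {R : realType} {N : nat}.
Implicit Types (c x y : 'rV[R]_N) (a b r s : R).

(** The difference [g - f] vanishes near [x], hence has the zero differential by uniqueness of
    first-order expansions; [g] is [f] plus this difference. *)
Lemma near_eq_differentiable (f g : 'rV[R]_N -> R) x :
  (\forall y \near x, f y = g y) -> differentiable f x -> differentiable g x.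
Proof.
move=> fg df; have -> : g = f + (g - f) by rewrite addrC subrK.
apply: differentiableD => //; pose h : 'rV[R]_N -> R := g - f; rewrite -/h.
have h0 y : f y = g y -> h y = 0 by move=> fgy; rewrite /h !fctE fgy subrr.
have H : \forall y \near (0 : 'rV[R]_N), h (y + x) = 0.
  have /nbhs_eballP[d d0 dP] := fg; apply/nbhs_eballP; exists d => // y.
  by rewrite /eball /= subr0 => yd; apply/h0/dP; rewrite /eball /= addrK.
have hE : h \o shift x = cst (h x) + (\0 : 'rV[R]_N -> R) +o_ (0 : 'rV[R]_N) id.
  apply/eqaddoP => e e0; near=> y; rewrite !fctE /= (h0 x (nbhs_singleton fg)) addr0 subr0.
  by rewrite (near H y) // normr0 mulr_ge0 // ltW.
have c0 : continuous (\0 : 'rV[R]_N -> R) by apply: cst_continuous.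
have d0 := @diff_unique _ _ _ h (\0) x c0 hE.
by apply/diff_locallyP; rewrite d0.
Unshelve. all: by end_near. Qed.

Lemma comp_derive (V : R -> R) (g : 'rV[R]_N -> R) x i (dV dg : R) :
  differentiable g x -> is_derive x (evec R i) g dg -> is_derive (g x) 1 V dV ->
  differentiable (V \o g) x /\ is_derive x (evec R i) (V \o g) (dV * dg).
Proof.
move=> dfg Dg DV.
have dfV : differentiable V (g x) by apply/derivable1_diffP; case: DV.
have dVg : differentiable (V \o g) x by exact: differentiable_comp.
split=> //; apply: DeriveDef; first exact: diff_derivable.
rewrite deriveE // diff_comp //= -(@deriveE _ _ _ g) // (@derive_val _ _ _ _ _ _ _ Dg).
by rewrite deriv1E ?derive1E ?(@derive_val _ _ _ _ _ _ _ DV) 1?mulrC //; case: DV.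
Qed.

Lemma is_derive_inv (t : R) : t != 0 -> is_derive t 1 (fun s => s^-1) (- t ^- 2).
Proof.
move=> t0; apply: DeriveDef; first exact: derivableV.
by rewrite (@deriveV _ _ id) // derive_id /GRing.scale /= mulr1.
Qed.

Lemma differentiable_coordB c x i : differentiable (fun y => (y - c) 0 i) x.
Proof.
rewrite (_ : (fun _ => _) = (fun y : 'rV[R]_N => y 0 i) - cst (c 0 i)).
  by apply: differentiableB => //; exact: differentiable_coord.
by apply/funext => y; rewrite !fctE !mxE.
Qed.

Lemma is_derive_coordB c x i j :
  is_derive x (evec R i) (fun y => (y - c) 0 j) ((i == j)%:R).
Proof.
have -> : (fun y => (y - c) 0 j) = (fun y => dot y (evec R j) + - c 0 j).
  by apply/funext => y; rewrite dot_delta !mxE.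
have D (t : R) : dot (t *: evec R i + x) (evec R j) - c 0 j -
    (dot x (evec R j) - c 0 j) = t * (i == j)%:R.
  by rewrite !dot_delta !mxE eqxx /= eq_sym; ring.
have L : (fun t : R => t^-1 *: ((dot (t *: evec R i + x) (evec R j) - c 0 j) -
    (dot x (evec R j) - c 0 j))) @ 0^' --> ((i == j)%:R : R).
  apply: (@cvg_trans _ ((cst ((i == j)%:R : R)) @ (0 : R)^')).
    apply: near_eq_cvg; near=> t; rewrite /= D /GRing.scale /= mulKf //.
    by near: t; exact: nbhs_dnbhs_neq.
  exact: cvg_cst.
apply: DeriveDef; last exact: cvg_lim.
by apply/cvg_ex; exists ((i == j)%:R).
Unshelve. all: by end_near. Qed.

Lemma sqr_enorm_derive c x i :
  differentiable (fun y => dot (y - c) (y - c)) x /\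
  is_derive x (evec R i) (fun y => dot (y - c) (y - c)) (2 * (x - c) 0 i).
Proof.
have E : (fun y => dot (y - c) (y - c)) =
    \sum_(j < N) ((fun y => (y - c) 0 j) * (fun y => (y - c) 0 j)).
  by apply/funext => y; rewrite fct_sumE /dot; apply: eq_bigr => j _; rewrite fctE.
split; rewrite E.
  apply: differentiable_sum => j; apply: differentiableM; exact: differentiable_coordB.
have H j := is_deriveM (is_derive_coordB c x i j) (is_derive_coordB c x i j).
apply: is_derive_eq (is_derive_sum H) _ => /=.
rewrite (bigD1 i) //= eqxx big1 ?addr0 => [|j ji]; rewrite /GRing.scale /=.
  by ring.
by rewrite eq_sym (negbTE ji) !mulr0 addr0.
Qed.

Lemma enorm_derive c x i : x != c ->
  differentiable (fun y => enorm (y - c)) x /\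
  is_derive x (evec R i) (fun y => enorm (y - c)) ((x - c) 0 i / enorm (x - c)).
Proof.
move=> xc; have s0 : 0 < enorm (x - c) by rewrite enorm_gt0 subr_eq0.
have q0 : 0 < dot (x - c) (x - c) by rewrite -sqr_enorm exprn_gt0.
have [dq Dq] := sqr_enorm_derive c x i.
have -> : (fun y => enorm (y - c)) = Num.sqrt \o (fun y => dot (y - c) (y - c)).
  by apply/funext => y; rewrite enormE.
have [A B] := comp_derive dq Dq (is_derive1_sqrt q0); split=> //.
apply: is_derive_eq; rewrite -enormE; field; exact: lt0r_neq0.
Qed.

Variables (V V1 V2 : R -> R) (c : 'rV[R]_N) (a b : R).
Hypothesis a0 : 0 <= a.
Hypothesis DV : forall s, a < s < b -> is_derive s 1 V (V1 s).
Hypothesis DV1 : forall s, a < s < b -> is_derive s 1 V1 (V2 s).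

Let v y := V (enorm (y - c)).
Let A := [set y : 'rV[R]_N | a < enorm (y - c) < b].

Lemma open_shell : open A.
Proof.
rewrite (_ : A = [set y | a < enorm (y - c)] `&` [set y | enorm (y - c) < b]).
  by apply: openI; apply: open_lt; do ?[exact: enorm_sub_continuous | exact: cst_continuous].
by apply/seteqP; split=> y /= => [/andP // |[H K]]; apply/andP.
Qed.

Lemma shell_neq x : A x -> x != c.
Proof. by move=> /andP[/(le_lt_trans a0)]; rewrite enorm_gt0 subr_eq0. Qed.

Lemma radial_pd x i : A x -> differentiable v x /\
  pd i v x = V1 (enorm (x - c)) * ((x - c) 0 i / enorm (x - c)).
Proof.
move=> Ax; have [dq Dq] := enorm_derive i (shell_neq Ax).
by have [H [_ K]] := comp_derive dq Dq (DV Ax).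
Qed.

Lemma radial_pd2 x i j : A x -> differentiable (pd i v) x /\
  pd j (pd i v) x =
    (V2 (enorm (x - c)) - V1 (enorm (x - c)) / enorm (x - c)) *
      (((x - c) 0 i / enorm (x - c)) * ((x - c) 0 j / enorm (x - c)))
    + (i == j)%:R * (V1 (enorm (x - c)) / enorm (x - c)).
Proof.
move=> Ax; have [dq Dq] := enorm_derive j (shell_neq Ax).
have s0 : 0 < enorm (x - c) by rewrite enorm_gt0 subr_eq0 shell_neq.
have sn0 : enorm (x - c) != 0 by exact: lt0r_neq0.
have [d1 D1] := comp_derive dq Dq (DV1 Ax).
have [d2 D2] := comp_derive dq Dq (is_derive_inv sn0).
(* The formula for [pd i v] is valid only in the shell, so the second derivative is taken of [g] and
   transferred by local equality. *)
pose g := ((V1 \o (fun y => enorm (y - c))) * (fun y => (y - c) 0 i)) *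
  (((fun t => t^-1) : R -> R) \o (fun y => enorm (y - c))).
have near_g : \forall y \near x, g y = pd i v y.
  near=> y; have [|_ ->] := @radial_pd y i; last by rewrite /g !fctE /= mulrA.
  by near: y; apply: open_nbhs_nbhs; split=> //; exact: open_shell.
have dg : differentiable g x.
  apply: differentiableM => //; apply: differentiableM => //; exact: differentiable_coordB.
have Dg := is_deriveM (is_deriveM D1 (is_derive_coordB c x j i)) D2.
split.
  exact: near_eq_differentiable near_g dg.
rewrite /pd -(near_eq_derive _ near_g) (@derive_val _ _ _ _ _ _ _ Dg).
rewrite /GRing.scale !fctE /= eq_sym; field.
exact: sn0.
Unshelve. all: by end_near. Qed.

Lemma radial_lap x : A x ->
  lap v x = V2 (enorm (x - c)) + (N%:R - 1) * (V1 (enorm (x - c)) / enorm (x - c)).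
Proof.
move=> Ax; have s0 : 0 < enorm (x - c) by rewrite enorm_gt0 subr_eq0 shell_neq.
have sn0 : enorm (x - c) != 0 by exact: lt0r_neq0.
set s := enorm (x - c) in s0 sn0 *.
rewrite /lap; under eq_bigr => i _ do rewrite (radial_pd2 i i Ax).2 eqxx mul1r.
rewrite big_split /= -mulr_sumr sumr_const card_ord -mulr_natl.
rewrite (_ : \sum_(i < N) _ = 1) ?mulr1 -/s; first by ring.
under eq_bigr => i _ do rewrite mulf_div.
by rewrite -mulr_suml -/(dot _ _) -sqr_enorm expr2 -/s divff ?mulf_neq0.
Qed.

End Radial.

(** * Maximum principles *)

Section Continuity.
Context {R : realType} {T : topologicalType}.
Implicit Types f g : T -> R.

Lemma contD f g : continuous f -> continuous g -> continuous (fun x => f x + g x).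
Proof. by move=> cf cg x; apply: cvgD; [exact: cf | exact: cg]. Qed.

Lemma contM f g : continuous f -> continuous g -> continuous (fun x => f x * g x).
Proof. by move=> cf cg x; apply: cvgM; [exact: cf | exact: cg]. Qed.

Lemma contB f g : continuous f -> continuous g -> continuous (fun x => f x - g x).
Proof. by move=> cf cg x; apply: cvgB; [exact: cf | exact: cg]. Qed.

Lemma contX f n : continuous f -> continuous (fun x => f x ^+ n).
Proof.
move=> cf x; apply: (@continuous_comp _ _ _ f (fun t => t ^+ n)); first exact: cf.
exact: exprn_continuous.
Qed.

End Continuity.

Section MaxPrinciple.
Context {R : realType} {N : nat}.
Implicit Types (c x y z e h : 'rV[R]_N) (a b r s L : R) (K : set 'rV[R]_N)
  (f g : 'rV[R]_N -> R).

(** Boundary values enter only through the requirement that negative points are interior to [K], so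
    the boundary of [K] never has to be described. *)
Lemma min_principle K f : compact K -> continuous f ->
  (forall x, K x -> f x < 0 ->
     (\forall y \near x, K y) /\ exists2 L, L < 0 & has_lap f x L) ->
  forall x, K x -> 0 <= f x.
Proof.
move=> cK cf H x Kx.
have [z] := compact_EVT_min (ex_intro _ x Kx) cK (continuous_subspaceT cf).
rewrite inE => Kz zmin; have {}zmin y : K y -> f z <= f y.
  by move=> Ky; apply: zmin; rewrite inE.
apply: le_trans (zmin _ Kx); rewrite leNgt; apply/negP => fz.
have [nK [L L0 /has_lap_min]] := H z Kz fz.
rewrite leNgt L0 => /(_ _)/negP; apply => //.
by apply: filterS nK => y /zmin.
Qed.

(* With [-m = min f], the function [f - C m ((x.e - a)^2 - s)] is nonnegative,
   which at the minimum point of [f] contradicts [C s < 1]. *)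
Lemma strip_principle K f e a s C : compact K -> continuous f ->
  dot e e = 1 -> 0 < C -> C * s < 1 ->
  (forall x, K x -> (dot x e - a) ^+ 2 <= s) ->
  (forall x, K x -> f x < 0 ->
     (\forall y \near x, K y) /\ exists2 L, L <= - C * f x & has_lap f x L) ->
  forall x, K x -> 0 <= f x.
Proof.
move=> cK cf e1 C0 Cs Ks H x Kx.
have [z] := compact_EVT_min (ex_intro _ x Kx) cK (continuous_subspaceT cf).
rewrite inE => Kz zmin; have {}zmin y : K y -> f z <= f y.
  by move=> Ky; apply: zmin; rewrite inE.
apply: le_trans (zmin _ Kx); rewrite leNgt; apply/negP => fz.
pose g y := f y + (C * f z) * ((dot y e - a) ^+ 2 - s).
have Cm : C * f z < 0 by rewrite pmulr_rlt0.
have fg y : K y -> f y <= g y.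
  by move=> Ky; rewrite /g lerDl nmulr_rge0 // subr_le0 Ks.
have : 0 <= g z.
  apply: (@min_principle K) => //.
    apply: contD => //; apply: contM; first exact: cst_continuous.
    apply: contB; last exact: cst_continuous.
    by apply: contX; apply: contB; [exact: dot_continuous | exact: cst_continuous].
  move=> y Ky gy; have fy : f y < 0 by apply: le_lt_trans (fg _ Ky) gy.
  have [nK [L LC fL]] := H y Ky fy; split=> //.
  exists (L + C * f z * (2 * dot e e)).
    by rewrite e1; have := zmin y Ky; have := ler_wpM2l (ltW C0) (zmin y Ky); lra.
  have := has_lapD fL (has_lapZ (C * f z) (has_lapD (has_lap_sqr y e a) (has_lap_affine y 0 (- s)))).
  rewrite addr0; congr has_lap; apply/funext => w; rewrite /g (dotC w 0) dot0l; ring.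
rewrite /g leNgt => /negP; apply.
have : C * f z * ((dot z e - a) ^+ 2 - s) <= C * f z * (- s).
  by rewrite ler_nM2l //; have := sqr_ge0 (dot z e - a); lra.
have : C * s * - f z < 1 * - f z by rewrite ltr_pM2r // oppr_gt0.
lra.
Qed.

(** At a negative point [L <= 0 <= - C * f x] for every positive [C], so the whole ball counts as a
    strip of half-width [r], thin enough once [C = 1 / (r^2 + 1)]. *)
Lemma weak_principle K f r (i0 : 'I_N) : compact K -> continuous f ->
  K `<=` ecball 0 r ->
  (forall x, K x -> f x < 0 ->
     (\forall y \near x, K y) /\ exists2 L, L <= 0 & has_lap f x L) ->
  forall x, K x -> 0 <= f x.
Proof.
move=> cK cf Kr H.
have C0 : 0 < (r ^+ 2 + 1)^-1 by rewrite invr_gt0 ltr_wpDl ?sqr_ge0.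
apply: (@strip_principle K f (evec R i0) 0 (r ^+ 2) _ cK cf _ C0).
- by rewrite dot_delta mxE !eqxx.
- by rewrite mulrC ltr_pdivrMr ?ltr_wpDl ?sqr_ge0 // mul1r ltrDl.
- move=> x /Kr; rewrite /ecball /= !subr0 => xr.
  have r0 : 0 <= r by apply: le_trans xr; exact: enorm_ge0.
  rewrite -[leLHS]real_normK ?num_real // ler_pXn2r ?nnegrE ?normr_ge0 //.
  by rewrite dot_delta; apply: le_trans (coord_le_enorm _ _) xr.
- move=> x Kx fx; have [nK [L L0 fL]] := H x Kx fx; split=> //; exists L => //.
  by apply: le_trans L0 _; rewrite mulNr -mulrN mulr_ge0 ?oppr_ge0 ?(ltW C0) ?(ltW fx).
Qed.


Lemma is_derive_pow (g : R -> R) (s dg : R) n : is_derive s 1 g dg ->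
  is_derive s 1 (fun t => g t ^+ n) (n%:R * g s ^+ n.-1 * dg).
Proof.
move=> Dg; rewrite (_ : (fun t => g t ^+ n) = g ^+ n).
  exact: is_derive_eq (is_deriveX n Dg) _.
by apply/funext => t; rewrite exprfctE.
Qed.

(** A polynomial substitute for the exponential barrier of Hopf. With [d = r^2 - s^2] the Laplacian
    is [2 (m + 2) d^m (2 (m + 1) s^2 - N d)], and the hypothesis on [m] makes the bracket
    nonnegative outside radius [rho]. The exponent [m + 2] leaves a natural power after two
    derivatives. *)
Lemma barrier_lap y r rho (m : nat) x : 0 < rho ->
  N%:R * r ^+ 2 <= m.+1%:R * rho ^+ 2 ->
  rho < enorm (x - y) < r ->
  exists2 L, 0 <= L & has_lap (fun z => (r ^+ 2 - enorm (z - y) ^+ 2) ^+ m.+2) x L.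
Proof.
move=> rho0 hm hx; have /andP[h1 h2] := hx.
pose V (s : R) := (r ^+ 2 - s ^+ 2) ^+ m.+2.
pose V1 (s : R) := - (m.+2%:R * 2 * (s * (r ^+ 2 - s ^+ 2) ^+ m.+1)).
pose V2 (s : R) := - (m.+2%:R * 2 * ((r ^+ 2 - s ^+ 2) ^+ m.+1 -
   s * (m.+1%:R * (2 * s) * (r ^+ 2 - s ^+ 2) ^+ m))).
have D0 (s : R) : is_derive s 1 (fun t => r ^+ 2 - t ^+ 2) (- (2 * s)).
  by apply: is_derive_eq; rewrite /GRing.scale /=; ring.
have DV s : rho < s < r -> is_derive s 1 V (V1 s).
  move=> _; apply: is_derive_eq (is_derive_pow m.+2 (D0 s)) _.
  by rewrite /V1 /GRing.scale /=; ring.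
have DV1 s : rho < s < r -> is_derive s 1 V1 (V2 s).
  move=> _; apply: is_derive_eq (is_deriveN (is_deriveZ (m.+2%:R * 2)
    (is_deriveM (is_derive_id s 1) (is_derive_pow m.+1 (D0 s))))) _.
  by rewrite /V2 /GRing.scale /=; ring.
exists (lap (fun z => V (enorm (z - y))) x); last first.
  apply: (C2_has_lap (f := fun z => V (enorm (z - y))) (@open_shell R N y rho r) hx) => z hz; split.
    (* The radial calculus asks for a coordinate index; if there is none, the norm vanishes
       identically and the shell is empty. *)
    have [i0|N0] := pselect (inhabited 'I_N).
      by case: i0 => i0; exact: (radial_pd (ltW rho0) DV i0 hz).1.
    have : enorm (z - y) = 0.
      rewrite enormE /dot big1 ?sqrtr0 // => i; case: N0; exact: inhabits.
    by move: hz => /andP[+ _] => /(lt_trans rho0)/gt_eqF/eqP.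
  by move=> i; exact: (radial_pd2 (ltW rho0) DV DV1 i i hz).1.
rewrite (radial_lap (ltW rho0) DV DV1 hx) /V2 /V1; set s := enorm _ in hx h1 h2 *.
have s0 : 0 < s by apply: lt_trans h1.
set d := r ^+ 2 - s ^+ 2.
have d0 : 0 <= d by rewrite subr_ge0 ler_pXn2r ?nnegrE ?ltW // (lt_trans s0).
rewrite [leRHS](_ : _ = 2 * m.+2%:R * d ^+ m * (2 * (m.+1%:R * s ^+ 2) - N%:R * d)); last first.
  by rewrite !(exprS d m); field; exact: lt0r_neq0.
apply: mulr_ge0; first by rewrite mulr_ge0 // exprn_ge0.
have : m.+1%:R * rho ^+ 2 <= m.+1%:R * s ^+ 2.
  by rewrite ler_pM2l // ler_pXn2r ?nnegrE ?ltW.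
have : N%:R * d <= N%:R * r ^+ 2 by rewrite ler_wpM2l // /d gerBl sqr_ge0.
have : 0 <= m.+1%:R * s ^+ 2 by rewrite mulr_ge0 // sqr_ge0.
lra.
Qed.

(** By continuity [f] stays above [f y / 2] on a small ball around [y]. On the remaining annulus it
    dominates [eps * b], which vanishes on the outer sphere; [eps] is normalised so that
    [eps * b <= f y / 2] everywhere. *)
Lemma strong_principle_ball f y r (i0 : 'I_N) : 0 < r -> continuous f ->
  (forall x, ecball y r x -> 0 <= f x) ->
  (forall x, eball y r x -> exists2 L, L <= 0 & has_lap f x L) ->
  0 < f y -> forall x, eball y r x -> 0 < f x.
Proof.
move=> r0 cf f0 Hf fy x xr.
have [rho [rho0 rhor rhoP]] : exists rho, [/\ 0 < rho, rho < r &
    forall z, ecball y rho z -> f y / 2 <= f z].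
  have : \forall z \near y, f y / 2 < f z.
    apply: open_nbhs_nbhs; split; last by lra.
    by apply: open_lt => //; exact: cst_continuous.
  move=> /nbhs_eballP[d d0 dP]; pose t := Num.min d r / 2.
  have m0 : 0 < Num.min d r by rewrite lt_min d0.
  have tm : t < Num.min d r by rewrite /t; lra.
  move: tm; rewrite lt_min => /andP[td tr].
  exists t; split=> //; first by rewrite /t; lra.
  by move=> z zt; apply/ltW/dP; apply: le_lt_trans td.
have [|xrho] := leP (enorm (x - y)) rho; first by move=> /rhoP; apply: lt_le_trans; lra.
have [m hm] : exists m : nat, N%:R * r ^+ 2 <= m.+1%:R * rho ^+ 2.
  have h : 0 <= N%:R * r ^+ 2 / rho ^+ 2.
    by rewrite divr_ge0 ?sqr_ge0 // mulr_ge0 ?sqr_ge0.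
  have := archi_boundP h; set k := Num.bound _ => hk.
  exists k; rewrite -ler_pdivrMr ?exprn_gt0 //; apply: ltW; apply: lt_trans hk _.
  by rewrite ltr_nat.
pose b z := (r ^+ 2 - enorm (z - y) ^+ 2) ^+ m.+2.
pose eps := f y / 2 / (r ^+ 2) ^+ m.+2.
have R0 : 0 < (r ^+ 2) ^+ m.+2 by rewrite !exprn_gt0.
have eps0 : 0 < eps by rewrite divr_gt0 // divr_gt0.
have bE z : enorm (z - y) <= r -> 0 <= eps * b z <= f y / 2.
  move=> zr; have h : 0 <= r ^+ 2 - enorm (z - y) ^+ 2.
    by rewrite subr_ge0 ler_pXn2r ?nnegrE ?enorm_ge0 // ltW.
  rewrite mulr_ge0 ?exprn_ge0 ?(ltW eps0) //= /eps mulrAC -mulrA ger_pMr ?divr_gt0 //.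
  rewrite ler_pdivrMr // mul1r ler_pXn2r ?nnegrE ?sqr_ge0 //.
  by rewrite gerBl sqr_ge0.
pose K := [set z | rho <= enorm (z - y)] `&` ecball y r.
have cK : compact K.
  rewrite /K setIC; apply: compact_closedI; first exact: compact_ecball.
  by apply: closed_le; [exact: cst_continuous | exact: enorm_sub_continuous].
have : 0 <= f x - eps * b x.
  apply: (@weak_principle K (fun z => f z - eps * b z) (r + enorm y) i0) => //.
  - apply: contB => //; apply: contM; first exact: cst_continuous.
    apply: contX; apply: contB; first exact: cst_continuous.
    by apply: contX; exact: enorm_sub_continuous.
  - move=> z [_]; rewrite /ecball /= subr0 => zr.
    by have := enormD (z - y) y; rewrite subrK; lra.
  - move=> z [/= z1 z2] fz.
    have z1' : rho < enorm (z - y).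
      rewrite lt_neqAle z1 andbT; apply/eqP => zE.
      have := rhoP z; rewrite /ecball /= -zE lexx => /(_ isT).
      by have /andP[_] := bE z z2; lra.
    have z2' : enorm (z - y) < r.
      rewrite lt_neqAle; apply/andP; split=> //; apply/eqP => zE.
      have := f0 z z2; move: fz; rewrite /b zE subrr expr0n /= mulr0 subr0; lra.
    have hz : rho < enorm (z - y) < r by rewrite z1'.
    split.
      have : nbhs z [set y0 | rho < enorm (y0 - y) < r].
        by apply: open_nbhs_nbhs; split=> //; exact: open_shell.
      by apply: filterS => t /= /andP[t1 t2]; split; exact: ltW.
    have [L L0 fL] := Hf z z2'; have [L' L'0 bL] := barrier_lap rho0 hm hz.
    exists (L - eps * L'); last exact: has_lapB fL (has_lapZ eps bL).
    by have := mulr_ge0 (ltW eps0) L'0; lra.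
  - by split; [exact: ltW | exact: ltW].
have : 0 < eps * b x.
  rewrite mulr_gt0 // exprn_gt0 // subr_gt0 ltr_pXn2r ?nnegrE ?enorm_ge0 //.
  exact: ltW.
lra.
Qed.

(** Positivity spreads along the segment from [x0] by a chain of balls of radius [r - M], which fit
    into the domain because the segment stays in the ball of radius [M]. The induction counts steps
    of length at most [d], half that radius; [t = n / (n + 1)] selects the last but one point of the
    chain. *)
Lemma strong_principle f r (i0 : 'I_N) x0 : continuous f ->
  (forall x, ecball 0 r x -> 0 <= f x) ->
  (forall x, eball 0 r x -> exists2 L, L <= 0 & has_lap f x L) ->
  eball 0 r x0 -> 0 < f x0 -> forall x, eball 0 r x -> 0 < f x.
Proof.
move=> cf f0 Hf; rewrite /eball /ecball /= in f0 Hf *; rewrite subr0 => x0r fx0 z; rewrite subr0 => zr.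
pose M := Num.max (enorm x0) (enorm z).
have Mr : M < r by rewrite gt_max x0r.
pose d := (r - M) / 2; have d0 : 0 < d by rewrite divr_gt0 // subr_gt0.
have H (n : nat) x : enorm x <= M -> enorm (x - x0) <= n%:R * d -> 0 < f x.
  elim: n x => [|n IH] x xM xn.
    move: xn; rewrite mul0r => xn.
    have /eqP : enorm (x - x0) == 0 by rewrite eq_le xn enorm_ge0.
    by move/eqP; rewrite enorm_eq0 subr_eq0 => /eqP ->.
  pose t : R := n%:R / n.+1%:R.
  have n1 : (n.+1%:R : R) != 0 by rewrite pnatr_eq0.
  have t01 : 0 <= t <= 1.
    by rewrite divr_ge0 //= ler_pdivrMr ?ltr0n // mul1r ler_nat.
  pose x' := (1 - t) *: x0 + t *: x.
  have x'M : enorm x' <= M.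
    have /andP[t0 t1] := t01; apply: le_trans (enormD _ _) _.
    rewrite !enormZ !ger0_norm // ?subr_ge0 //.
    have A : (1 - t) * enorm x0 <= (1 - t) * M.
      by apply: ler_wpM2l; rewrite ?subr_ge0 // le_max lexx.
    have B : t * enorm x <= t * M by exact: ler_wpM2l.
    by lra.
  have fx' : 0 < f x'.
    apply: IH => //; rewrite (_ : x' - x0 = t *: (x - x0)).
      have /andP[t0 t1] := t01; rewrite enormZ ger0_norm //.
      by apply: le_trans (ler_wpM2l t0 xn) _; rewrite /t mulrA divfK.
    by apply/rowP => i; rewrite !mxE; ring.
  apply: (@strong_principle_ball f x' (r - M) i0) => //.
  - by rewrite subr_gt0.
  - move=> y; rewrite /ecball /= => yx'; apply: f0; rewrite subr0.
    by have := enormD (y - x') x'; rewrite subrK; lra.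
  - move=> y; rewrite /eball /= => yx'; apply: Hf; rewrite subr0.
    by have := enormD (y - x') x'; rewrite subrK; lra.
  rewrite /eball /= (_ : x - x' = (n.+1%:R)^-1 *: (x - x0)).
    rewrite enormZ ger0_norm // ltr_pdivrMl ?ltr0n //.
    apply: le_lt_trans xn _; rewrite ltr_pM2l ?ltr0n // /d; lra.
  apply/rowP => i; rewrite !mxE /t -natr1; field.
  by rewrite natr1.
have h : 0 <= enorm (z - x0) / d by rewrite divr_ge0 ?enorm_ge0 // ltW.
have := archi_boundP h; set k := Num.bound _ => hk.
by apply: (H k); [rewrite le_max lexx orbT | rewrite -ler_pdivrMr // ltW].
Qed.

End MaxPrinciple.

(** * Moving planes *)

Section MovingPlanes.
Context {R : realType} {N : nat}.
Variables (F : R -> R) (r : R) (w : 'rV[R]_N -> R) (i0 : 'I_N).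
Hypothesis r0 : 0 < r.
Hypothesis F0 : forall t, 0 <= F t.
Hypothesis Fmono : {homo F : s t / s <= t}.
Hypothesis Flip : forall M, exists2 C, 0 < C &
  forall s t, s <= t -> t <= M -> F t - F s <= C * (t - s).
Hypothesis wc : continuous w.
Hypothesis w_out : forall x, r <= enorm x -> w x = 0.
Hypothesis w_lap : forall x, enorm x < r -> has_lap w x (- F (w x)).

Lemma w_bounded : exists M, forall x, w x <= M.
Proof.
have ne : ecball (0 : 'rV[R]_N) r !=set0.
  by exists 0; rewrite /ecball /= subr0 enorm0 ltW.
have [z _ zP] := compact_EVT_max ne (@compact_ecball _ _ 0 r) (continuous_subspaceT wc).
exists (Num.max (w z) 0) => x; have [xr|xr] := leP (enorm x) r.
  by rewrite le_max zP // inE /ecball /= subr0.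
by rewrite (w_out (ltW xr)) le_max lexx orbT.
Qed.

Lemma w_ge0 x : 0 <= w x.
Proof.
have [xr|xr] := leP (enorm x) r; last by rewrite w_out // ltW.
apply: (@weak_principle _ _ (ecball 0 r) w r i0) => //; first exact: compact_ecball.
  move=> y; rewrite /ecball /= subr0 => yr wy.
  have yr' : enorm y < r.
    by rewrite lt_neqAle yr andbT; apply/eqP => yE; rewrite w_out ?yE ?ltxx // in wy.
  split.
    have : nbhs y (eball 0 r).
      by apply: open_nbhs_nbhs; split; [exact: open_eball | rewrite /eball /= subr0].
    by apply: filterS => z; rewrite /eball /= => /ltW.
  by exists (- F (w y)); rewrite ?oppr_le0 //; exact: w_lap.
by rewrite /ecball /= subr0.
Qed.

Variable (e : 'rV[R]_N).
Hypothesis e1 : dot e e = 1.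

Lemma enorm_refl l x : 0 <= l -> l <= dot x e -> enorm (refl e l x) <= enorm x.
Proof.
move=> l0 lx; rewrite enorm_le ?enorm_ge0 // sqr_enorm refl_sqr //.
by rewrite gerBl mulr_ge0 ?mulr_ge0 // subr_ge0.
Qed.

Lemma refl_id l x : dot x e = l -> refl e l x = x.
Proof. by move=> <-; rewrite /refl subrr mulr0 scale0r subr0. Qed.

(** Lipschitz in the point and in the position of the plane at once: continuity for a fixed plane
    and the passage to neighbouring planes both rest on it. *)
Lemma refl_dist l m x y :
  enorm (refl e m y - refl e l x) <= enorm (y - x) + 2 * `|m - l|.
Proof.
have -> : refl e m y - refl e l x = refl e 0 (y - x) + (2 * (m - l)) *: e.
  by rewrite /refl !dotE; apply/rowP => i; rewrite !mxE; ring.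
apply: le_trans (enormD _ _) _.
rewrite enormZ normrM (ger0_norm (ler0n _ _)) [enorm e]enormE e1 sqrtr1 mulr1 lerD2r.
by rewrite enorm_le ?enorm_ge0 // sqr_enorm refl_sqr // mulr0 mul0r subr0.
Qed.

Lemma cont_refl l : continuous (fun x => w (refl e l x)).
Proof.
move=> x; have wx := @wc (refl e l x).
move=> A /wx /nbhs_eballP[d d0 dA]; apply/nbhs_eballP; exists d => // y yd.
apply: dA; rewrite /eball /=; apply: le_lt_trans (refl_dist _ _ _ _) _.
by rewrite subrr normr0 mulr0 addr0.
Qed.

(** The cap is the outer one, so for [l >= 0] its reflection stays inside the ball, where the
    equation holds. *)
Definition cap_le l := forall x, enorm x <= r -> l <= dot x e -> w x <= w (refl e l x).

Lemma cap_lap l x : 0 <= l -> l <= dot x e -> enorm x < r ->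
  has_lap (fun y => w (refl e l y) - w y) x (F (w x) - F (w (refl e l x))).
Proof.
move=> l0 lx xr.
have H : has_lap (fun y => w (refl e l y)) x (- F (w (refl e l x))).
  apply: has_lap_refl => //; apply: w_lap; apply: le_lt_trans xr.
  exact: enorm_refl.
by have := has_lapB H (w_lap xr); rewrite opprK addrC.
Qed.

Lemma compact_cap l : compact [set x | enorm x <= r /\ l <= dot x e].
Proof.
rewrite (_ : mkset _ = ecball 0 r `&` [set x | l <= dot x e]); last first.
  by apply/seteqP; split=> x /=; rewrite /ecball /= subr0.
apply: compact_closedI; first exact: compact_ecball.
by apply: closed_le; [exact: cst_continuous | exact: dot_continuous].
Qed.

Lemma near_cap l x : enorm x < r -> l < dot x e ->
  \forall y \near x, enorm y <= r /\ l <= dot y e.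
Proof.
move=> xr lx.
have : nbhs x (eball 0 r `&` [set y | l < dot y e]).
  apply: open_nbhs_nbhs; split; last by split => //; rewrite /eball /= subr0.
  apply: openI; first exact: open_eball.
  by apply: open_lt; [exact: cst_continuous | exact: dot_continuous].
by apply: filterS => y []; rewrite /eball /= subr0 => /ltW ? /ltW.
Qed.

Hypothesis w_pos : forall x, enorm x < r -> 0 < w x.

Lemma enorm_refl_lt l x : 0 < l -> l < dot x e -> enorm (refl e l x) < enorm x.
Proof.
move=> l0 lx; rewrite enorm_lt ?enorm_ge0 // sqr_enorm refl_sqr //.
by rewrite gtrBl mulr_gt0 ?mulr_gt0 // subr_gt0.
Qed.

(* On the part of the sphere with [x.e >= l + eta] the difference of [w] and its
   reflection is bounded below, hence it dominates a small multiple of the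
   harmonic function [x.e - l - eta]. *)
Lemma cap_lt l x : 0 < l -> cap_le l -> enorm x <= r -> l < dot x e ->
  w x < w (refl e l x).
Proof.
move=> l0 Pl xr lx; have [xr'|xr'] := eqVneq (enorm x) r.
  rewrite w_out ?xr' // w_pos //; rewrite -xr'; exact: enorm_refl_lt.
pose eta := (dot x e - l) / 2; have eta0 : 0 < eta by rewrite divr_gt0 // subr_gt0.
pose phi y := w (refl e l y) - w y.
have phic : continuous phi by apply: contB => //; exact: cont_refl.
pose K := [set y : 'rV[R]_N | enorm y <= r /\ l + eta <= dot y e].
have phi0 y : K y -> 0 <= phi y.
  by move=> [y1 y2]; rewrite subr_ge0; apply: Pl => //; apply: le_trans y2; lra.
have [m m0 mP] : exists2 m, 0 < m & forall y, K y -> enorm y = r -> m <= phi y.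
  pose S := K `&` [set y | r <= enorm y].
  have cS : compact S.
    apply: compact_closedI; first exact: compact_cap.
    apply: closed_le; first exact: cst_continuous.
    by have := @enorm_sub_continuous R N 0; under eq_fun do rewrite subr0.
  have [S0|/set0P S0] := eqVneq S set0.
    exists 1 => // y Ky yr; exfalso; suff : S y by rewrite S0.
    by split; rewrite /= ?yr.
  have [z] := compact_EVT_min S0 cS (continuous_subspaceT phic).
  rewrite inE => -[[z1 z2] z3] zP; exists (phi z).
    have lz : l < dot z e by apply: lt_le_trans z2; lra.
    rewrite /phi (w_out z3) subr0 w_pos //; apply: lt_le_trans z1.
    exact: enorm_refl_lt.
  by move=> y Ky yr; apply: zP; rewrite inE; split; rewrite /= ?yr.
pose eps := m / (2 * r); have eps0 : 0 < eps by rewrite divr_gt0 // mulr_gt0.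
pose psi y := phi y - eps * (dot y e - (l + eta)).
have : 0 <= psi x.
  apply: (@weak_principle _ _ K psi r i0) => //; first exact: compact_cap.
  - apply: contB => //; apply: contM; first exact: cst_continuous.
    by apply: contB; [exact: dot_continuous | exact: cst_continuous].
  - by move=> y [yr _]; rewrite /ecball /= subr0.
  - move=> y [yr ye] psiy.
    have yr' : enorm y < r.
      rewrite lt_neqAle yr andbT; apply/eqP => yE.
      have := mP y (conj yr ye) yE; move: psiy; rewrite /psi.
      have : eps * (dot y e - (l + eta)) <= eps * (2 * r).
        rewrite ler_pM2l //; have := dot_le y e.
        rewrite [enorm e]enormE e1 sqrtr1 mulr1; lra.
      rewrite {2}/eps divfK ?lt0r_neq0 // ?mulr_gt0 //; lra.
    have ye' : l + eta < dot y e.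
      rewrite lt_neqAle ye andbT; apply/eqP => yE; move: psiy.
      by rewrite /psi -yE subrr mulr0 subr0 ltNge phi0.
    split; first exact: near_cap.
    exists (F (w y) - F (w (refl e l y)) - eps * 0).
      by rewrite mulr0 subr0 subr_le0 Fmono // -subr_ge0 phi0.
    apply: has_lapB; first by apply: cap_lap => //; [exact: ltW | apply: le_trans ye; lra].
    exact: has_lapZ (has_lap_affine _ _ _).
  - by split=> //; rewrite /eta; lra.
rewrite /psi /phi => h.
have : 0 < eps * (dot x e - (l + eta)) by rewrite mulr_gt0 // /eta; lra.
lra.
Qed.

(** At depth at least [eta] beyond the plane the inequality is strict on a compact set, hence
    survives a small move of the plane. What is left of the new cap is a slab of half-width at most
    [eta] around level [l], and there the Lipschitz bound on [F] feeds the strip principle. The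
    choice [eta = 1 / (C + 1)] gives [C * eta^2 < 1]. *)
Lemma cap_open l : 0 < l -> cap_le l ->
  exists2 d, 0 < d & forall m, l - d < m < l -> 0 < m -> cap_le m.
Proof.
move=> l0 Pl; have [M wM] := w_bounded; have [C C0 CP] := Flip M.
pose eta := (C + 1)^-1; have eta0 : 0 < eta by rewrite invr_gt0 ltr_wpDl // ltW.
have Ceta : C * eta ^+ 2 < 1.
  rewrite /eta exprVn ltr_pdivrMr ?exprn_gt0 ?ltr_wpDl ?(ltW C0) //.
  have := sqr_ge0 C; lra.
pose K := [set y : 'rV[R]_N | enorm y <= r /\ l + eta <= dot y e].
(* Pointwise strictness gives a product neighbourhood in the point and the plane position;
   compactness of [K] makes the range of planes uniform. *)
have near_pos : \forall m \near l, K `<=` (fun y => 0 < w (refl e m y) - w y).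
  have nc := (compact_near_coveringP K).1 (@compact_cap (l + eta)).
  apply: (nc R (nbhs l) (fun m y => 0 < w (refl e m y) - w y)) => //.
  move=> x [xr xe]; have lx : l < dot x e by apply: lt_le_trans xe; lra.
  have := cap_lt l0 Pl xr lx; set A := w _; set B := w _ => AB.
  have c2 : (A + B) / 2 < B by lra.
  have c1 : A < (A + B) / 2 by lra.
  have : nbhs x [set z | w z < (A + B) / 2].
    by apply: open_nbhs_nbhs; split => //; apply: open_lt => //; exact: cst_continuous.
  move=> /nbhs_eballP[d1 d10 d1P].
  have : nbhs (refl e l x) [set z | (A + B) / 2 < w z].
    by apply: open_nbhs_nbhs; split => //; apply: open_lt => //; exact: cst_continuous.
  move=> /nbhs_eballP[d2 d20 d2P].
  exists (eball x (Num.min d1 (d2 / 2)), ball l (d2 / 4)).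
    split => /=; last by apply: nbhsx_ballx; rewrite divr_gt0.
    by apply/nbhs_eballP; exists (Num.min d1 (d2 / 2)); rewrite // lt_min d10 divr_gt0.
  move=> [y m] /= []; rewrite {1}/eball /= lt_min => /andP[y1 y2].
  rewrite -ball_normE /ball_ /= => ml.
  rewrite subr_gt0; apply: (@lt_trans _ _ ((A + B) / 2)); first exact: d1P.
  apply: d2P; rewrite /eball /=; apply: le_lt_trans (refl_dist _ _ _ _) _.
  by rewrite distrC in ml; lra.
have /nbhs_ballP[d d0 dP] := near_pos.
exists (Num.min d eta); first by rewrite lt_min d0.
move=> m /andP[m1 m2] m0 x xr xm.
have [m1' m1''] : l - d < m /\ l - eta < m.
  have : l - m < Num.min d eta by lra.
  by rewrite lt_min => /andP[]; lra.
have inK y : K y -> 0 < w (refl e m y) - w y.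
  by apply: dP; rewrite -ball_normE /ball_ /= gtr0_norm; lra.
have [ex|ex] := leP (l + eta) (dot x e).
  by rewrite -subr_ge0 ltW // inK.
pose K' := [set y : 'rV[R]_N | enorm y <= r /\ m <= dot y e] `&` [set y | dot y e <= l + eta].
rewrite -subr_ge0.
apply: (@strip_principle _ _ K' (fun y => w (refl e m y) - w y) e l (eta ^+ 2) C) => //.
- apply: compact_closedI; first exact: compact_cap.
  by apply: closed_le; [exact: dot_continuous | exact: cst_continuous].
- by apply: contB => //; exact: cont_refl.
- move=> y [[yr ym] /= yl]; rewrite -[leLHS]real_normK ?num_real //.
  by rewrite ler_pXn2r ?nnegrE ?normr_ge0 ?(ltW eta0) // ler_norml; apply/andP; lra.
- move=> y [[yr ym] /= yl] phiy.
  have yr' : enorm y < r.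
    rewrite lt_neqAle yr andbT; apply/eqP => yE.
    by move: phiy; rewrite [X in _ - X]w_out ?yE // subr0 ltNge w_ge0.
  have ym' : m < dot y e.
    rewrite lt_neqAle ym andbT; apply/eqP => yE.
    by move: phiy; rewrite refl_id // subrr ltxx.
  have yl' : dot y e < l + eta.
    rewrite ltNge; apply/negP => yl'; move: phiy.
    by rewrite ltNge ltW // inK.
  split.
    have A : \forall z \near y, dot z e < l + eta.
      apply: open_nbhs_nbhs; split => //.
      by apply: open_lt; [exact: dot_continuous | exact: cst_continuous].
    have B := near_cap yr' ym'.
    near=> z; split; first by near: z.
    by apply: ltW; near: z.
  exists (F (w y) - F (w (refl e m y))); last by apply: cap_lap => //; exact: ltW.
  have : w (refl e m y) <= w y by lra.
  by move=> /CP/(_ (wM y)); lra.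
- by split => //; exact: ltW.
Unshelve. all: by end_near. Qed.

(** For [l >= r] the points of the cap lie on the plane itself. At the supremum of the failing
    levels the inequality holds by continuity from above, and [cap_open] then excludes failing
    levels just below it. Level 0 is again a limit. *)
Lemma cap_le0 : cap_le 0.
Proof.
suff H l : 0 < l -> cap_le l.
  move=> x xr; rewrite le_eqVlt => /predU1P[xe|xe]; first by rewrite refl_id.
  rewrite leNgt; apply/negP => lt.
  have : nbhs (refl e 0 x) [set z | w z < w x].
    by apply: open_nbhs_nbhs; split => //; apply: open_lt => //; exact: cst_continuous.
  move=> /nbhs_eballP[d d0 dP].
  pose l := Num.min (dot x e) (d / 4); have l0 : 0 < l by rewrite lt_min xe divr_gt0.
  have := H l l0 x xr; rewrite ge_min lexx => /(_ isT); rewrite leNgt => /negP; apply.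
  apply: dP; rewrite /eball /=; apply: le_lt_trans (refl_dist _ _ _ _) _.
  rewrite subrr enorm0 add0r subr0 gtr0_norm //.
  have : l <= d / 4 by rewrite ge_min lexx orbT.
  lra.
move=> l0; apply: contrapT => nP.
pose S := [set m | 0 < m /\ ~ cap_le m].
have big m : r <= m -> cap_le m.
  move=> rm x xr mx; rewrite refl_id //; apply/eqP; rewrite eq_le mx andbT.
  apply: le_trans (dot_le x e) _.
  by rewrite [enorm e]enormE e1 sqrtr1 mulr1; apply: le_trans xr rm.
have supS : has_sup S.
  split; first by exists l.
  by exists r => m [_ nPm]; rewrite leNgt; apply/negP => /ltW /big.
have lsup : l <= sup S by apply: sup_upper_bound.
have s0 : 0 < sup S by apply: lt_le_trans lsup.
have Psup : cap_le (sup S).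
  move=> x xr xe.
  rewrite leNgt; apply/negP => lt.
  have [xe'|xe'] := eqVneq (dot x e) (sup S).
    by move: lt; rewrite refl_id ?ltxx.
  have {xe xe'}xe : sup S < dot x e by rewrite lt_neqAle eq_sym xe'.
  have : nbhs (refl e (sup S) x) [set z | w z < w x].
    by apply: open_nbhs_nbhs; split => //; apply: open_lt => //; exact: cst_continuous.
  move=> /nbhs_eballP[d d0 dP].
  pose m := Num.min (dot x e) (sup S + d / 4).
  have sm : sup S < m by rewrite lt_min xe /=; lra.
  have Pm : cap_le m.
    apply: contrapT => nPm; have : m <= sup S.
      by apply: sup_upper_bound => //; split => //; apply: lt_trans sm.
    by rewrite leNgt sm.
  have := Pm x xr; rewrite ge_min lexx => /(_ isT); rewrite leNgt => /negP; apply.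
  apply: dP; rewrite /eball /=; apply: le_lt_trans (refl_dist _ _ _ _) _.
  rewrite subrr enorm0 add0r gtr0_norm ?subr_gt0 //.
  have : m <= sup S + d / 4 by rewrite ge_min lexx orbT.
  lra.
have [d d0 dP] := cap_open s0 Psup.
have [m [m0 nPm] mS] := sup_adherent d0 supS.
have mle : m <= sup S by apply: sup_upper_bound.
apply: (nPm); apply: dP => //; rewrite mS /= lt_neqAle mle andbT.
by apply/eqP => mE; case: nP; move: nPm; rewrite mE.
Qed.

End MovingPlanes.

(** * Radial symmetry from reflections through the centre *)

Section RadialSymmetry.
Context {R : realType} {N : nat}.
Variables (F : R -> R) (r : R) (w : 'rV[R]_N -> R) (i0 : 'I_N).
Hypothesis r0 : 0 < r.
Hypothesis F0 : forall t, 0 <= F t.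
Hypothesis Fmono : {homo F : s t / s <= t}.
Hypothesis Flip : forall M, exists2 C, 0 < C &
  forall s t, s <= t -> t <= M -> F t - F s <= C * (t - s).
Hypothesis wc : continuous w.
Hypothesis w_out : forall x, r <= enorm x -> w x = 0.
Hypothesis w_lap : forall x, enorm x < r -> has_lap w x (- F (w x)).

(** By the strong principle [w] is identically zero or positive inside. Two distinct points of equal
    norm are exchanged by the reflection through the origin with normal [u - v]; the inequality for
    every ordered pair gives equality. *)
Theorem radial_symmetry x y : enorm x = enorm y -> w x = w y.
Proof.
have [[z [zr wz]]|nz] := pselect (exists z, enorm z < r /\ w z != 0); last first.
  suff H z : w z = 0 by rewrite !H.
  have [zr|/w_out //] := ltP (enorm z) r.
  by apply/eqP; apply: contrapT => /negP wz; apply: nz; exists z.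
have wge := w_ge0 i0 F0 wc w_out w_lap.
have wpos t : enorm t < r -> 0 < w t.
  move=> tr; apply: (@strong_principle _ _ w r i0 z) => //.
  - by move=> u; rewrite /eball /= subr0 => ur; exists (- F (w u)); [rewrite oppr_le0 | exact: w_lap].
  - by rewrite /eball /= subr0.
  - by rewrite lt_neqAle eq_sym wz wge.
  - by rewrite /eball /= subr0.
suff H u v : enorm u = enorm v -> w u <= w v by move=> xy; apply/eqP; rewrite eq_le !H.
move=> uv; have [->//|nuv] := eqVneq u v.
have [ur|ur] := leP r (enorm u); first by rewrite !w_out // -uv.
have d0 : 0 < enorm (u - v) by rewrite enorm_gt0 subr_eq0.
pose e := (enorm (u - v))^-1 *: (u - v).
have e1 : dot e e = 1.
  by rewrite /e !dotZl !dotZr -sqr_enorm; field; exact: lt0r_neq0.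
have duv : dot v v = dot u u by apply/esym/enorm_eq.
have ue : 2 * dot u e = enorm (u - v).
  have : enorm (u - v) * (2 * dot u e) = enorm (u - v) * enorm (u - v).
    rewrite -expr2 sqr_enorm /e dotZr mulrCA (mulrCA _ (_^-1)) mulKf ?lt0r_neq0 //.
    by rewrite !dotE (dotC v u) duv; ring.
  by move/mulfI; apply; exact: lt0r_neq0.
have -> : v = refl e 0 u.
  rewrite /refl subr0 ue /e scalerA divff ?lt0r_neq0 // scale1r.
  by apply/rowP => i; rewrite !mxE; ring.
apply: (@cap_le0 _ _ F r w i0) => //; last by lra.
exact: ltW.
Qed.

End RadialSymmetry.

(** * The radial equation *)

Section PosPow.
Context {R : realType}.
Implicit Types p s t k M : R.

Lemma MVT_is_derive (f df : R -> R) (a b : R) : a < b ->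
  (forall t, a <= t <= b -> is_derive t 1 f (df t)) ->
  exists2 t, a < t < b & f b - f a = df t * (b - a).
Proof.
move=> ab H; have [t||t] := MVT ab (f := f) (df := df).
- by rewrite in_itv /= => /andP[ta tb]; apply: H; rewrite !ltW.
- apply: derivable_within_continuous => t; rewrite in_itv /= => tab.
  by have [] := H t tab.
- by rewrite in_itv /= => tab E; exists t.
Qed.

Lemma is_derive_plus (f g : R -> R) t df dg : is_derive t 1 f df ->
  is_derive t 1 g dg -> is_derive t 1 (fun s => f s + g s) (df + dg).
Proof. by move=> Df Dg; exact: is_deriveD. Qed.

Lemma is_derive_minus (f g : R -> R) t df dg : is_derive t 1 f df ->
  is_derive t 1 g dg -> is_derive t 1 (fun s => f s - g s) (df - dg).
Proof. by move=> Df Dg; exact: is_deriveB. Qed.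

Lemma is_derive_mult (f g : R -> R) t df dg : is_derive t 1 f df ->
  is_derive t 1 g dg -> is_derive t 1 (fun s => f s * g s) (f t * dg + g t * df).
Proof. by move=> Df Dg; exact: is_deriveM. Qed.

Lemma is_derive_scale (f : R -> R) k t df : is_derive t 1 f df ->
  is_derive t 1 (fun s => k * f s) (k * df).
Proof. by move=> Df; exact: is_deriveZ. Qed.

Lemma is_derive_lin k t : is_derive t 1 ( *%R k) k.
Proof. by apply: is_derive_eq (is_derive_scale k (is_derive_id t 1)) _; rewrite mulr1. Qed.

Lemma pospow_ge0 p t : 0 <= pospow p t.
Proof. exact: powR_ge0. Qed.

Lemma pospow_le0 p t : 0 < p -> t <= 0 -> pospow p t = 0.
Proof. by move=> p0 t0; rewrite /pospow max_r // powR0 // gt_eqF. Qed.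

Lemma pospowE p t : 0 <= t -> pospow p t = t `^ p.
Proof. by move=> t0; rewrite /pospow max_l. Qed.

Lemma pospow_gt0 p t : 0 < t -> 0 < pospow p t.
Proof. by move=> t0; rewrite pospowE ?ltW // powR_gt0. Qed.

Lemma pospow_homo p : 0 < p -> {homo pospow p : s t / s <= t}.
Proof.
move=> p0 s t st; rewrite /pospow.
apply: ge0_ler_powR; first exact: ltW.
- by rewrite nnegrE le_max lexx orbT.
- by rewrite nnegrE le_max lexx orbT.
- by rewrite ge_max !le_max st lexx orbT.
Qed.

Lemma pospowZ p k t : 0 < p -> 0 < k -> pospow p (k * t) = k `^ p * pospow p t.
Proof.
move=> p0 k0; have [t0|t0] := leP t 0.
  by rewrite !pospow_le0 ?mulr0 // pmulr_rle0.
by rewrite !pospowE ?mulr_ge0 ?ltW // powRM ?ltW.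
Qed.

Lemma pospow_lip p M : 1 < p -> exists2 C, 0 < C &
  forall s t, s <= t -> t <= M -> pospow p t - pospow p s <= C * (t - s).
Proof.
move=> p1; have p0 : 0 < p by apply: lt_trans p1.
(* The derivative [p t^(p-1)] increases on the positive axis and the function vanishes on the
   negative one, so [B] controls all slopes below [M]; the 1 keeps [B] positive. *)
pose B := Num.max M 1; have B0 : 0 < B by rewrite lt_max ltr01 orbT.
have BM : M <= B by rewrite le_max lexx.
exists (p * B `^ (p - 1)); first by rewrite mulr_gt0 // powR_gt0.
have Bp t : 0 < t -> t <= B -> t `^ (p - 1) <= B `^ (p - 1).
  by move=> t0 tB; apply: ge0_ler_powR; rewrite ?nnegrE ?(ltW t0) ?(ltW B0) // subr_ge0 ltW.
have pB : 0 <= p * B `^ (p - 1) by rewrite mulr_ge0 ?powR_ge0 // ltW.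
move=> s t st tM; have tB : t <= B by apply: le_trans BM.
have [t0|t0] := leP t 0.
  rewrite (pospow_le0 p0 t0) (pospow_le0 p0 (le_trans st t0)) subrr.
  by rewrite mulr_ge0 ?subr_ge0.
have [s0|s0] := leP s 0.
  rewrite (pospow_le0 p0 s0) subr0 (pospowE _ (ltW t0)) -(mulr_powRB1 (ltW t0) p0).
  apply: (@le_trans _ _ (1 * B `^ (p - 1) * t)).
    by rewrite mul1r mulrC ler_wpM2r ?Bp // ltW.
  apply: ler_pM; rewrite ?mul1r ?powR_ge0 // ?(ltW t0) //; last by rewrite lerBrDr gerDl.
  by rewrite ler_peMl ?powR_ge0 // ltW.
move: st; rewrite le_eqVlt => /predU1P[->|st]; first by rewrite !subrr mulr0.
rewrite (pospowE _ (ltW t0)) (pospowE _ (ltW s0)).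
have [|z /andP[sz zt] ->] := @MVT_is_derive (fun x => x `^ p) (fun x => p * x `^ (p - 1)) s t st.
  by move=> z /andP[sz zt]; apply: is_derive1_powR; apply: lt_le_trans sz.
rewrite ler_wpM2r ?subr_ge0 ?(ltW st) // ler_wpM2l ?(ltW p0) // Bp ?(lt_trans s0) //.
by apply: le_trans tB; exact: ltW.
Qed.

Lemma pospow_lip_norm p M : 1 < p -> exists2 C, 0 < C &
  forall s t, s <= M -> t <= M -> `|pospow p t - pospow p s| <= C * `|t - s|.
Proof.
move=> p1; have p0 : 0 < p by apply: lt_trans p1.
have [C C0 CP] := pospow_lip M p1; exists C => // s t sM tM.
have [st|ts] := leP s t.
  rewrite !ger0_norm ?subr_ge0 //; first exact: CP.
  exact: pospow_homo.
rewrite (distrC (pospow p t)) (distrC t) !ger0_norm ?subr_ge0 ?(ltW ts) //.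
  by apply: CP => //; exact: ltW.
by apply: pospow_homo => //; exact: ltW.
Qed.

Lemma pospow_continuous p : 1 < p -> continuous (pospow p : R -> R).
Proof.
move=> p1 t; apply/cvgrPdist_lt => e e0.
have [C C0 CP] := pospow_lip_norm (t + 1) p1.
have d0 : 0 < Num.min 1 (e / C) by rewrite lt_min ltr01 divr_gt0.
apply/nbhs_ballP; exists (Num.min 1 (e / C)); first exact: d0.
move=> s.
rewrite /ball_ /= lt_min => /andP[s1 s2].
apply: le_lt_trans (CP s t _ _) _; [|lra|by rewrite mulrC -ltr_pdivlMr].
by move: s1; rewrite ltr_norml => /andP[? ?]; lra.
Qed.

End PosPow.

(** * The singular radial equation: flux, uniqueness, scaling, gluing *)

Section Profile.
Context {R : realType}.
Variables (p : R) (n : nat).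
Hypothesis p1 : 1 < p.
Let p0 : 0 < p. Proof. exact: lt_trans p1. Qed.
Implicit Types (V W : R -> R) (r s t : R).

(* The radial equation V'' + (n/s) V' = - [V]_+^p, with [n = N - 1], where [V1] is
   the derivative of [V], together with V(0+) = V 0 and V'(0+) = 0. *)
Definition profile r V V1 := [/\
  forall s, 0 < s < r -> is_derive s 1 V (V1 s),
  forall s, 0 < s < r -> is_derive s 1 V1 (- pospow p (V s) - n%:R * (V1 s / s)),
  forall eps, 0 < eps -> exists2 d, 0 < d & forall s, 0 < s < d -> `|V s - V 0| < eps &
  forall eps, 0 < eps -> exists2 d, 0 < d & forall s, 0 < s < d -> `|V1 s| < eps].

(** Up to the factor [N] times the volume of the unit ball, this is the mass of [pospow p] of the
    profile in the ball of radius [s]. Multiplying by [s^n] absorbs the singular term of the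
    equation. *)
Definition flux V1 s : R := - (s ^+ n * V1 s).

Lemma flux_derive r V V1 s : profile r V V1 -> 0 < s < r ->
  is_derive s 1 (flux V1) (s ^+ n * pospow p (V s)).
Proof.
move=> [_ DV1 _ _] sr; have /andP[s0 _] := sr.
apply: is_derive_eq (is_deriveN (is_deriveM (is_derive_pow n (is_derive_id s 1)) (DV1 s sr))) _.
rewrite /GRing.scale /=; case: (n) => [|m] /=; first by rewrite !expr0; ring.
by rewrite exprS; field; exact: lt0r_neq0.
Qed.

Lemma flux_homo r V V1 s t : profile r V V1 -> 0 < s -> s <= t -> t < r ->
  flux V1 s <= flux V1 t.
Proof.
move=> P s0; rewrite le_eqVlt => /predU1P[->//|st] tr.
have [|z /andP[sz zt] E] := @MVT_is_derive _ (flux V1) (fun s => s ^+ n * pospow p (V s)) s t st.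
  move=> z /andP[sz zt]; apply: flux_derive P _.
  by rewrite (lt_le_trans s0 sz) (le_lt_trans zt tr).
rewrite -subr_ge0 E mulr_ge0 ?subr_ge0 ?(ltW st) // mulr_ge0 ?pospow_ge0 //.
by rewrite exprn_ge0 // (le_trans (ltW s0)) // ltW.
Qed.

(** The flux is nondecreasing and tends to 0 at 0; the sample point is taken below 1 so that
    [t^n <= 1]. *)
Lemma flux_ge0 r V V1 s : profile r V V1 -> 0 < s < r -> 0 <= flux V1 s.
Proof.
move=> P /andP[s0 sr]; have [_ _ _ V10] := P.
apply/ler_addgt0Pr => eps e0; have [d d0 dP] := V10 _ e0.
pose t := Num.min (Num.min d s) 1 / 2.
have m0 : 0 < Num.min (Num.min d s) 1 by rewrite !lt_min d0 s0 ltr01.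
have t0 : 0 < t by rewrite divr_gt0.
have : t < Num.min (Num.min d s) 1 by rewrite /t; lra.
rewrite !lt_min => /andP[/andP[td ts] t1].
have := flux_homo P t0 (ltW ts) sr; rewrite /flux => H.
have tn1 : t ^+ n <= 1 by rewrite exprn_ile1 // ltW.
have tn0 : 0 <= t ^+ n by rewrite exprn_ge0 // ltW.
have : `|t ^+ n * V1 t| <= 1 * eps.
  rewrite normrM (ger0_norm tn0) ler_pM // ltW // dP // t0 td //.
rewrite mul1r ler_norml => /andP[_ B]; lra.
Qed.

Lemma profile_V1_le0 r V V1 s : profile r V V1 -> 0 < s < r -> V1 s <= 0.
Proof.
move=> P sr; have := flux_ge0 P sr; rewrite /flux oppr_ge0 pmulr_rle0 //.
by rewrite exprn_gt0 //; case/andP: sr.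
Qed.

Lemma profile_homo r V V1 s t : profile r V V1 -> 0 < s -> s <= t -> t < r -> V t <= V s.
Proof.
move=> P s0; rewrite le_eqVlt => /predU1P[->//|st] tr.
have [DV _ _ _] := P.
have inr z : s <= z <= t -> 0 < z < r.
  by move=> /andP[sz zt]; rewrite (lt_le_trans s0 sz) (le_lt_trans zt tr).
have [|z /andP[sz zt] E] := @MVT_is_derive _ V V1 s t st; first by move=> z /inr/DV.
rewrite -subr_le0 E mulr_le0_ge0 ?subr_ge0 ?(ltW st) // (profile_V1_le0 P) // inr //.
by rewrite !ltW.
Qed.

Lemma profile_le0 r V V1 s : profile r V V1 -> 0 < s < r -> V s <= V 0.
Proof.
move=> P /andP[s0 sr]; have [_ _ V0 _] := P.
apply/ler_addgt0Pr => eps e0; have [d d0 dP] := V0 _ e0.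
pose t := Num.min d s / 2.
have m0 : 0 < Num.min d s by rewrite lt_min d0 s0.
have t0 : 0 < t by rewrite divr_gt0.
have : t < Num.min d s by rewrite /t; lra.
rewrite lt_min => /andP[td ts].
have := profile_homo P t0 (ltW ts) sr.
have := dP t; rewrite t0 td ltr_norml => /(_ isT) /andP[]; lra.
Qed.

(** Near the origin the profile is still positive, so the flux strictly increases there and never
    returns to 0. *)
Lemma flux_gt0 r V V1 s : profile r V V1 -> 0 < V 0 -> 0 < s < r -> 0 < flux V1 s.
Proof.
move=> P Vpos /andP[s0 sr]; have [_ _ V0 _] := P.
have [d d0 dP] := V0 _ Vpos; pose t := Num.min d s / 2.
have m0 : 0 < Num.min d s by rewrite lt_min d0 s0.
have t0 : 0 < t by rewrite divr_gt0.
have : t < Num.min d s by rewrite /t; lra.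
rewrite lt_min => /andP[td ts]; have tr : t < r by apply: lt_trans sr.
apply: lt_le_trans (flux_homo P t0 (ltW ts) sr).
have t20 : 0 < t / 2 by rewrite divr_gt0.
have tt : t / 2 < t by lra.
have [|z /andP[sz zt] E] := @MVT_is_derive _ (flux V1) (fun s => s ^+ n * pospow p (V s)) _ _ tt.
  move=> z /andP[sz zt]; apply: flux_derive P _.
  by rewrite (lt_le_trans t20 sz) (le_lt_trans zt tr).
have z0 : 0 < z by apply: lt_trans sz.
apply: le_lt_trans (flux_ge0 P (s := t / 2) _) _; first by rewrite t20 (lt_trans tt).
rewrite -subr_gt0 E mulr_gt0 ?subr_gt0 // mulr_gt0 ?exprn_gt0 // pospow_gt0 //.
have := dP z; rewrite z0 (lt_trans zt) // ltr_norml => /(_ isT) /andP[]; lra.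
Qed.

(* The energy E = (V - W)^2 + (V1 - W1)^2 satisfies E' <= K E because the singular
   damping term has a favourable sign, and E tends to 0 at 0. *)
Lemma profile_unique r V V1 W W1 : profile r V V1 -> profile r W W1 -> V 0 = W 0 ->
  forall s, 0 < s < r -> V s = W s /\ V1 s = W1 s.
Proof.
move=> PV PW VW s sr; have /andP[s0 sr'] := sr.
have [DV DV1 V0 V10] := PV; have [DW DW1 W0 W10] := PW.
have [C C0 CP] := pospow_lip_norm (V 0) p1.
(* The 1 pays for [2 D D1 <= D^2 + D1^2], the [C] for the difference of the nonlinear terms. The
   Lipschitz constant up to [V 0] suffices, as both profiles stay below this common value. *)
pose K := 1 + C.
pose E t := ((V t - W t) ^+ 2 + (V1 t - W1 t) ^+ 2) * expR (- K * t).
pose E1 t := ((2 * (V t - W t) * (V1 t - W1 t) + 2 * (V1 t - W1 t) *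
   (- pospow p (V t) - n%:R * (V1 t / t) - (- pospow p (W t) - n%:R * (W1 t / t)))) -
   K * ((V t - W t) ^+ 2 + (V1 t - W1 t) ^+ 2)) * expR (- K * t).
have DE t : 0 < t < r -> is_derive t 1 E (E1 t).
  move=> tr; have D1 := is_derive_pow 2 (is_derive_minus (DV t tr) (DW t tr)).
  have D2 := is_derive_pow 2 (is_derive_minus (DV1 t tr) (DW1 t tr)).
  have D3 : is_derive t 1 (fun t => expR (- K * t)) (- K * expR (- K * t)).
    apply: is_derive_eq (is_derive1_comp (is_derive_expR _) (is_derive_lin (- K) t)) _.
    by rewrite mulrC.
  apply: is_derive_eq (is_derive_mult (is_derive_plus D1 D2) D3) _.
  by rewrite /E1 /=; ring.
have E1le t : 0 < t < r -> E1 t <= 0.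
  move=> tr; have /andP[t0 _] := tr; rewrite /E1 mulr_le0_ge0 ?expR_ge0 //.
  set D := V t - W t; set D1 := V1 t - W1 t.
  have -> : - pospow p (V t) - n%:R * (V1 t / t) - (- pospow p (W t) - n%:R * (W1 t / t))
    = - (pospow p (V t) - pospow p (W t)) - n%:R / t * D1 by rewrite /D1; ring.
  set G := pospow p (V t) - _.
  have GC : `|G| <= C * `|D|.
    by apply: CP; [rewrite VW; exact: profile_le0 PW tr | exact: profile_le0 PV tr].
  have h1 : 0 <= n%:R / t * D1 ^+ 2 by rewrite mulr_ge0 ?sqr_ge0 // divr_ge0 // ltW.
  have h2 : - (2 * D1 * G) <= C * (D ^+ 2 + D1 ^+ 2).
    apply: le_trans (ler_norm _) _; rewrite normrN !normrM (ger0_norm (ler0n _ _)).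
    apply: (@le_trans _ _ (2 * `|D1| * (C * `|D|))); first by rewrite ler_wpM2l ?mulr_ge0.
    rewrite -(real_normK (num_real D)) -(real_normK (num_real D1)).
    rewrite -subr_ge0 (_ : _ - _ = C * (`|D| - `|D1|) ^+ 2); last by ring.
    by rewrite mulr_ge0 ?sqr_ge0 // ltW.
  have h3 := sqr_ge0 (D - D1).
  rewrite /K; rewrite (_ : _ - _ = - (2 * D1 * G) - C * (D ^+ 2 + D1 ^+ 2) - (D - D1) ^+ 2
    - 2 * (n%:R / t * D1 ^+ 2)); last by ring.
  lra.
have Ele t : 0 < t < s -> E s <= E t.
  move=> /andP[t0 ts]; have inr z : t <= z <= s -> 0 < z < r.
    by move=> /andP[tz zs]; rewrite (lt_le_trans t0 tz) (le_lt_trans zs sr').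
  have [|z /andP[tz zs] H] := @MVT_is_derive _ E E1 t s ts; first by move=> z /inr/DE.
  rewrite -subr_le0 H mulr_le0_ge0 ?subr_ge0 ?(ltW ts) // E1le // inr //.
  by rewrite !ltW.
suff : E s <= 0.
  rewrite /E pmulr_lle0 ?expR_gt0 // => H.
  have A := sqr_ge0 (V s - W s); have B := sqr_ge0 (V1 s - W1 s).
  have A0 : (V s - W s) ^+ 2 == 0 by rewrite eq_le A andbT; lra.
  have B0 : (V1 s - W1 s) ^+ 2 == 0 by rewrite eq_le B andbT; lra.
  by move: A0 B0; rewrite !sqrf_eq0 !subr_eq0 => /eqP -> /eqP ->.
rewrite leNgt; apply/negP => Es.
(* At a small [t] both squares are at most [(2 eps)^2 <= 4 eps], so [E t <= 8 eps < E s], against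
   the monotonicity of [E]. *)
pose eps := Num.min 1 (E s / 9).
have e0 : 0 < eps by rewrite lt_min ltr01 divr_gt0.
have e1 : eps <= 1 by rewrite ge_min lexx.
have e2 : eps <= E s / 9 by rewrite ge_min lexx orbT.
have [d1 d10 d1P] := V0 _ e0; have [d2 d20 d2P] := W0 _ e0.
have [d3 d30 d3P] := V10 _ e0; have [d4 d40 d4P] := W10 _ e0.
pose m := Num.min s (Num.min (Num.min d1 d2) (Num.min d3 d4)).
have m0 : 0 < m by rewrite !lt_min s0 d10 d20 d30 d40.
pose t := m / 2; have t0 : 0 < t by rewrite divr_gt0.
have : t < m by rewrite /t; lra.
rewrite !lt_min => /and3P[ts /andP[t1 t2] /andP[t3 t4]].
have : E t < E s; last by rewrite ltNge Ele // t0.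
have eK : expR (- K * t) <= 1 by rewrite expR_le1 // mulNr oppr_le0 mulr_ge0 ?ltW // /K; lra.
have sq x y : `|x| < eps -> `|y| < eps -> (x - y) ^+ 2 <= 4 * eps.
  move=> xe ye; rewrite -[leLHS]real_normK ?num_real //.
  apply: (@le_trans _ _ ((2 * eps) ^+ 2)).
    rewrite ler_pXn2r ?nnegrE ?mulr_ge0 ?(ltW e0) //.
    by apply: le_trans (ler_normB _ _) _; lra.
  rewrite exprMn expr2 [eps ^+ 2]expr2 -natrM ler_pM2l // -[leRHS]mul1r.
  by rewrite ler_wpM2r // ltW.
have h1 : (V t - W t) ^+ 2 <= 4 * eps.
  rewrite (_ : V t - W t = (V t - V 0) - (W t - W 0)); last by rewrite VW; ring.
  by apply: sq; [apply: d1P | apply: d2P]; rewrite t0.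
have h2 : (V1 t - W1 t) ^+ 2 <= 4 * eps by apply: sq; [apply: d3P | apply: d4P]; rewrite t0.
apply: (@le_lt_trans _ _ (((V t - W t) ^+ 2 + (V1 t - W1 t) ^+ 2) * 1)).
  by rewrite ler_wpM2l // addr_ge0 ?sqr_ge0.
lra.
Qed.

(** The condition [k * tau^2 = k^p] balances the two derivatives on the left of the equation against
    the homogeneity of the power on the right. *)
Lemma profile_scale r V V1 k tau : 0 < k -> 0 < tau -> k * tau ^+ 2 = k `^ p ->
  profile (tau * r) V V1 ->
  profile r (fun s => k * V (tau * s)) (fun s => k * tau * V1 (tau * s)).
Proof.
move=> k0 t0 kt [DV DV1 V0 V10].
have inr s : 0 < s < r -> 0 < tau * s < tau * r.
  by move=> /andP[s0 sr]; rewrite mulr_gt0 // ltr_pM2l.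
have Dt s := is_derive_lin tau s.
split.
- move=> s sr; apply: is_derive_eq (is_derive_scale k (is_derive1_comp (DV _ (inr s sr)) (Dt s))) _.
  by rewrite /GRing.scale /=; ring.
- move=> s sr; have /andP[s0 _] := sr.
  apply: is_derive_eq (is_derive_scale (k * tau) (is_derive1_comp (DV1 _ (inr s sr)) (Dt s))) _.
  rewrite /GRing.scale /= pospowZ // -kt; field.
  by rewrite !lt0r_neq0.
- move=> eps e0; have [d d0 dP] := V0 _ (divr_gt0 e0 k0).
  exists (d / tau); first by rewrite divr_gt0.
  move=> s /andP[s0 sd]; rewrite mulr0 -mulrBr normrM gtr0_norm // mulrC -ltr_pdivlMr //.
  by apply: dP; rewrite mulr_gt0 //= mulrC -ltr_pdivlMr.
- move=> eps e0; have kt0 : 0 < k * tau by rewrite mulr_gt0.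
  have [d d0 dP] := V10 _ (divr_gt0 e0 kt0).
  exists (d / tau); first by rewrite divr_gt0.
  move=> s /andP[s0 sd]; rewrite normrM gtr0_norm // mulrC -ltr_pdivlMr //.
  by apply: dP; rewrite mulr_gt0 //= mulrC -ltr_pdivlMr.
Qed.

(** By the mean value theorem the difference quotients at [a] are values of [g] at nearby points,
    which converge to [g a]. This serves at the radius where two branches of a profile meet. *)
Lemma is_derive_glue (f g : R -> R) (a d : R) : 0 < d ->
  (forall s, a - d < s < a + d -> s != a -> is_derive s 1 f (g s)) ->
  {for a, continuous f} -> {for a, continuous g} -> is_derive a 1 f (g a).
Proof.
move=> d0 Df fa ga.
have cf s : a - d < s < a + d -> {for s, continuous f}.
  move=> sd; have [->//|sa] := eqVneq s a.
  have [Dfs _] := Df s sd sa.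
  by apply: differentiable_continuous; apply/derivable1_diffP.
have L : (fun h : R => h^-1 *: (f (h *: (1 : R) + a) - f a)) @ 0^' --> g a.
  apply/cvgrPdist_lt => e e0.
  have /cvgrPdist_lt/(_ e e0)/nbhs_ballP[d1 d10 d1P] := ga.
  apply/nbhs_ballP; exists (Num.min d d1) => /=; first by rewrite lt_min d0.
  move=> h; rewrite -ball_normE /ball_ /= sub0r normrN lt_min => /andP[hd hd1] h0.
  rewrite /GRing.scale /= mulr1.
  have within u v : u < v -> a - d < u -> v < a + d -> {within `[u, v], continuous f}.
    move=> uv ua va; apply: continuous_in_subspaceT => z; rewrite inE /= in_itv /= => /andP[uz zv].
    by apply: cf; rewrite (lt_le_trans ua uz) (le_lt_trans zv va).
  have close z : `|a - z| < d1 -> `|g a - g z| < e by move=> za; apply: d1P; rewrite -ball_normE.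
  have /andP[hd2 hd3] : - d < h < d by rewrite -ltr_norml.
  have /andP[hd4 hd5] : - d1 < h < d1 by rewrite -ltr_norml.
  have [hp|hn] := ltP 0 h.
    have ab : a < h + a by lra.
    have [||z] := @MVT _ f g a (h + a) ab.
    - move=> z; rewrite in_itv /= => /andP[z1 z2]; apply: Df; [apply/andP; lra | by rewrite gt_eqF].
    - by apply: within => //; lra.
    rewrite in_itv /= => /andP[z1 z2] ->; rewrite addrK mulrCA mulVf // mulr1.
    by apply: close; rewrite ltr_norml; apply/andP; lra.
  have {}hn : h < 0 by rewrite lt_neqAle h0.
  have ab : h + a < a by lra.
  have [||z] := @MVT _ f g (h + a) a ab.
  - move=> z; rewrite in_itv /= => /andP[z1 z2]; apply: Df; [apply/andP; lra | by rewrite lt_eqF].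
  - by apply: within => //; lra.
  rewrite in_itv /= => /andP[z1 z2] E.
  have -> : f (h + a) - f a = g z * h by rewrite -[LHS]opprB E; ring.
  rewrite mulrCA mulVf // mulr1.
  by apply: close; rewrite ltr_norml; apply/andP; lra.
apply: DeriveDef; last exact: cvg_lim.
by apply/cvg_ex; exists (g a).
Qed.

End Profile.

(** * From the elliptic to the radial equation *)

Section Solutions.
Context {R : realType} {N : nat}.
Variables (p : R).
Hypothesis p1 : 1 < p.
Let p0 : 0 < p. Proof. exact: lt_trans p1. Qed.
Implicit Types (c x y : 'rV[R]_N) (r gamma : R) (v g : 'rV[R]_N -> R).

Lemma pd_eq_on (A : set 'rV[R]_N) v g i : open A ->
  (forall x, A x -> v x = g x) -> forall x, A x -> pd i v x = pd i g x.
Proof.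
move=> oA vg x Ax; apply: near_eq_derive.
have : nbhs x A by exact: open_nbhs_nbhs.
by apply: filterS => y /vg.
Qed.

Lemma lap_eq_on (A : set 'rV[R]_N) v g : open A ->
  (forall x, A x -> v x = g x) -> forall x, A x -> lap v x = lap g x.
Proof.
move=> oA vg x Ax; apply: eq_bigr => i _.
by apply: (pd_eq_on i oA (pd_eq_on i oA vg)).
Qed.


Lemma within_epsP (A : set 'rV[R]_N) v : {within A, continuous v} <->
  forall x eps, A x -> 0 < eps -> exists2 d, 0 < d &
    forall y, A y -> enorm (y - x) < d -> `|v y - v x| < eps.
Proof.
split.
  move=> /(subspace_continuousP A) vc x eps Ax e0.
  have /cvgrPdist_lt/(_ eps e0)/nbhs_eballP[d d0 dP] := vc x Ax.
  by exists d => // y Ay yd; rewrite distrC; apply: dP.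
move=> H; apply/(subspace_continuousP A) => x Ax; apply/cvgrPdist_lt => e e0.
have [d d0 dP] := H x e Ax e0; apply/nbhs_eballP; exists d => // y yd Ay.
by rewrite distrC; exact: dP.
Qed.

(* The part of [solFI] that does not involve the integral. *)
Definition solpde c r gamma v := [/\ {within ecball c r, continuous v},
  forall x, eball c r x -> differentiable v x /\ forall i, differentiable (pd i v) x,
  forall x, eball c r x -> - lap v x = pospow p (v x) &
  forall x, esphere c r x -> v x = gamma].

Variable i0 : 'I_N.

(** Translating to the origin and extending [v - gamma] by zero yields a function continuous on the
    whole space. Shifting the argument of the nonlinearity by [gamma] keeps it nonnegative,
    nondecreasing and locally Lipschitz, whatever the sign of [gamma]. *)
Lemma solpde_radial c r gamma v x y : 0 < r -> solpde c r gamma v ->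
  enorm (x - c) <= r -> enorm (x - c) = enorm (y - c) -> v x = v y.
Proof.
move=> r0 [/within_epsP vc C2 vlap vbd] xr xy.
pose w z := if enorm z < r then v (z + c) - gamma else 0.
have w_out z : r <= enorm z -> w z = 0 by move=> rz; rewrite /w ltNge rz.
have wE z : enorm z <= r -> w z = v (z + c) - gamma.
  rewrite /w le_eqVlt => /predU1P[zr|->//].
  by rewrite zr ltxx vbd ?subrr // /esphere /= addrK.
have wc : continuous w.
  move=> z; apply/(@cvgrPdist_lt _ _ _ (nbhs z)) => e e0; apply/nbhs_eballP.
  have [zr|zr] := ltP r (enorm z).
    exists (enorm z - r); first by rewrite subr_gt0.
    move=> t; rewrite /eball /= => tz; rewrite !w_out ?subrr ?normr0 ?ltW //.
    by have := enorm_dist z t; rewrite ler_norml enormB => /andP[_]; lra.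
  have Az : ecball c r (z + c) by rewrite /ecball /= addrK.
  have [d d0 dP] := vc _ e Az e0.
  have dt t : enorm t <= r -> enorm (t - z) < d -> `|w z - w t| < e.
    move=> tr td; rewrite !wE // distrC opprB addrA subrK.
    apply: dP; first by rewrite /ecball /= addrK.
    by rewrite opprD addrACA subrr addr0.
  have [zr'|zr'] := eqVneq (enorm z) r.
    exists d => // t td; have [tr|tr] := leP (enorm t) r; first exact: dt.
    by rewrite !w_out ?subrr ?normr0 ?zr' // ltW.
  have {zr'}zr : enorm z < r by rewrite lt_neqAle zr'.
  exists (Num.min d (r - enorm z)); first by rewrite lt_min d0 subr_gt0.
  move=> t; rewrite /eball /= lt_min => /andP[td tr]; apply: dt => //.
  by have := enorm_dist t z; rewrite ler_norml => /andP[_]; lra.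
have w_lap z : enorm z < r -> has_lap w z (- pospow p (w z + gamma)).
  move=> zr; rewrite (wE _ (ltW zr)) subrK.
  have Bz : eball c r (z + c) by rewrite /eball /= addrK.
  rewrite -vlap // opprK.
  have := has_lapD (has_lap_shift (C2_has_lap (@open_eball _ _ c r) Bz C2)) (has_lap_affine z 0 (- gamma)).
  rewrite addr0; apply: near_has_lap.
  have : nbhs z (eball 0 r).
    by apply: open_nbhs_nbhs; split; [exact: open_eball | rewrite /eball /= subr0].
  apply: filterS => t; rewrite /eball /= subr0 => tr.
  by rewrite (wE _ (ltW tr)) (dotC t) dot0l add0r.
have := @radial_symmetry _ _ (fun t => pospow p (t + gamma)) r w i0 r0 _ _ _ wc w_out w_lap
  (x - c) (y - c) xy.
have yr : enorm (y - c) <= r by rewrite -xy.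
rewrite !wE // !subrK => H; apply: (addIr (- gamma)); apply: H.
- by move=> t; exact: pospow_ge0.
- by move=> s t st; apply: pospow_homo => //; rewrite lerD2r.
- move=> M; have [C C0 CP] := pospow_lip (M + gamma) p1; exists C => // s t st tM.
  rewrite (_ : t - s = (t + gamma) - (s + gamma)); last by ring.
  by apply: CP; rewrite lerD2r.
Qed.

Lemma dot_evec : dot (evec R i0) (evec R i0) = 1.
Proof. by rewrite dot_delta mxE !eqxx. Qed.

Lemma enorm_evec (s : R) : 0 <= s -> enorm (s *: evec R i0) = s.
Proof. by move=> s0; rewrite enormZ enormE dot_evec sqrtr1 mulr1 ger0_norm. Qed.

Lemma sum_evec (F : 'I_N -> R) : \sum_i (evec R i0) 0 i * F i = F i0.
Proof.
rewrite (bigD1 i0) //= mxE !eqxx mul1r big1 ?addr0 // => i ii0.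
by rewrite mxE (negbTE ii0) andbF mul0r.
Qed.

(** Restricting [v] to a line through the centre supplies the derivatives; the equation along it
    comes from evaluating the Laplacian of [V (enorm (x - c))], which equals [v] by symmetry. *)
Lemma solpde_profile c r gamma v : 0 < r -> solpde c r gamma v ->
  profile p N.-1 r (fun s => v (c + s *: evec R i0)) (fun s => pd i0 v (c + s *: evec R i0)).
Proof.
move=> r0 sv; have [vc C2 vlap _] := sv; set e0 := evec R i0.
have N1 : (N.-1)%:R = N%:R - 1 :> R.
  by case: (N) i0 => [[]//|n _]; rewrite /= -natr1 addrK.
have inB s : - r < s < r -> eball c r (c + s *: e0).
  move=> sr; rewrite /eball /= addrAC subrr add0r enormZ enormE dot_evec sqrtr1 mulr1.
  by rewrite ltr_norml.
have pos s : 0 < s < r -> - r < s < r.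
  by move=> /andP[s0 ->]; rewrite andbT (lt_trans _ s0) // oppr_lt0.
set V := fun s => v _; set V1 := fun s => pd i0 v _.
pose V2 s := pd i0 (pd i0 v) (c + s *: e0).
have DV s : - r < s < r -> is_derive s 1 V (V1 s).
  move=> sr; have := line_derive (C2 _ (inB s sr)).1; rewrite sum_evec.
  exact.
have DV1 s : - r < s < r -> is_derive s 1 V1 (V2 s).
  move=> sr; have := line_derive ((C2 _ (inB s sr)).2 i0); rewrite sum_evec.
  exact.
have cont0 (f : 'rV[R]_N -> R) eps : differentiable f c -> 0 < eps ->
    exists2 d, 0 < d & forall s, 0 < s < d -> `|f (c + s *: e0) - f c| < eps.
  move=> /differentiable_continuous/cvgrPdist_lt H /H/nbhs_eballP[d d0 dP].
  exists d => // s /andP[s0 sd]; rewrite distrC; apply: dP.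
  by rewrite /eball /= addrAC subrr add0r enorm_evec // ltW.
have cB : eball c r c by rewrite /eball /= subrr enorm0.
split.
- by move=> s /pos; exact: DV.
- move=> s sr; have /andP[s0 _] := sr; apply: is_derive_eq (DV1 s (pos s sr)) _.
  have vV x : eball c r x -> v x = V (enorm (x - c)).
    move=> xr; apply: solpde_radial r0 sv _ _; first exact: ltW.
    by rewrite addrAC subrr add0r enorm_evec // enorm_ge0.
  have := lap_eq_on (@open_eball _ _ c r) vV (inB s (pos s sr)).
  have En : enorm (c + s *: e0 - c) = s by rewrite addrAC subrr add0r enorm_evec // ltW.
  have DVp t : 0 < t < r -> is_derive t 1 V (V1 t) by move=> /pos; exact: DV.
  have DV1p t : 0 < t < r -> is_derive t 1 V1 (V2 t) by move=> /pos; exact: DV1.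
  have hx : 0 < enorm (c + s *: e0 - c) < r by rewrite En.
  rewrite (radial_lap (lexx 0) DVp DV1p hx).
  rewrite En N1 => H; have := vlap _ (inB s (pos s sr)); rewrite H -/(V s); lra.
- move=> eps e00; have [d d0 dP] := cont0 v eps (C2 c cB).1 e00.
  by exists d => // s sd; rewrite /V scale0r addr0; exact: dP.
(* Radiality makes [v] even along the line, so subtracting the first-order expansions at [s] and
   [- s] bounds [2 s pd i0 v c] by [2 eps s]. *)
- have pd0 : pd i0 v c = 0.
    apply/eqP; rewrite -normr_le0; apply/ler_addgt0Pr => eps e00; rewrite add0r.
    have [d d0 dP] := diff_eps (C2 c cB).1 e00.
    pose m := Num.min d r; have m0 : 0 < m by rewrite lt_min d0.
    pose s := m / 2; have s0 : 0 < s by rewrite divr_gt0.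
    have : s < m by rewrite /s; lra.
    rewrite lt_min => /andP[sd sr].
    have es : enorm (s *: e0) = s by rewrite enorm_evec // ltW.
    have A := dP (s *: e0); rewrite es in A; have {}A := A sd.
    have B := dP (s *: - e0); rewrite scalerN enormN es in B; have {}B := B sd.
    have vE : v (c + s *: e0) = v (c - s *: e0).
      have E1 : enorm (c + s *: e0 - c) = s by rewrite addrAC subrr add0r es.
      have E2 : enorm (c - s *: e0 - c) = s by rewrite addrAC subrr add0r enormN es.
      by apply: solpde_radial r0 sv _ _; rewrite E1 ?E2 // ltW.
    have S (t : R) : \sum_i (t *: e0) 0 i * pd i v c = t * pd i0 v c.
      under eq_bigr => i _ do rewrite mxE -mulrA.
      by rewrite -mulr_sumr sum_evec.
    rewrite S in A; rewrite -scaleNr S scaleNr -vE in B.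
    have : `|2 * s * pd i0 v c| <= 2 * (eps * s).
      rewrite (_ : _ * _ = (v (c + s *: e0) - v c - - s * pd i0 v c) -
        (v (c + s *: e0) - v c - s * pd i0 v c)); last by ring.
      apply: le_trans (ler_normB _ _) _; lra.
    rewrite normrM gtr0_norm ?mulr_gt0 // => H.
    by rewrite -(ler_pM2l (_ : 0 < 2 * s)) ?mulr_gt0 //; lra.
  move=> eps e00; have [d d0 dP] := cont0 _ eps ((C2 c cB).2 i0) e00.
  by exists d => // s /dP; rewrite pd0 subr0.
Qed.

End Solutions.

(** * The global radial profile *)

Section GlobalProfile.
Context {R : realType}.
Variables (p : R) (n : nat).
Hypothesis p1 : 1 < p.
Hypothesis n1 : (1 < n)%N.
Let p0 : 0 < p. Proof. exact: lt_trans p1. Qed.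
Implicit Types (s t : R).

(** Here [n = N - 1], so [gp_out] is the branch of the radial harmonic functions [A + B s^(2-N)]
    that vanishes at 1 and carries the constant flux [m]. *)
Record global_profile (U U1 : R -> R) (m : R) : Prop := GlobalProfile {
  gp_profile : forall b, profile p n b U U1;
  gp_m : 0 < m;
  gp_pos : forall s, 0 <= s < 1 -> 0 < U s;
  gp_out : forall s, 1 <= s -> U s = - (m / (n.-1)%:R * (1 - s ^- n.-1));
  gp_flux : forall s, 1 <= s -> flux n U1 s = m }.

(** The hypotheses contain no slope of [V] at 1. The flux is monotone and bounded on the open
    interval, so its supremum [m] is its limit at 1 and fixes the harmonic continuation; gluing then
    yields the equation at 1 itself. *)
Lemma global_profile_exists (V V1 : R -> R) : profile p n 1 V V1 -> 
  (forall s, 0 <= s < 1 -> 0 < V s) ->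
  (forall eps, 0 < eps -> exists2 d, 0 < d & forall s, 1 - d < s < 1 -> V s < eps) ->
  exists U U1 m, global_profile U U1 m /\ forall s, s < 1 -> U s = V s /\ U1 s = V1 s.
Proof.
move=> P Vpos V1lim; have [DV DV1 V0 V10] := P.
pose S := [set flux n V1 s | s in [set s | 0 < s < 1]].
have half : 0 < (2^-1 : R) < 1 by apply/andP; split; lra.
have Sne : S !=set0 by exists (flux n V1 2^-1); exists 2^-1.
(* Beyond 1/2 the flux has slope at most [pospow p (V 0)], since [V] never exceeds [V 0]; up to 1/2
   monotonicity is enough. *)
have Sub : has_ubound S.
  exists (flux n V1 2^-1 + pospow p (V 0)) => _ [s /= /andP[s0 s1] <-].
  have [s2|s2] := leP s 2^-1.
    apply: le_trans (flux_homo P s0 s2 _) _; first by lra.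
    by rewrite lerDl pospow_ge0.
  have [|z /andP[sz zt] E] := MVT_is_derive (f := flux n V1) (df := fun s => s ^+ n * pospow p (V s)) s2.
    by move=> z /andP[z1 z2]; apply: flux_derive P _; apply/andP; split; lra.
  rewrite -lerBlDl E; apply: (@le_trans _ _ (1 * pospow p (V 0) * 1)); last by rewrite mulr1 mul1r.
  apply: ler_pM; first 1 last.
  - lra.
  - apply: ler_pM; rewrite ?pospow_ge0 ?exprn_ge0 //; first by lra.
      by apply: exprn_ile1; lra.
    by apply: pospow_homo => //; apply: profile_le0 P _ => //; apply/andP; split; lra.
  - lra.
  - by rewrite mulr_ge0 ?pospow_ge0 ?exprn_ge0 //; lra.
have Ss : has_sup S by [].
pose m := sup S.
have leS s : 0 < s < 1 -> flux n V1 s <= m by move=> sr; apply: sup_upper_bound => //; exists s.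
have m0 : 0 < m by apply: lt_le_trans (leS _ half); apply: flux_gt0 P _ half => //; rewrite Vpos ?lexx ?ltr01.
have limS eps : 0 < eps -> exists2 d, 0 < d & forall s, 1 - d < s < 1 -> `|flux n V1 s - m| < eps.
  move=> e0; have [_ [t /= /andP[t0 t1] <-] tm] := sup_adherent e0 Ss.
  exists (1 - t); first by rewrite subr_gt0.
  move=> s /andP[s1 s2]; rewrite distrC ger0_norm ?subr_ge0 ?leS //; last by apply/andP; split; lra.
  have := flux_homo P t0 (_ : t <= s) s2; rewrite -/m in tm.
  move=> H; have {}H : flux n V1 t <= flux n V1 s by apply: H; lra.
  lra.
pose k : R := (n.-1)%:R; have k0 : 0 < k by rewrite /k ltr0n -subn1 subn_gt0.
have nk : n%:R = k + 1 by rewrite /k natr1 prednK // (ltn_trans _ n1).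
pose U s := if s < 1 then V s else - (m / k * (1 - s ^- n.-1)).
pose U1 s := if s < 1 then V1 s else - (m / s ^+ n).
have Ulow s : s < 1 -> U s = V s by rewrite /U => ->.
have U1low s : s < 1 -> U1 s = V1 s by rewrite /U1 => ->.
have Uhigh s : 1 <= s -> U s = - (m / k * (1 - s ^- n.-1)) by rewrite /U ltNge => ->.
have U1high s : 1 <= s -> U1 s = - (m / s ^+ n) by rewrite /U1 ltNge => ->.
have Uneg s : 1 <= s -> U s <= 0.
  move=> s1; rewrite Uhigh // oppr_le0 mulr_ge0 ?divr_ge0 ?(ltW m0) ?(ltW k0) // subr_ge0.
  by rewrite invf_le1 ?exprn_gt0 ?(lt_le_trans ltr01) // exprn_ege1.
have DUhigh s : 0 < s -> is_derive s 1 (fun s => - (m / k * (1 - s ^- n.-1))) (- (m / s ^+ n)).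
  move=> s0; have sn0 : s ^+ n.-1 != 0 by rewrite expf_neq0 // lt0r_neq0.
  have D0 : is_derive s 1 (fun t => t ^+ n.-1) _ := is_derive_pow n.-1 (is_derive_id s 1).
  have D1 := is_derive1_comp (f := fun t => t^-1) (g := fun t => t ^+ n.-1) (is_derive_inv sn0) D0.
  have -> : (fun s => - (m / k * (1 - s ^- n.-1))) = (fun s => - (m / k) * (1 - s ^- n.-1)).
    by apply/funext => t; rewrite mulNr.
  have D2 : is_derive s 1 (fun t => 1 - t ^- n.-1) _ := is_derive_minus (is_derive_cst (1 : R) s 1) D1.
  have D3 : is_derive s 1 (fun t => - (m / k) * (1 - t ^- n.-1)) _ := is_derive_scale (- (m / k)) D2.
  apply: is_derive_eq D3 _.
  rewrite /= -/k.
  have e1 : s ^+ n.-1 = s * s ^+ n.-2 by rewrite -exprS prednK // -subn1 subn_gt0.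
  have e2 : s ^+ n = s * (s * s ^+ n.-2) by rewrite -e1 -exprS prednK // (ltn_trans _ n1).
  rewrite e1 e2; field.
  by rewrite expf_neq0 ?(lt0r_neq0 s0) // (lt0r_neq0 k0).
have cUhigh s : 0 < s -> {for s, continuous (fun s => - (m / k * (1 - s ^- n.-1)))}.
  move=> s0; apply: differentiable_continuous; apply/derivable1_diffP.
  by have [] := DUhigh s s0.
exists U, U1, m; split; last by move=> s s1; rewrite Ulow ?U1low.
have U_1 : U 1 = 0 by rewrite Uhigh // expr1n invr1 subrr mulr0 oppr0.
have U1_1 : U1 1 = - m by rewrite U1high // expr1n divr1.
have flux_high s : 1 <= s -> flux n U1 s = m.
  move=> s1; rewrite /flux U1high // mulrN opprK mulrC divfK // expf_neq0 //.
  by rewrite lt0r_neq0 // (lt_le_trans ltr01).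
have cU : {for 1, continuous U}.
  apply/cvgrPdist_lt => e e0; rewrite U_1.
  have [d d0 dP] := V1lim e e0.
  have /cvgrPdist_lt/(_ e e0)/nbhs_ballP[d' /= d'0 d'P] := cUhigh 1 ltr01.
  apply/nbhs_ballP; exists (Num.min d (Num.min d' 1)); first by rewrite /= !lt_min d0 d'0 ltr01.
  move=> s; rewrite /ball /= !lt_min => /and3P[a1 sd' a2].
  have /andP[{}a1 a3] : - d < 1 - s < d by rewrite -ltr_norml.
  have /andP[{}a2 a4] : - 1 < 1 - s < 1 by rewrite -ltr_norml.
  rewrite sub0r; have [s1|s1] := ltP s 1.
    rewrite Ulow // normrN gtr0_norm ?dP ?Vpos //; apply/andP; split; lra.
  have := d'P s sd'.
  by rewrite -(Uhigh 1) // U_1 sub0r Uhigh // normrN.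
have cflux : {for 1, continuous (flux n U1)}.
  apply/cvgrPdist_lt => e e0; rewrite flux_high //.
  have [d d0 dP] := limS e e0.
  apply/nbhs_ballP; exists d => // s; rewrite /ball /= => sd.
  have /andP[a1 a2] : - d < 1 - s < d by rewrite -ltr_norml.
  have [s1|s1] := ltP s 1; last by rewrite flux_high // subrr normr0.
  by rewrite distrC /flux U1low // dP //; apply/andP; split; lra.
have cU1 : {for 1, continuous U1}.
  have H : (fun s : R => - (flux n U1 s / s ^+ n)) @ (1 : R) --> U1 1.
    rewrite U1_1 -(flux_high 1 (lexx 1)) -[X in - X]divr1 -[X in _ / X](expr1n R n).
    apply: cvgN; apply: cvgM; first exact: cflux.
    apply: cvgV; first by rewrite expr1n oner_neq0.
    exact: exprn_continuous.
  apply: cvg_trans H; apply: near_eq_cvg; near=> s.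
  rewrite /flux mulNr opprK mulrC mulKf // expf_neq0 // lt0r_neq0 //.
  near: s; exact: lt_nbhsr.
have near_low (f g : R -> R) s : s < 1 -> (forall t, t < 1 -> f t = g t) ->
    \forall t \near s, g t = f t.
  move=> s1 fg; have : nbhs s [set t | t < 1] by apply: open_nbhs_nbhs; split => //; exact: open_lt.
  by apply: filterS => t /= /fg.
have near_high (f g : R -> R) s : 1 < s -> (forall t, 1 <= t -> f t = g t) ->
    \forall t \near s, g t = f t.
  move=> s1 fg; have : nbhs s [set t | 1 < t] by apply: open_nbhs_nbhs; split => //; exact: open_gt.
  by apply: filterS => t /= /ltW /fg.
have DU s : 0 < s -> s != 1 -> is_derive s 1 U (U1 s).
  move=> s0 sn1; have [s1|s1] := ltP s 1.
    rewrite U1low //; apply: near_eq_is_derive (near_low _ _ _ s1 Ulow) _.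
    by apply: DV; rewrite s0.
  have {}s1 : 1 < s by rewrite lt_neqAle eq_sym sn1.
  rewrite U1high ?ltW //; apply: near_eq_is_derive (near_high _ _ _ s1 Uhigh) _.
  exact: DUhigh.
pose U2 s := - pospow p (U s) - n%:R * (U1 s / s).
have DU1 s : 0 < s -> s != 1 -> is_derive s 1 U1 (U2 s).
  move=> s0 sn1; have [s1|s1] := ltP s 1.
    rewrite /U2 U1low // Ulow //; apply: near_eq_is_derive (near_low _ _ _ s1 U1low) _.
    by apply: DV1; rewrite s0.
  have {}s1 : 1 < s by rewrite lt_neqAle eq_sym sn1.
  rewrite /U2 (pospow_le0 p0 (Uneg _ (ltW s1))) U1high ?ltW //.
  apply: near_eq_is_derive (near_high _ _ _ s1 U1high) _.
  have sn0 : s ^+ n != 0 by rewrite expf_neq0 // lt0r_neq0.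
  have D0 : is_derive s 1 (fun t => t ^+ n) _ := is_derive_pow n (is_derive_id s 1).
  have D1 := is_derive1_comp (f := fun t => t^-1) (g := fun t => t ^+ n) (is_derive_inv sn0) D0.
  have -> : (fun s => - (m / s ^+ n)) = (fun s => - m * s ^- n).
    by apply/funext => t; rewrite mulNr.
  have D2 : is_derive s 1 (fun t => - m * t ^- n) _ := is_derive_scale (- m) D1.
  apply: is_derive_eq D2 _.
  have e1 : s ^+ n = s * s ^+ n.-1 by rewrite -exprS prednK // (ltn_trans _ n1).
  rewrite /= mulr1 e1; field.
  by rewrite expf_neq0 ?(lt0r_neq0 s0).
(* The right-hand side of the equation is continuous across 1 because [U] and [U1] are, so it can
   act as the derivative of [U1] in the gluing. *)
have cU2 : {for 1, continuous U2}.
  apply: cvgB.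
    apply: cvgN; apply: (@continuous_comp _ _ _ U (pospow p)) => //.
    exact: pospow_continuous.
  apply: cvgM; first exact: cvg_cst.
  apply: cvgM; first exact: cU1.
  by apply: cvgV => //; exact: oner_neq0.
have half0 : 0 < (2^-1 : R) by lra.
split => //.
- move=> b; split.
  + move=> s /andP[s0 _]; have [->|sn1] := eqVneq s 1; last exact: DU.
    apply: (is_derive_glue half0) => // t /andP[t1 t2]; apply: DU; lra.
  + move=> s /andP[s0 _]; have [->|sn1] := eqVneq s 1; last exact: DU1.
    apply: (is_derive_glue (g := U2) half0) => // t /andP[t1 t2]; apply: DU1; lra.
  + move=> e e0; have [d d0 dP] := V0 e e0; exists (Num.min d 1); first by rewrite lt_min d0 ltr01.
    by move=> s; rewrite lt_min => /and3P[s0 sd s1]; rewrite !Ulow ?ltr01 // dP // s0.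
  + move=> e e0; have [d d0 dP] := V10 e e0; exists (Num.min d 1); first by rewrite lt_min d0 ltr01.
    by move=> s; rewrite lt_min => /and3P[s0 sd s1]; rewrite U1low // dP // s0.
- by move=> s /[dup] /Vpos ? /andP[_ s1]; rewrite Ulow.
Unshelve. all: by end_near. Qed.

End GlobalProfile.

(** * Scaling *)

Section Scaling.
Context {R : realType} {N : nat}.
Implicit Types (c x y : 'rV[R]_N) (a k r tau beta : R) (w : 'rV[R]_N -> R).

Lemma holder_on_C beta (A : set 'rV[R]_N) w : holder_on beta A w ->
  exists2 C, 0 <= C & forall x y, A x -> A y -> `|w x - w y| <= C * enorm (x - y) `^ beta.
Proof.
move=> [C CP]; exists `|C| => // x y Ax Ay; apply: le_trans (CP x y Ax Ay) _.
by apply: ler_wpM2r; [exact: powR_ge0 | exact: ler_norm].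
Qed.

Lemma holder_on_eq beta (A : set 'rV[R]_N) w w' : (forall x, A x -> w x = w' x) ->
  holder_on beta A w -> holder_on beta A w'.
Proof. by move=> ww' [C CP]; exists C => x y Ax Ay; rewrite -!ww' //; exact: CP. Qed.

Variables (c c' : 'rV[R]_N) (tau : R).
Hypothesis tau0 : 0 < tau.
Let T x := tau *: (x - c) + c'.

Lemma enorm_aff x y : enorm (T x - T y) = tau * enorm (x - y).
Proof.
rewrite /T opprD addrACA subrr addr0 -scalerBr enormZ gtr0_norm //.
by rewrite opprB addrA subrK.
Qed.

Lemma enorm_aff_center x : enorm (T x - c') = tau * enorm (x - c).
Proof. by rewrite /T addrK enormZ gtr0_norm. Qed.

Lemma affine_pd w a k x i : differentiable w (T x) ->
  differentiable (fun y => a + k * w (T y)) x /\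
  pd i (fun y => a + k * w (T y)) x = k * tau * pd i w (T x).
Proof.
move=> dw.
have dT : is_diff x T ( *:%R tau).
  have H : is_diff x (tau *: (@id 'rV[R]_N - cst c) + cst c') (tau *: (@id 'rV[R]_N - 0) + 0).
    by apply: is_diffD.
  by rewrite subr0 addr0 in H.
have dwT := is_diff_comp dT (differentiableP dw).
have H : is_diff x (cst a + k *: (w \o T)) (0 + k *: ('d w (T x) \o *:%R tau)).
  exact: is_diffD.
have D : differentiable (cst a + k *: (w \o T)) x by apply: ex_diff.
split; first exact: D.
rewrite /pd (deriveE _ (D : differentiable (fun y => a + k * w (T y)) x)).
rewrite (@diff_val _ _ _ _ _ _ _ H) deriveE // /= !fctE add0r /= linearZ /=.
by rewrite /GRing.scale /= mulrA.
Qed.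

Lemma affine_pd_on w a k r : 
  (forall x, eball c' (tau * r) x -> differentiable w x /\ forall i, differentiable (pd i w) x) ->
  forall x, eball c r x -> let v := fun y => a + k * w (T y) in
    [/\ differentiable v x, forall i, pd i v x = k * tau * pd i w (T x),
     forall i, differentiable (pd i v) x &
     forall i j, pd j (pd i v) x = k * tau * tau * pd j (pd i w) (T x)].
Proof.
move=> C2 x xr v.
have inT y : eball c r y -> eball c' (tau * r) (T y).
  by rewrite /eball /= enorm_aff_center ltr_pM2l.
have pdv i y : eball c r y -> pd i v y = 0 + k * tau * pd i w (T y).
  by move=> /inT/C2[dw _]; rewrite add0r; have [] := affine_pd a k i dw.
have [dw dpw] := C2 _ (inT x xr).
have near_pd i : \forall y \near x, 0 + k * tau * pd i w (T y) = pd i v y.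
  have : nbhs x (eball c r) by apply: open_nbhs_nbhs; split => //; exact: open_eball.
  by apply: filterS => y /pdv ->.
split.
(* [affine_pd] is stated with a coordinate index; when there is none, all row vectors coincide and
   [v] is constant. *)
- have [[i _]|N0] := pselect (exists i : 'I_N, True).
    by have [] := affine_pd a k i dw.
  have -> : v = cst (v x).
    apply/funext => y; congr v; apply/rowP => i; case: N0; by exists i.
  exact: differentiable_cst.
- by move=> i; rewrite pdv // add0r.
- move=> i; apply: near_eq_differentiable (near_pd i) _.
  by have [] := affine_pd 0 (k * tau) i (dpw i).
- move=> i j; rewrite {1}/pd -(near_eq_derive _ (near_pd i)).
  by have [_] := affine_pd 0 (k * tau) j (dpw i).
Qed.

Lemma affine_lap w a k r : 
  (forall x, eball c' (tau * r) x -> differentiable w x /\ forall i, differentiable (pd i w) x) ->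
  forall x, eball c r x ->
    lap (fun y => a + k * w (T y)) x = k * tau * tau * lap w (T x).
Proof.
move=> C2 x xr; have [_ _ _ H] := affine_pd_on a k C2 xr.
by rewrite /lap mulr_sumr; apply: eq_bigr => i _; exact: H.
Qed.

Lemma affine_C2beta w a k r beta : C2beta beta c' (tau * r) w ->
  C2beta beta c r (fun y => a + k * w (T y)).
Proof.
move=> [wc C2 h0 h1 h2]; set v := fun y => _.
have inT y : eball c r y -> eball c' (tau * r) (T y).
  by rewrite /eball /= enorm_aff_center ltr_pM2l.
have inTc y : ecball c r y -> ecball c' (tau * r) (T y).
  by rewrite /ecball /= enorm_aff_center ler_pM2l.
have hol (g : 'rV[R]_N -> R) b l : holder_on beta (eball c' (tau * r)) g ->
    holder_on beta (eball c r) (fun y => b + l * g (T y)).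
  move=> /holder_on_C[C C0 CP]; exists (`|l| * C * tau `^ beta) => x y xr yr.
  rewrite opprD addrACA subrr add0r -mulrBr normrM -!mulrA; apply: ler_wpM2l => //.
  apply: le_trans (CP _ _ (inT _ xr) (inT _ yr)) _.
  by rewrite enorm_aff powRM ?enorm_ge0 // ltW.
split.
- apply/within_epsP => x eps xr e0.
  have e1 : 0 < eps / (`|k| + 1) by rewrite divr_gt0 // ltr_wpDl.
  have [d d0 dP] := (within_epsP _ _).1 wc _ _ (inTc x xr) e1.
  exists (d / tau); first by rewrite divr_gt0.
  move=> y yr yd; rewrite /v opprD addrACA subrr add0r -mulrBr normrM.
  have : `|w (T y) - w (T x)| < eps / (`|k| + 1).
    apply: dP; first exact: inTc.
    by rewrite enorm_aff mulrC -ltr_pdivlMr.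
  rewrite ltr_pdivlMr ?ltr_wpDl // => H; apply: le_lt_trans H.
  by rewrite mulrC ler_wpM2l // lerDl.
- by move=> x xr; have [] := affine_pd_on a k C2 xr.
- exact: hol.
- move=> i; apply: holder_on_eq (hol _ 0 (k * tau) (h1 i)) => x xr.
  by have [_ -> _ _] := affine_pd_on a k C2 xr; rewrite add0r.
- move=> i j; apply: holder_on_eq (hol _ 0 (k * tau * tau) (h2 i j)) => x xr.
  by have [_ _ _ ->] := affine_pd_on a k C2 xr; rewrite add0r.
Qed.

End Scaling.

(** * Regularity of the global radial solution *)

Section LipschitzBounded.
Context {R : realType} {N : nat}.
Implicit Types (x y : 'rV[R]_N) (A : set 'rV[R]_N) (f g : 'rV[R]_N -> R).

(** Bounding the values along with the increments makes the class closed under products, so the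
    explicit radial Hessian can be assembled factor by factor. *)
Definition lipb A f := exists2 C, 0 <= C & forall x y, A x -> A y ->
  `|f x| <= C /\ `|f x - f y| <= C * enorm (x - y).

Lemma lipbD A f g : lipb A f -> lipb A g -> lipb A (fun x => f x + g x).
Proof.
move=> [C C0 CP] [D D0 DP]; exists (C + D); first exact: addr_ge0.
move=> x y Ax Ay; have [a1 a2] := CP x y Ax Ay; have [b1 b2] := DP x y Ax Ay; split.
  by apply: le_trans (ler_normD _ _) _; exact: lerD.
by rewrite opprD addrACA mulrDl; apply: le_trans (ler_normD _ _) _; exact: lerD.
Qed.

Lemma lipbM A f g : lipb A f -> lipb A g -> lipb A (fun x => f x * g x).
Proof.
move=> [C C0 CP] [D D0 DP]; exists (C * D + C * D); first by rewrite addr_ge0 // mulr_ge0.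
move=> x y Ax Ay; have [a1 a2] := CP x y Ax Ay; have [b1 b2] := DP x y Ax Ay.
have [a3 _] := CP y x Ay Ax; split.
  by rewrite normrM (@le_trans _ _ (C * D)) ?ler_pM // lerDl mulr_ge0.
rewrite (_ : _ - _ = (f x - f y) * g x + f y * (g x - g y)); last by ring.
apply: le_trans (ler_normD _ _) _; rewrite !normrM mulrDl; apply: lerD.
  by rewrite mulrAC ler_pM.
by rewrite -mulrA ler_pM.
Qed.

Lemma lipb_cst A (k : R) : lipb A (fun=> k).
Proof. by exists `|k| => // x y _ _; split => //; rewrite subrr normr0 mulr_ge0 ?enorm_ge0. Qed.

Lemma lipb_eq A f g : (forall x, A x -> f x = g x) -> lipb A f -> lipb A g.
Proof. by move=> fg [C C0 CP]; exists C => // x y Ax Ay; rewrite -!fg //; exact: CP. Qed.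

Lemma lipb_holder A f beta (D : R) : 0 < beta < 1 -> 
  (forall x y, A x -> A y -> enorm (x - y) <= D) -> lipb A f -> holder_on beta A f.
Proof.
move=> /andP[b0 b1] AD [C C0 CP]; exists (C * D `^ (1 - beta)) => x y Ax Ay.
have [_ H] := CP x y Ax Ay; apply: le_trans H _; rewrite -mulrA; apply: ler_wpM2l => //.
have [->|xy] := eqVneq (enorm (x - y)) 0; first by rewrite mulr_ge0 ?powR_ge0.
have {xy}xy : 0 < enorm (x - y) by rewrite lt_neqAle eq_sym xy enorm_ge0.
have D0 : 0 <= D by apply: le_trans (AD x y Ax Ay); exact: ltW.
rewrite -[leLHS](powRr1 (ltW xy)) -[X in _ `^ X](subrK beta) powRD ?(gt_eqF xy) ?implybT //.
apply: ler_wpM2r; first exact: powR_ge0.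
by apply: ge0_ler_powR; rewrite ?nnegrE ?(ltW xy) ?subr_ge0 ?(ltW b1) // AD.
Qed.

Lemma lipb_radial (a b D : R) (h : R -> R) :
  (forall s, a < s < b -> `|h s| <= D) ->
  (forall s t, a < s < b -> a < t < b -> `|h s - h t| <= D * `|s - t|) ->
  lipb [set x | a < enorm (x - 0) < b] (fun x => h (enorm (x - 0))).
Proof.
move=> h1 h2; exists `|D| => // x y /= xr yr; split.
  by apply: le_trans (h1 _ xr) _; exact: ler_norm.
apply: le_trans (h2 _ _ xr yr) _; apply: (@le_trans _ _ (`|D| * `|enorm (x - 0) - enorm (y - 0)|)).
  by apply: ler_wpM2r => //; exact: ler_norm.
apply: ler_wpM2l => //; rewrite !subr0; exact: enorm_dist.
Qed.

Lemma lipb_coord (b : R) i : lipb (eball 0 b) (fun x => (x - 0) 0 i).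
Proof.
exists (Num.max `|b| 1); first by rewrite le_max normr_ge0.
move=> x y xb yb; rewrite !subr0; split.
  apply: le_trans (coord_le_enorm _ _) _; rewrite le_max; apply/orP; left.
  by move: xb; rewrite /eball /= subr0 => /ltW/le_trans; apply; exact: ler_norm.
apply: (@le_trans _ _ (1 * enorm (x - y))).
  by rewrite mul1r; have := coord_le_enorm (x - y) i; rewrite !mxE.
by apply: ler_wpM2r; [exact: enorm_ge0 | rewrite le_max lexx orbT].
Qed.

Lemma lipb_sub A B f : B `<=` A -> lipb A f -> lipb B f.
Proof. by move=> BA [C C0 CP]; exists C => // x y /BA Ax /BA Ay; exact: CP. Qed.

Lemma MVT_lip (h h1 : R -> R) (a b D : R) :
  (forall s, a < s < b -> is_derive s 1 h (h1 s)) ->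
  (forall s, a < s < b -> `|h1 s| <= D) ->
  forall s t, a < s < b -> a < t < b -> `|h s - h t| <= D * `|s - t|.
Proof.
move=> Dh h1D.
have H s t : a < s < b -> a < t < b -> s < t -> `|h s - h t| <= D * `|s - t|.
  move=> /andP[s1 s2] /andP[t1 t2] st.
  have [|z /andP[sz zt] E] := @MVT_is_derive _ h h1 s t st.
    by move=> z /andP[z1 z2]; apply: Dh; rewrite (lt_le_trans s1 z1) (le_lt_trans z2 t2).
  rewrite distrC E normrM (distrC s); apply: ler_wpM2r => //.
  by apply: h1D; rewrite (lt_trans s1 sz) (lt_trans zt t2).
move=> s t sr tr; have [st|ts|->] := ltgtP s t; first exact: H.
  by rewrite distrC (distrC s); apply: H.
by rewrite !subrr normr0 mulr0.
Qed.

(** Two points lying in neither common piece are separated by at least 1/2 in norm; passing through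
    a point [z] of norm 3/4, which belongs to both pieces, costs a bounded amount. *)
Lemma holder_union f beta b : 0 < beta ->
  holder_on beta (eball 0 1) f ->
  holder_on beta [set x | 2^-1 < enorm (x - 0) < b] f ->
  holder_on beta (eball 0 b) f.
Proof.
move=> beta0 /holder_on_C[C C0 CP] /holder_on_C[D D0 DP].
(* The total cost of the detour through [z], divided by the least possible value of [enorm (x - y)]
   to the power [beta]. *)
pose K := (C * 2 `^ beta + D * (2 * `|b|) `^ beta) / 2^-1 `^ beta.
have h0 : 0 < (2^-1 : R) by lra.
have K0 : 0 <= K by rewrite divr_ge0 ?addr_ge0 ?mulr_ge0 ?powR_ge0.
have far x y : enorm x <= 2^-1 -> 1 <= enorm y -> enorm y < b ->
    `|f x - f y| <= K * enorm (x - y) `^ beta.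
  move=> xs y1 yb; have y0 : 0 < enorm y by apply: lt_le_trans y1.
  have b1 : 1 < b by apply: le_lt_trans yb.
  pose z := (3 / 4 / enorm y) *: y.
  have zE : enorm z = 3 / 4.
    by rewrite /z enormZ gtr0_norm ?divr_gt0 // divfK // lt0r_neq0.
  have H1 : `|f x - f z| <= C * 2 `^ beta.
    apply: le_trans (CP x z _ _) _; rewrite /eball /= ?subr0 ?zE; [lra|lra|].
    apply: ler_wpM2l => //; apply: ge0_ler_powR; rewrite ?nnegrE ?enorm_ge0 ?(ltW beta0) //.
    by apply: le_trans (enormD _ _) _; rewrite enormN zE; lra.
  have H2 : `|f z - f y| <= D * (2 * `|b|) `^ beta.
    apply: le_trans (DP z y _ _) _; rewrite /= ?subr0 ?zE; [apply/andP; lra|apply/andP; lra|].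
    apply: ler_wpM2l => //; apply: ge0_ler_powR; rewrite ?nnegrE ?enorm_ge0 ?(ltW beta0) ?mulr_ge0 //.
    by apply: le_trans (enormD _ _) _; rewrite enormN zE; have := ler_norm b; lra.
  have H3 : 2^-1 `^ beta <= enorm (x - y) `^ beta.
    apply: ge0_ler_powR; rewrite ?nnegrE ?enorm_ge0 ?(ltW beta0) ?(ltW h0) //.
    by have := enormD (y - x) x; rewrite subrK enormB; lra.
  rewrite -(subrK (f z) (f x)) -addrA; apply: le_trans (ler_normD _ _) _.
  apply: le_trans (lerD H1 H2) _; rewrite /K -mulrA.
  rewrite ler_peMr ?addr_ge0 ?mulr_ge0 ?powR_ge0 //.
  by rewrite mulrC ler_pdivlMr ?powR_gt0 // mul1r.
exists (C + D + K) => x y; rewrite /eball /= !subr0 => xb yb.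
have P0 := powR_ge0 (enorm (x - y)) beta; rewrite !mulrDl.
have HC : 0 <= C * enorm (x - y) `^ beta by rewrite mulr_ge0.
have HD : 0 <= D * enorm (x - y) `^ beta by rewrite mulr_ge0.
have HK : 0 <= K * enorm (x - y) `^ beta by rewrite mulr_ge0.
have [x1|x1] := ltP (enorm x) 1; have [y1|y1] := ltP (enorm y) 1.
- by have := CP x y; rewrite /eball /= !subr0 => /(_ x1 y1); lra.
- have [xh|xh] := leP (enorm x) 2^-1; first by have := far x y xh y1 yb; lra.
  have := DP x y; rewrite /= !subr0 xh xb yb andbT => /(_ isT).
  have -> : 2^-1 < enorm y by lra.
  by move=> /(_ isT); lra.
- have [yh|yh] := leP (enorm y) 2^-1.
    by have := far y x yh x1 xb; rewrite distrC enormB; lra.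
  have := DP x y; rewrite /= !subr0 yh xb yb andbT.
  have -> : 2^-1 < enorm x by lra.
  by move=> /(_ isT isT); lra.
- have := DP x y; rewrite /= !subr0 xb yb !andbT.
  have -> : 2^-1 < enorm x by lra.
  have -> : 2^-1 < enorm y by lra.
  by move=> /(_ isT isT); lra.
Qed.

End LipschitzBounded.

Section GlobalSolution.
Context {R : realType} {N : nat}.
Variables (p beta : R) (u : 'rV[R]_N -> R) (U U1 : R -> R) (m : R) (i0 : 'I_N).
Hypothesis p1 : 1 < p.
Hypothesis beta01 : 0 < beta < 1.
Hypothesis n1 : (1 < N.-1)%N.
Hypothesis hu : C2beta beta 0 1 u.
Hypothesis su : solpde p 0 1 0 u.
Hypothesis gp : global_profile p N.-1 U U1 m.
Hypothesis uU : forall s : R, 0 <= s < 1 -> U s = u (0 + s *: evec R i0).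
Let p0 : 0 < p. Proof. exact: lt_trans p1. Qed.

Definition radial_sol (x : 'rV[R]_N) := U (enorm (x - 0)).
Let ut := radial_sol.

Lemma radial_sol_in x : eball 0 1 x -> u x = ut x.
Proof.
move=> xr; rewrite /ut /radial_sol uU ?enorm_ge0 //.
apply: (solpde_radial p1 i0 ltr01 su); first exact: ltW.
by rewrite add0r !subr0 enorm_evec // enorm_ge0.
Qed.

Lemma gp_DU (s : R) : 0 < s -> is_derive s 1 U (U1 s).
Proof. by move=> s0; have [H _ _ _] := gp_profile gp (s + 1); apply: H; rewrite s0 ltrDl ltr01. Qed.

Lemma gp_DU1 (s : R) : 0 < s ->
  is_derive s 1 U1 (- pospow p (U s) - (N.-1)%:R * (U1 s / s)).
Proof. by move=> s0; have [_ H _ _] := gp_profile gp (s + 1); apply: H; rewrite s0 ltrDl ltr01. Qed.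

Lemma gp_le0 (s : R) : 0 < s -> U s <= U 0.
Proof. by move=> s0; apply: profile_le0 (gp_profile gp (s + 1)) _; rewrite s0 ltrDl ltr01. Qed.

Lemma gp_flux_ge0 (s : R) : 0 < s -> 0 <= flux N.-1 U1 s.
Proof. by move=> s0; apply: flux_ge0 (gp_profile gp (s + 1)) _; rewrite s0 ltrDl ltr01. Qed.

Lemma gp_flux_le (s : R) : 0 < s -> flux N.-1 U1 s <= m.
Proof.
move=> s0; have [s1|s1] := leP 1 s; first by rewrite (gp_flux gp s1).
rewrite -(gp_flux gp (lexx 1)); apply: flux_homo (gp_profile gp 2) s0 (ltW s1) _.
by rewrite ltr1n.
Qed.

Lemma N1E : (N.-1)%:R = N%:R - 1 :> R.
Proof. by case: (N) i0 => [[]//|n _]; rewrite /= -natr1 addrK. Qed.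

Let shell0 (x : 'rV[R]_N) : 1 <= enorm x -> 0 < enorm (x - 0) < enorm x + 1.
Proof. by move=> x1; rewrite subr0 ltrDl ltr01 andbT; apply: lt_le_trans x1. Qed.

Let DUb (b s : R) : 0 < s < b -> is_derive s 1 U (U1 s).
Proof. by move=> /andP[s0 _]; exact: gp_DU. Qed.

Let DU1b (b s : R) : 0 < s < b ->
  is_derive s 1 U1 (- pospow p (U s) - (N.-1)%:R * (U1 s / s)).
Proof. by move=> /andP[s0 _]; exact: gp_DU1. Qed.

(** In the unit ball the function is [u], which covers the centre where the radial formulas
    degenerate; from radius 1 on, the radial calculus applies. *)
Lemma radial_sol_C2 x :
  differentiable ut x /\ forall i, differentiable (pd i ut) x.
Proof.
have [_ C2 _ _] := su.
have [x1|x1] := ltP (enorm x) 1; last first.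
  split; first exact: (radial_pd (lexx 0) (@DUb _) i0 (shell0 x1)).1.
  by move=> i; exact: (radial_pd2 (lexx 0) (@DUb _) (@DU1b _) i i0 (shell0 x1)).1.
have xB : eball 0 1 x by rewrite /eball /= subr0.
have [d0 d1] := C2 x xB.
have nB : nbhs x (eball 0 1) by apply: open_nbhs_nbhs; split => //; exact: open_eball.
split; first by apply: near_eq_differentiable d0; apply: filterS nB => y /radial_sol_in.
move=> i; apply: near_eq_differentiable (d1 i).
by apply: filterS nB; apply: pd_eq_on; [exact: open_eball | exact: radial_sol_in].
Qed.

Lemma radial_sol_lap x : - lap ut x = pospow p (ut x).
Proof.
have [_ _ vlap _] := su.
have [x1|x1] := ltP (enorm x) 1; last first.
  rewrite (radial_lap (lexx 0) (@DUb _) (@DU1b _) (shell0 x1)) N1E /ut /radial_sol.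
  by ring.
have xB : eball 0 1 x by rewrite /eball /= subr0.
have lapE : lap u x = lap ut x := lap_eq_on (@open_eball _ _ 0 1) radial_sol_in xB.
by rewrite -lapE (vlap x xB) (radial_sol_in xB).
Qed.

Lemma radial_sol_continuous : continuous ut.
Proof. by move=> x; apply: differentiable_continuous; exact: (radial_sol_C2 x).1. Qed.

Let A (b : R) := [set x : 'rV[R]_N | 2^-1 < enorm (x - 0) < b].

Let half0 (s : R) : 2^-1 < s -> 0 < s. Proof. by move=> h; lra. Qed.

Lemma gp_U1_bound (s : R) : 2^-1 < s -> `|U1 s| <= m * 2 ^+ N.-1.
Proof.
move=> sh; have s0 := half0 sh; have sn0 : 0 < s ^+ N.-1 by rewrite exprn_gt0.
have -> : U1 s = - (flux N.-1 U1 s / s ^+ N.-1).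
  by rewrite /flux mulNr opprK mulrC mulKf // lt0r_neq0.
rewrite normrN normrM !ger0_norm ?invr_ge0 ?(ltW sn0) ?gp_flux_ge0 //.
apply: ler_pM; rewrite ?gp_flux_ge0 ?invr_ge0 ?(ltW sn0) ?gp_flux_le //.
rewrite -exprVn ler_pXn2r ?nnegrE ?invr_ge0 ?(ltW s0) //.
by rewrite -(invrK 2) lef_pV2 ?posrE ?invr_gt0 // ltW.
by apply: ltn_trans n1.
Qed.

Let lipb_inv b : lipb (A b) (fun x => (enorm (x - 0))^-1).
Proof.
apply: (@lipb_radial _ _ 2^-1 b 4 (fun s => s^-1)).
  move=> s /andP[sh _]; have s0 := half0 sh; rewrite ger0_norm ?invr_ge0 ?(ltW s0) //.
  by apply: (@le_trans _ _ 2); [rewrite -(invrK 2) lef_pV2 ?posrE ?invr_gt0 // ltW | lra].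
apply: (@MVT_lip _ _ (fun s => - s ^- 2)) => s /andP[sh _]; have s0 := half0 sh.
  by apply: is_derive_inv; exact: lt0r_neq0.
rewrite normrN ger0_norm ?invr_ge0 ?sqr_ge0 //.
have -> : (4 : R) = 2 ^+ 2 by rewrite -natrX.
rewrite -exprVn ler_pXn2r ?nnegrE ?invr_ge0 ?(ltW s0) //.
by rewrite -(invrK 2) lef_pV2 ?posrE ?invr_gt0 // ltW.
Qed.

Let mpow0 : 0 <= m * 2 ^+ N.-1.
Proof. by rewrite mulr_ge0 ?exprn_ge0 // ltW // (gp_m gp). Qed.

Let U_lip b (s t : R) : 2^-1 < s < b -> 2^-1 < t < b ->
  `|U s - U t| <= m * 2 ^+ N.-1 * `|s - t|.
Proof.
apply: (@MVT_lip _ U U1) => z /andP[zh _]; first exact/gp_DU/half0.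
exact: gp_U1_bound.
Qed.

Let lipb_U b : lipb (A b) ut.
Proof.
apply: (@lipb_radial _ _ 2^-1 b (m * 2 ^+ N.-1 * (`|b| + 2)) U).
  move=> s /andP[sh sb].
  have U_1 : U 1 = 0 by rewrite (gp_out gp (lexx 1)) expr1n invr1 subrr mulr0 oppr0.
  rewrite -[U s]subr0 -U_1; apply: le_trans (@U_lip (`|b| + 2) s 1 _ _) _.
  - by rewrite sh /=; have := ler_norm b; lra.
  - by apply/andP; have := normr_ge0 b; lra.
  apply: ler_wpM2l => //; apply: le_trans (ler_normB _ _) _.
  rewrite normr1 ger0_norm; last by lra.
  by have := ler_norm b; lra.
move=> s t sr tr; apply: le_trans (U_lip sr tr) _; apply: ler_wpM2r => //.
by rewrite ler_peMr //; have := normr_ge0 b; lra.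
Qed.

Let lipb_fU b : lipb (A b) (fun x => pospow p (ut x)).
Proof.
have [C C0 CP] := pospow_lip_norm (U 0) p1.
apply: (@lipb_radial _ _ 2^-1 b (pospow p (U 0) + C * (m * 2 ^+ N.-1)) (fun s => pospow p (U s))).
  move=> s /andP[/half0 s0 _]; rewrite ger0_norm ?pospow_ge0 //.
  have CD0 : 0 <= C * (m * 2 ^+ N.-1) by rewrite mulr_ge0 // ltW.
  apply: (@le_trans _ _ (pospow p (U 0))); last by rewrite lerDl.
  by apply: pospow_homo => //; exact: gp_le0.
move=> s t sr tr; have /andP[/half0 s0 _] := sr; have /andP[/half0 t0 _] := tr.
apply: le_trans (CP _ _ (gp_le0 t0) (gp_le0 s0)) _.
apply: (@le_trans _ _ (C * (m * 2 ^+ N.-1 * `|s - t|))).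
  by apply: ler_wpM2l; [exact: ltW | exact: U_lip sr tr].
by rewrite mulrA; apply: ler_wpM2r => //; rewrite lerDr pospow_ge0.
Qed.

Let lipb_U1 b : lipb (A b) (fun x => U1 (enorm (x - 0))).
Proof.
pose D := pospow p (U 0) + (N.-1)%:R * (m * 2 ^+ N.-1 * 2).
have D0 : 0 <= D by rewrite addr_ge0 ?pospow_ge0 // !mulr_ge0 // ltW // (gp_m gp).
apply: (@lipb_radial _ _ 2^-1 b (m * 2 ^+ N.-1 + D) U1).
  by move=> s /andP[sh _]; apply: le_trans (gp_U1_bound sh) _; rewrite lerDl.
apply: MVT_lip => s /andP[sh _]; have s0 := half0 sh; first exact: gp_DU1.
apply: (@le_trans _ _ D); last by rewrite lerDr.
apply: le_trans (ler_normB _ _) _; rewrite normrN; apply: lerD.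
  rewrite ger0_norm ?pospow_ge0 //; apply: pospow_homo => //; exact: gp_le0.
rewrite normrM (ger0_norm (ler0n _ _)) ler_wpM2l // normrM ler_pM ?gp_U1_bound //.
rewrite ger0_norm ?invr_ge0 ?(ltW s0) //.
by rewrite -(invrK 2) lef_pV2 ?posrE ?invr_gt0 // ltW.
Qed.

Let lipb_x b i : lipb (A b) (fun x => (x - 0) 0 i / enorm (x - 0)).
Proof.
apply: lipbM; last exact: lipb_inv.
apply: lipb_sub (lipb_coord b i) => x /andP[_]; exact.
Qed.

Let A_bound b (x y : 'rV[R]_N) : A b x -> A b y -> enorm (x - y) <= b + b.
Proof.
move=> /andP[_]; rewrite subr0 => /ltW xb /andP[_]; rewrite subr0 => /ltW yb.
by apply: le_trans (enormD _ _) _; rewrite enormN lerD.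
Qed.

Let A_sub b x : A b x -> 0 < enorm (x - 0) < b.
Proof. by move=> /andP[/half0 -> ->]. Qed.

(** Hoelder bounds come from [u] on the unit ball and from Lipschitz bounds on the shell beyond
    radius 1/2; the overlap of the two lets them be merged. *)
Lemma radial_sol_C2beta b : C2beta beta 0 b ut.
Proof.
have [_ _ h0 h1 h2] := hu; have /andP[beta0 _] := beta01.
have hol f : lipb (A b) f -> holder_on beta (A b) f.
  exact: lipb_holder beta01 (@A_bound b).
have oB := @open_eball R N 0 1.
split.
- exact: continuous_subspaceT radial_sol_continuous.
- by move=> x _; exact: radial_sol_C2.
- apply: holder_union => //; first exact: holder_on_eq radial_sol_in h0.
  exact/hol/lipb_U.
- move=> i; apply: holder_union => //.
    exact: holder_on_eq (pd_eq_on i oB radial_sol_in) (h1 i).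
  apply: hol; apply: (lipb_eq (f := fun x => U1 (enorm (x - 0)) * ((x - 0) 0 i / enorm (x - 0)))).
    by move=> x /A_sub xr; rewrite (radial_pd (lexx 0) (@DUb _) i xr).2.
  by apply: lipbM; [exact: lipb_U1 | exact: lipb_x].
- move=> i j; apply: holder_union => //.
    exact: holder_on_eq (pd_eq_on j oB (pd_eq_on i oB radial_sol_in)) (h2 i j).
  (* Inserting the equation for [U1] turns [U2 - U1 / s] into [- pospow p U - N U1 / s], a
     combination of functions already known to be Lipschitz and bounded. *)
  apply: hol; apply: (lipb_eq (f := fun x =>
    ((-1) * pospow p (ut x) + (- N%:R) * (U1 (enorm (x - 0)) * (enorm (x - 0))^-1)) *
      (((x - 0) 0 i / enorm (x - 0)) * ((x - 0) 0 j / enorm (x - 0)))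
    + (i == j)%:R * (U1 (enorm (x - 0)) * (enorm (x - 0))^-1))).
    move=> x /A_sub xr; rewrite (radial_pd2 (lexx 0) (@DUb _) (@DU1b _) i j xr).2.
    by rewrite N1E /ut /radial_sol; ring.
  apply: lipbD.
    apply: lipbM; last by apply: lipbM; exact: lipb_x.
    apply: lipbD; first by apply: lipbM; [exact: lipb_cst | exact: lipb_fU].
    apply: lipbM; first exact: lipb_cst.
    by apply: lipbM; [exact: lipb_U1 | exact: lipb_inv].
  apply: lipbM; first exact: lipb_cst.
  by apply: lipbM; [exact: lipb_U1 | exact: lipb_inv].
Qed.

End GlobalSolution.

(** * Integrals of radial functions *)

Section AffineIntegral.
Context {R : realType}.
Local Notation leb := (@lebesgue_measure R).

(** The image of Lebesgue measure under [t -> (t - c) / r], divided by [r], agrees with Lebesgue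
    measure on half-open intervals, hence equals it. *)
Lemma ge0_integral_affine (g : R -> R) (c r : R) : 0 < r ->
  measurable_fun setT g -> (forall t, 0 <= g t) ->
  (\int[leb]_t (g ((t - c) / r))%:E = r%:E * \int[leb]_t (g t)%:E)%E.
Proof.
move=> r0 mg g0; pose phi (t : R) := (t - c) / r.
have mphi : measurable_fun setT (phi : measurableTypeR R -> measurableTypeR R).
  apply: continuous_measurable_fun => t; apply: cvgM; last exact: cvg_cst.
  by apply: cvgB; [exact: cvg_id | exact: cvg_cst].
have ri0 : 0 <= r^-1 by rewrite invr_ge0 ltW.
pose ri := NngNum ri0.
pose pf := measure_function_pushforward__canonical__measure_function_Measure leb mphi.
pose mu := mscale ri pf.
have E : forall A, measurable A -> leb A = mu A.
  apply: lebesgue_measure_unique => X /ocitvP[->|[[a b] /= ab ->]].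
    by rewrite !measure0.
  rewrite /mu /mscale /= /pf /= /pushforward.
  rewrite (_ : phi @^-1` _ = `]c + r * a, c + r * b]%classic); last first.
    apply/seteqP; split=> t /=; rewrite !in_itv /= /phi ltr_pdivlMr // ler_pdivrMr //;
      rewrite (mulrC a) (mulrC b) => /andP[? ?]; apply/andP; split; lra.
  rewrite !lebesgue_measure_itv /= !lte_fin ltrD2l ltr_pM2l //.
  case: ifPn => _; last by rewrite mule0.
  rewrite -!EFinB -EFinM; congr (_%:E).
  by rewrite opprD addrACA subrr add0r -mulrBr mulKf // lt0r_neq0.
have H : (\int[leb]_t (g t)%:E = \int[mu]_t (g t)%:E)%E.
  by apply: eq_measure_integral => A mA _; exact: E.
rewrite H /mu ge0_integral_mscale //=; last first.
- by move=> t _; rewrite lee_fin.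
- exact/measurable_EFinP.
rewrite ge0_integral_pushforward //; last first.
- by move=> t _; rewrite lee_fin.
- exact/measurable_EFinP.
by rewrite preimage_setT muleA -EFinM divff ?lt0r_neq0 // mul1e.
Qed.

End AffineIntegral.

(** * Iterated integrals of monotone radial functions *)

Section RadialIntegral.
Context {R : realType}.
Local Notation leb := (@lebesgue_measure R).
Implicit Types (Phi Psi h : R -> R) (c : nat -> R) (q r s t rho k : R).

(* Profiles (as functions of the squared distance) that are nonnegative,
   nonincreasing and compactly supported: monotonicity makes all partial
   integrals measurable. *)
Definition decr rho Phi := [/\ forall q, 0 <= q -> 0 <= Phi q,
  forall q q', 0 <= q -> q <= q' -> Phi q' <= Phi q &
  forall q, 0 <= q -> rho <= q -> Phi q = 0].

Lemma decr_shift rho Phi a : decr rho Phi -> 0 <= a -> decr rho (fun q => Phi (a + q)).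
Proof.
move=> [P0 Pm Pz] a0; split.
- by move=> q q0; apply: P0; rewrite addr_ge0.
- by move=> q q' q0 qq'; apply: Pm; rewrite ?addr_ge0 ?lerD2l.
- by move=> q q0 rq; apply: Pz; rewrite ?addr_ge0 // (le_trans rq) // lerDr.
Qed.

Lemma decr_widen rho rho' Phi : rho <= rho' -> decr rho Phi -> decr rho' Phi.
Proof. by move=> rr [P0 Pm Pz]; split => // q q0 rq; apply: Pz => //; apply: le_trans rq. Qed.

Lemma decrD rho Phi Psi : decr rho Phi -> decr rho Psi -> decr rho (fun q => Phi q + Psi q).
Proof.
move=> [P0 Pm Pz] [Q0 Qm Qz]; split.
- by move=> q q0; rewrite addr_ge0 ?P0 ?Q0.
- by move=> q q' q0 qq'; rewrite lerD ?Pm ?Qm.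
- by move=> q q0 rq; rewrite Pz // Qz // addr0.
Qed.

Lemma decrZ rho Phi k : 0 <= k -> decr rho Phi -> decr rho (fun q => k * Phi q).
Proof.
move=> k0 [P0 Pm Pz]; split.
- by move=> q q0; rewrite mulr_ge0 ?P0.
- by move=> q q' q0 qq'; rewrite ler_wpM2l ?Pm.
- by move=> q q0 rq; rewrite Pz // mulr0.
Qed.

Lemma decr_measurable rho h (a : R) : decr rho h ->
  measurable_fun setT (fun t : R => h ((t - a) ^+ 2)).
Proof.
(* The profile is controlled only for nonnegative arguments; clamping at 0 makes it monotone on the
   whole line without changing it at squares. *)
move=> [P0 Pm Pz]; pose h' q := h (Num.max q 0).
have -> : (fun t : R => h ((t - a) ^+ 2)) = h' \o (fun t : R => (t - a) ^+ 2).
  by apply/funext => t; rewrite /h' /= max_l ?sqr_ge0.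
apply: measurableT_comp.
  apply: nonincreasing_measurable => // q q' qq'; apply: Pm.
    by rewrite le_max lexx orbT.
  by rewrite ge_max !le_max qq' lexx orbT.
apply: continuous_measurable_fun; apply: contX; apply: contB.
  by move=> t; exact: cvg_id.
exact: cst_continuous.
Qed.

Lemma decr_integrable rho h (a : R) : decr rho h ->
  leb.-integrable setT (EFin \o (fun t : R => h ((t - a) ^+ 2))).
Proof.
move=> dh; have [P0 Pm Pz] := dh; set g := fun t : R => _.
have mg := decr_measurable a dh : measurable_fun setT g.
(* With this choice [b^2 >= rho] whatever the size or sign of [rho], so the integrand vanishes
   outside [[a - b, a + b]]. *)
pose b := `|rho| + 1; have b0 : 0 < b by rewrite ltr_wpDl.
pose A := `[a - b, a + b]%classic.
have gE : g = g \_ A.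
  apply/funext => t; rewrite patchE; case: ifPn => // /negP tA.
  rewrite /g Pz ?sqr_ge0 //.
  have h1 : rho <= b ^+ 2.
    have -> : b ^+ 2 = `|rho| ^+ 2 + 2 * `|rho| + 1 by rewrite /b; ring.
    have h2 : rho <= `|rho| := ler_norm rho; have h3 : 0 <= `|rho| := normr_ge0 rho.
    have h4 : 0 <= `|rho| ^+ 2 := sqr_ge0 _; clear -h2 h3 h4; lra.
  apply: le_trans h1 _.
  have [lt|ge] := ltP t (a - b).
    by rewrite -(sqrrN (t - a)) ler_pXn2r ?nnegrE //; lra.
  have [gt|le] := ltP (a + b) t.
    by rewrite ler_pXn2r ?nnegrE //; lra.
  by case: tA; rewrite inE /A /= in_itv /= ge le.
have bg : [bounded g x | x in A].
  exists (h 0); split; first exact: num_real.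
  move=> M hM t _; rewrite /= ger0_norm ?P0 ?sqr_ge0 //.
  by apply: le_trans (ltW hM); apply: Pm => //; exact: sqr_ge0.
have mA : measurable A by exact: measurable_itv.
have ig : leb.-integrable A (EFin \o g).
  apply: measurable_bounded_integrable => //.
    rewrite /A /= lebesgue_measure_itv /= lte_fin; case: ifPn => // _.
    by rewrite -EFinB ltry.
  exact: measurable_funTS.
have := (integrable_mkcond (mu := leb) (EFin \o g) mA).1 ig.
rewrite (_ : (EFin \o g) \_ A = EFin \o g) //.
by apply/funext => t; rewrite [in RHS]gE /= !patchE; case: ifP.
Qed.

(** The centre is an infinite sequence, so that peeling off a coordinate is just composition with
    [succn]. *)
Fixpoint sqd c (s : seq R) : R :=
  if s is t :: l then (t - c 0%N) ^+ 2 + sqd (c \o succn) l else 0.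

Lemma sqdE c (s : seq R) : sqd c s = \sum_(i < size s) (nth 0 s i - c i) ^+ 2.
Proof.
elim: s c => [|t s IH] c /=; first by rewrite big_ord0.
by rewrite big_ord_recl IH.
Qed.

Definition radint n c Phi : R := iint n (fun l => Phi (sqd c l)).

Lemma radintS n c Phi : radint n.+1 c Phi =
  Rintegral leb setT (fun t => radint n (c \o succn) (fun q => Phi ((t - c 0%N) ^+ 2 + q))).
Proof. by []. Qed.

(** The four facts share one induction: integrability of the outer integrand needs the inner
    integral to be nonnegative, nonincreasing and compactly supported, while additivity and
    homogeneity need that integrability. *)
Lemma radint_facts n c : 
  [/\ forall rho Phi, decr rho Phi -> 0 <= radint n c Phi,
    forall rho Phi Psi, decr rho Phi -> decr rho Psi ->
      (forall q, 0 <= q -> Phi q <= Psi q) -> radint n c Phi <= radint n c Psi,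
    forall rho Phi Psi, decr rho Phi -> decr rho Psi ->
      radint n c (fun q => Phi q + Psi q) = radint n c Phi + radint n c Psi &
    forall rho Phi k, 0 <= k -> decr rho Phi ->
      radint n c (fun q => k * Phi q) = k * radint n c Phi].
Proof.
elim: n c => [|n IH] c.
  rewrite /radint /=; split => //.
  - by move=> rho Phi [P0 _ _]; exact: P0.
  - by move=> rho Phi Psi _ _; apply.
have [I0 Ile ID IZ] := IH (c \o succn).
have H rho Phi : decr rho Phi -> decr rho (fun a => radint n (c \o succn) (fun q => Phi (a + q))).
  move=> dP; have [P0 Pm Pz] := dP; split.
  - by move=> q q0; apply: I0 (decr_shift dP q0).
  - move=> q q' q0 qq'; apply: Ile; [apply: decr_shift dP _|exact: decr_shift dP q0|].
      exact: le_trans qq'.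
    by move=> t t0; apply: Pm; rewrite ?addr_ge0 ?lerD2r.
  - move=> q q0 rq; apply/eqP; rewrite eq_le (I0 _ _ (decr_shift dP q0)) andbT.
    (* The number 0 is rewritten as the integral of [0 * Phi], so that the comparison principle
       yields the vanishing. *)
    have := IZ _ _ 0 (lexx 0) dP; rewrite mul0r => <-.
    apply: Ile (decr_shift dP q0) (decrZ (lexx 0) dP) _ => t t0.
    by rewrite mul0r Pz ?addr_ge0 // (le_trans rq) // lerDl.
have intg rho Phi : decr rho Phi -> leb.-integrable setT (EFin \o
    (fun t => radint n (c \o succn) (fun q => Phi ((t - c 0%N) ^+ 2 + q)))).
  by move=> /H; exact: decr_integrable.
split.
- move=> rho Phi dP; rewrite radintS; apply: Rintegral_ge0 => t _.
  by apply: I0 (decr_shift dP (sqr_ge0 _)).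
- move=> rho Phi Psi dP dQ PQ; rewrite !radintS; apply: le_Rintegral => //.
  + exact: intg dP.
  + exact: intg dQ.
  + move=> t _; apply: Ile (decr_shift dP (sqr_ge0 _)) (decr_shift dQ (sqr_ge0 _)) _ => q q0.
    by apply: PQ; rewrite addr_ge0 ?sqr_ge0.
- move=> rho Phi Psi dP dQ; rewrite !radintS -RintegralD //; last 2 first.
  + exact: intg dP.
  + exact: intg dQ.
  apply: eq_Rintegral => t _.
  exact: ID (decr_shift dP (sqr_ge0 _)) (decr_shift dQ (sqr_ge0 _)).
- move=> rho Phi k k0 dP; rewrite !radintS -RintegralZl //; last exact: intg dP.
  apply: eq_Rintegral => t _; exact: IZ k0 (decr_shift dP (sqr_ge0 _)).
Qed.

Lemma radint_decr n c rho Phi : decr rho Phi ->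
  decr rho (fun a => radint n c (fun q => Phi (a + q))).
Proof.
have [I0 Ile _ IZ] := radint_facts n c => dP; have [P0 Pm Pz] := dP; split.
- by move=> q q0; apply: I0 (decr_shift dP q0).
- move=> q q' q0 qq'; apply: Ile; [apply: decr_shift dP _|exact: decr_shift dP q0|].
    exact: le_trans qq'.
  by move=> t t0; apply: Pm; rewrite ?addr_ge0 ?lerD2r.
- move=> q q0 rq; apply/eqP; rewrite eq_le (I0 _ _ (decr_shift dP q0)) andbT.
  have := IZ _ _ 0 (lexx 0) dP; rewrite mul0r => <-.
  apply: Ile (decr_shift dP q0) (decrZ (lexx 0) dP) _ => t t0.
  by rewrite mul0r Pz ?addr_ge0 // (le_trans rq) // lerDl.
Qed.

(** The centre is arbitrary on the left and 0 on the right, so translation invariance is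
    included. *)
Lemma radint_scale n c rho Phi r : 0 < r -> decr rho Phi ->
  radint n c (fun q => Phi (q / r ^+ 2)) = r ^+ n * radint n (fun=> 0) Phi.
Proof.
move=> r0; elim: n c Phi => [|n IH] c Phi dP.
  by rewrite /radint /= mul0r expr0 mul1r.
rewrite !radintS.
have r2 : r ^+ 2 != 0 by rewrite expf_neq0 // lt0r_neq0.
pose h a := radint n (fun=> 0) (fun q => Phi (a + q)).
have dh : decr rho h := radint_decr n (fun=> 0) dP.
have -> : (fun t => radint n (c \o succn) (fun q => Phi (((t - c 0%N) ^+ 2 + q) / r ^+ 2)))
    = (fun t => r ^+ n * h (((t - c 0%N) / r - 0) ^+ 2)).
  apply/funext => t.
  rewrite /h -(IH (c \o succn) _ (decr_shift dP (sqr_ge0 _))) subr0 expr_div_n.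
  by congr radint; apply/funext => q; rewrite mulrDl.
have ih := decr_integrable 0 dh.
have E : Rintegral leb setT (fun t => h (((t - c 0%N) / r - 0) ^+ 2)) =
    r * Rintegral leb setT (fun t => h ((t - 0) ^+ 2)).
  rewrite /Rintegral (@ge0_integral_affine _ (fun t => h ((t - 0) ^+ 2))) //.
  - by rewrite fineM // integrable_fin_num.
  - exact: decr_measurable dh.
  - by move=> t; have [h0 _ _] := dh; rewrite h0 ?sqr_ge0.
rewrite RintegralZl //; last first.
  have dd : decr (rho * r ^+ 2) (fun q => h (q / r ^+ 2)).
    have [h0 hm hz] := dh; have ri : 0 <= (r ^+ 2)^-1 by rewrite invr_ge0 sqr_ge0.
    split.
    - by move=> q q0; apply: h0; rewrite mulr_ge0.
    - by move=> q q' q0 qq'; apply: hm; rewrite ?mulr_ge0 // ler_wpM2r.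
    - by move=> q q0 qr; apply: hz; rewrite ?mulr_ge0 // ler_pdivlMr // exprn_gt0.
  have := decr_integrable (c 0%N) dd; congr (leb.-integrable _ (EFin \o _)).
  by apply/funext => t; rewrite subr0 expr_div_n.
by rewrite E exprS mulrCA mulrA.
Qed.

End RadialIntegral.

(** * Mass of a ball as a flux *)

Section BallIntegral.
Context {R : realType}.
Implicit Types (c : nat -> R) (H h M : R -> R) (q r s t : R).

Definition ballprof H r q : R := if q < r ^+ 2 then H q else 0.

Lemma ballprof_decr H r : (forall q, 0 <= q -> q < r ^+ 2 -> 0 <= H q) ->
  (forall q q', 0 <= q -> q <= q' -> q' < r ^+ 2 -> H q' <= H q) ->
  decr (r ^+ 2) (ballprof H r).
Proof.
move=> H0 Hm; split; rewrite /ballprof.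
- by move=> q q0; case: ifP => // qr; exact: H0.
- move=> q q' q0 qq'; case: ifPn => [q'r|_]; last by case: ifP => // qr; exact: H0.
  by rewrite (le_lt_trans qq' q'r) Hm.
- by move=> q q0 rq; rewrite ltNge rq.
Qed.

Lemma iint_ext n (F G : seq R -> R) : (forall l, size l = n -> F l = G l) ->
  iint n F = iint n G.
Proof.
elim: n F G => [|n IH] F G FG /=; first exact: FG.
by apply: eq_Rintegral => t _; apply: IH => l ln; apply: FG; rewrite /= ln.
Qed.

(** The sequence [c] is chosen before [f] and [H], so that integrals of different functions over the
    same ball can be compared. *)
Lemma integral_on_radial N (x0 : 'rV[R]_N) r : 0 < r -> exists c, forall f H,
  (forall x, eball x0 r x -> f x = H (dot (x - x0) (x - x0))) ->
  integral_on (eball x0 r) f = radint N c (ballprof H r).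
Proof.
move=> r0; pose c k := if insub k is Some i then x0 0 (i : 'I_N) else 0.
exists c => f H fH; apply: iint_ext => l lN; set x := \row_i _.
have -> : sqd c l = dot (x - x0) (x - x0).
  rewrite sqdE lN; apply: eq_bigr => i _.
  by rewrite !mxE /c valK expr2.
have xE : `[< eball x0 r x >] = (dot (x - x0) (x - x0) < r ^+ 2).
  by rewrite -enorm_lt ?ltW //; apply/asboolP/idP.
rewrite /ballprof -xE; case: asboolP => // xr; exact: fH.
Qed.

Definition unit_vol n : R := radint n (fun=> 0) (ballprof (fun=> 1) 1).

Lemma ballprof1_decr r : decr (r ^+ 2) (ballprof (fun=> 1) r).
Proof. exact: ballprof_decr. Qed.

Lemma radint_ball n c r : 0 < r ->
  radint n c (ballprof (fun=> 1) r) = r ^+ n * unit_vol n.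
Proof.
move=> r0; rewrite /unit_vol -(radint_scale n c r0 (ballprof1_decr 1)).
congr radint; apply/funext => q; rewrite /ballprof expr1n.
by rewrite ltr_pdivrMr ?exprn_gt0 // mul1r.
Qed.

Lemma unit_vol_ge0 n : 0 <= unit_vol n.
Proof. by have [I0 _ _ _] := radint_facts n (fun=> 0 : R); exact: I0 (ballprof1_decr 1). Qed.

Lemma volume_ball N (x0 : 'rV[R]_N) r : 0 < r -> volume (eball x0 r) = r ^+ N * unit_vol N.
Proof.
move=> r0; have [c E] := integral_on_radial x0 r0.
by rewrite /volume (E _ (fun=> 1)) ?radint_ball.
Qed.

(* A bound by (osc g) * (length) on every subinterval improves by a factor 2 under
   bisection, because the oscillations of the monotone [g] telescope. *)
Lemma bisection_const (P g : R -> R) (L a b : R) : 0 <= L -> a <= b ->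
  (forall s t, a <= s -> s <= t -> t <= b -> g t <= g s) ->
  (forall s t, a <= s -> s <= t -> t <= b -> `|P t - P s| <= (g s - g t) * (L * (t - s))) ->
  P a = P b.
Proof.
move=> L0 ab gm H.
have K (k : nat) s t : a <= s -> s <= t -> t <= b ->
    `|P t - P s| <= (g s - g t) * (L * (t - s)) / 2 ^+ k.
  elim: k s t => [|k IH] s t as_ st tb; first by rewrite expr0 divr1; exact: H.
  pose z := (s + t) / 2.
  have sz : s <= z by rewrite /z; lra.
  have zt : z <= t by rewrite /z; lra.
  have A1 := IH s z as_ sz (le_trans zt tb).
  have A2 := IH z t (le_trans as_ sz) zt tb.
  rewrite -(subrK (P z) (P t)) -addrA; apply: le_trans (ler_normD _ _) _.
  apply: le_trans (lerD A2 A1) _.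
  have k0 : (2 : R) ^+ k != 0 by rewrite expf_neq0.
  rewrite le_eqVlt; apply/orP; left; apply/eqP; rewrite exprS /z; field.
  by rewrite k0.
apply/eqP; rewrite eq_sym -subr_eq0 -normr_le0; apply/ler_addgt0Pr => e e0; rewrite add0r.
set X := (g a - g b) * (L * (b - a)).
have X0 : 0 <= X by rewrite !mulr_ge0 ?subr_ge0 // gm.
have h : 0 <= X / e by rewrite divr_ge0 // ltW.
have := archi_boundP h; set k := Num.bound _ => hk.
apply: le_trans (K k a b (lexx a) ab (lexx b)) _; rewrite -/X.
rewrite ler_pdivrMr ?exprn_gt0 // mulrC -ler_pdivrMr //.
by apply: le_trans (ltW hk) _; rewrite -natrX ler_nat ltnW // ltn_expl.
Qed.

(** This is integration in polar coordinates for nonincreasing [h]. On a shell both the integral and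
    its candidate [n * k * M] lie between the extreme values of [h] times the shell volume, so their
    difference [P] has increments small enough for bisection to make it constant; [P] tends to 0 at
    0. *)
Lemma radial_flux n c r h M : (0 < n)%N -> 0 < r ->
  (forall s, 0 <= s -> 0 <= h s) ->
  (forall s t, 0 <= s -> s <= t -> h t <= h s) ->
  (forall s, 0 < s -> is_derive s 1 M (s ^+ n.-1 * h s)) ->
  (forall e, 0 < e -> exists2 d, 0 < d & forall s, 0 < s < d -> `|M s| < e) ->
  radint n c (ballprof (h \o Num.sqrt) r) = n%:R * unit_vol n * M r.
Proof.
move=> n0 r0 h0 hm DM M0; set k := unit_vol n.
have k0 : 0 <= k := unit_vol_ge0 n.
have [I0 Ile ID IZ] := radint_facts n c.
pose e s := radint n c (ballprof (h \o Num.sqrt) s).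
pose v s := radint n c (ballprof (fun=> 1) s).
have dH s : decr (s ^+ 2) (ballprof (h \o Num.sqrt) s).
  apply: ballprof_decr => [q q0 _|q q' q0 qq' _] /=; first by rewrite h0 ?sqrtr_ge0.
  by apply: hm; rewrite ?sqrtr_ge0 // ler_wsqrtr.
have vE s : 0 < s -> v s = s ^+ n * k by exact: radint_ball.
have sq s t : 0 < s -> s <= t -> s ^+ 2 <= t ^+ 2.
  by move=> s0 st; rewrite ler_pXn2r ?nnegrE ?(ltW s0) // (le_trans (ltW s0)).
have sqrtle s q : 0 < s -> 0 <= q -> s ^+ 2 <= q -> s <= Num.sqrt q.
  by move=> s0 q0 sq'; rewrite -[leLHS](ger0_norm (ltW s0)) -sqrtr_sqr ler_wsqrtr.
have lesqrt s q : 0 < s -> 0 <= q -> q < s ^+ 2 -> Num.sqrt q <= s.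
  by move=> s0 q0 sq'; rewrite -[leRHS](ger0_norm (ltW s0)) -sqrtr_sqr ler_wsqrtr // ltW.
(* Differences of [decr] profiles need not be [decr], so the shell estimate is stated as an
   inequality between sums of integrals over whole balls. *)
have up s t : 0 < s -> s <= t -> e t - e s <= h s * (v t - v s).
  move=> s0 st; have hs : 0 <= h s by rewrite h0 // ltW.
  have d1 := decr_widen (sq _ _ s0 st) (decrZ hs (ballprof1_decr s)).
  have d2 := decrZ hs (ballprof1_decr t).
  have d3 := decr_widen (sq _ _ s0 st) (dH s).
  have : radint n c (fun q => ballprof (h \o Num.sqrt) t q + h s * ballprof (fun=> 1) s q) <=
         radint n c (fun q => ballprof (h \o Num.sqrt) s q + h s * ballprof (fun=> 1) t q).
    apply: Ile; [exact: decrD (dH t) d1 | exact: decrD d3 d2 |] => q q0.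
    rewrite /ballprof /=; have [qs|qs] := ltP q (s ^+ 2).
      by rewrite (lt_le_trans qs (sq _ _ s0 st)).
    by case: ifP => _; rewrite ?mulr0 ?mulr1 ?addr0 ?add0r //; apply: hm; [exact: ltW | exact: sqrtle].
  rewrite (ID _ _ _ (dH t) d1) (ID _ _ _ d3 d2) (IZ _ _ _ hs (ballprof1_decr s)).
  rewrite (IZ _ _ _ hs (ballprof1_decr t)) -/(e _) -/(e _) -/(v _) -/(v _); lra.
have lo s t : 0 < s -> s <= t -> h t * (v t - v s) <= e t - e s.
  move=> s0 st; have t0 := lt_le_trans s0 st; have ht : 0 <= h t by rewrite h0 // ltW.
  have d1 := decr_widen (sq _ _ s0 st) (decrZ ht (ballprof1_decr s)).
  have d2 := decrZ ht (ballprof1_decr t).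
  have d3 := decr_widen (sq _ _ s0 st) (dH s).
  have : radint n c (fun q => ballprof (h \o Num.sqrt) s q + h t * ballprof (fun=> 1) t q) <=
         radint n c (fun q => ballprof (h \o Num.sqrt) t q + h t * ballprof (fun=> 1) s q).
    apply: Ile; [exact: decrD d3 d2 | exact: decrD (dH t) d1 |] => q q0.
    rewrite /ballprof /=; have [qs|qs] := ltP q (s ^+ 2).
      by rewrite (lt_le_trans qs (sq _ _ s0 st)).
    case: ifPn => qt; rewrite ?mulr0 ?mulr1 ?addr0 ?add0r //.
    by apply: hm; [exact: sqrtr_ge0 | exact: lesqrt].
  rewrite (ID _ _ _ (dH t) d1) (ID _ _ _ d3 d2) (IZ _ _ _ ht (ballprof1_decr s)).
  rewrite (IZ _ _ _ ht (ballprof1_decr t)) -/(e _) -/(e _) -/(v _) -/(v _); lra.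
have nR : (0 : R) < n%:R by rewrite ltr0n.
have Dpow s : is_derive s 1 (fun t => t ^+ n) (n%:R * s ^+ n.-1).
  by apply: is_derive_eq (is_derive_pow n (is_derive_id s 1)) _; rewrite mulr1.
(* The mean value theorem of Cauchy for [M] against [z^n], applied to [M - B z^n] with [B] the
   quotient of increments. *)
have powM s t : 0 < s -> s <= t -> exists2 z, s <= z <= t &
    n%:R * (M t - M s) = h z * (t ^+ n - s ^+ n).
  move=> s0; rewrite le_eqVlt => /predU1P[<-|st].
    by exists s; rewrite ?lexx // !subrr !mulr0.
  have tn : t ^+ n - s ^+ n > 0.
    by rewrite subr_gt0 ltr_pXn2r ?nnegrE ?(ltW s0) // ltW // (lt_trans s0).
  pose B := (M t - M s) / (t ^+ n - s ^+ n).
  have [|z /andP[sz zt] E] := @MVT_is_derive _ (fun z => M z - B * z ^+ n)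
     (fun z => z ^+ n.-1 * h z - B * (n%:R * z ^+ n.-1)) s t st.
    move=> z /andP[sz _]; apply: is_derive_minus; first by apply: DM; apply: lt_le_trans sz.
  have z0 : 0 < z by apply: lt_trans sz.
  have E0 : M t - B * t ^+ n - (M s - B * s ^+ n) = 0.
    by rewrite /B; field; exact: lt0r_neq0.
  exists z; first by rewrite !ltW.
  move/eqP: E; rewrite E0 eq_sym mulf_eq0 (gt_eqF (_ : 0 < t - s)) ?subr_gt0 // orbF.
  rewrite (_ : _ - _ = z ^+ n.-1 * (h z - B * n%:R)); last by ring.
  rewrite mulf_eq0 expf_eq0 (gt_eqF z0) andbF /= subr_eq0 => /eqP ->.
  by rewrite /B; field; exact: lt0r_neq0.
pose P s := e s - n%:R * k * M s.
have Pinc s t : 0 < s -> s <= t -> `|P t - P s| <= (h s - h t) * (k * (t ^+ n - s ^+ n)).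
  move=> s0 st; have t0 := lt_le_trans s0 st; have [z /andP[sz zt] ME] := powM s t s0 st.
  have tn : 0 <= k * (t ^+ n - s ^+ n).
    rewrite mulr_ge0 // subr_ge0 ler_pXn2r ?nnegrE ?(ltW s0) //; exact: ltW.
  have := up s t s0 st; have := lo s t s0 st.
  rewrite !vE // -mulrBl (mulrC (_ - _) k).
  have hz1 := ler_wpM2r tn (hm s z (ltW s0) sz).
  have hz2 := ler_wpM2r tn (hm z t (le_trans (ltW s0) sz) zt).
  have -> : P t - P s = (e t - e s) - h z * (k * (t ^+ n - s ^+ n)).
    by rewrite mulrCA -ME /P; ring.
  by rewrite ler_norml => H1 H2; apply/andP; split; lra.
have Pconst s t : 0 < s -> s <= t -> P s = P t.
  move=> s0 st; have t0 := lt_le_trans s0 st.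
  apply: (@bisection_const P h (k * (n%:R * t ^+ n.-1)) s t) => //.
  - by rewrite !mulr_ge0 // exprn_ge0 // ltW.
  - by move=> x y sx xy yt; apply: hm => //; apply: le_trans sx; exact: ltW.
  - move=> x y sx xy yt; have x0 := lt_le_trans s0 sx; apply: le_trans (Pinc x y x0 xy) _.
    apply: ler_wpM2l; first by rewrite subr_ge0 hm // ltW.
    rewrite -mulrA; apply: ler_wpM2l => //.
    move: xy; rewrite le_eqVlt => /predU1P[->|xy]; first by rewrite !subrr mulr0.
    have [z /andP[xz zy] ->] := MVT_is_derive xy (fun t _ => Dpow t).
    apply: ler_wpM2r; first by rewrite subr_ge0 ltW.
    apply: ler_wpM2l => //; have z0 := lt_trans x0 xz.
    case: (n.-1) => [|j]; first by rewrite !expr0.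
    by rewrite ler_pXn2r ?nnegrE ?(ltW z0) ?(ltW t0) // (le_trans (ltW zy)).
have ebd s : 0 < s -> s <= 1 -> `|e s| <= h 0 * k * s.
  move=> s0 s1; rewrite ger0_norm; last exact: I0 (dH s).
  have h00 : 0 <= h 0 by exact: h0.
  apply: (@le_trans _ _ (h 0 * v s)).
    rewrite -(IZ _ _ _ h00 (ballprof1_decr s)); apply: Ile (dH s) (decrZ h00 (ballprof1_decr s)) _ => q q0.
    by rewrite /ballprof /=; case: ifP => _; rewrite ?mulr0 ?mulr1 //; apply: hm; rewrite ?sqrtr_ge0.
  rewrite vE // (mulrC (s ^+ n)) -[leRHS]mulrA.
  apply: ler_wpM2l => //; apply: ler_wpM2l => //.
  by rewrite -(prednK n0) exprS ler_piMr ?(ltW s0) // exprn_ile1 // ltW.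
suff : P r = 0 by move/eqP; rewrite subr_eq0 => /eqP.
apply/eqP; rewrite -normr_le0; apply/ler_addgt0Pr => d d0; rewrite add0r.
pose D := n%:R * k + 1; have D0 : 0 < D by rewrite ltr_wpDl ?mulr_ge0.
have d2 : 0 < d / 2 / D by rewrite !divr_gt0.
have [d1 d10 d1P] := M0 _ d2.
pose B := h 0 * k + 1; have B0 : 0 < B by rewrite ltr_wpDl ?mulr_ge0 ?h0.
pose m := Num.min (Num.min d1 r) (Num.min 1 (d / B)).
have m0 : 0 < m by rewrite !lt_min d10 r0 ltr01 divr_gt0.
pose s := m / 2; have s0 : 0 < s by rewrite divr_gt0.
have : s < m by rewrite /s; lra.
rewrite !lt_min => /andP[/andP[sd1 sr] /andP[s1 _]].
have sB : s * 2 <= d / B by rewrite /s divfK // !ge_min lexx !orbT.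
rewrite -(Pconst s r s0 (ltW sr)) /P; apply: le_trans (ler_normB _ _) _.
have H1 := ebd s s0 (ltW s1).
have H2 : `|n%:R * k * M s| <= d / 2.
  rewrite normrM ger0_norm ?mulr_ge0 //.
  have := d1P s; rewrite s0 sd1 => /(_ isT); rewrite ltr_pdivlMr // => H2.
  apply: le_trans (ltW H2); rewrite mulrC; apply: ler_wpM2l => //.
  by rewrite /D lerDl.
have H3 : h 0 * k * s <= d / 2.
  move: sB; rewrite ler_pdivlMr // => sB; have : h 0 * k * s <= B * s.
    by apply: ler_wpM2r; [exact: ltW | rewrite /B lerDl].
  lra.
lra.
Qed.

End BallIntegral.

(** * Classification of the solutions *)

Section Classification.
Context {R : realType} {N : nat}.
Variables (p beta : R) (u : 'rV[R]_N -> R) (U U1 : R -> R) (m : R) (i0 : 'I_N).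
Hypothesis p1 : 1 < p.
Hypothesis beta01 : 0 < beta < 1.
Hypothesis N3 : (3 <= N)%N.
Hypothesis hu : C2beta beta 0 1 u.
Hypothesis su : solpde p 0 1 0 u.
Hypothesis gp : global_profile p N.-1 U U1 m.
Hypothesis uU : forall s : R, 0 <= s < 1 -> U s = u (0 + s *: evec R i0).
Variables (c : 'rV[R]_N) (r : R).
Hypothesis r0 : 0 < r.
Hypothesis kappa0 : 0 < unit_vol N :> R.
Let p0 : 0 < p. Proof. exact: lt_trans p1. Qed.
Let n1 : (1 < N.-1)%N. Proof. by rewrite -ltnS prednK // (ltn_trans _ N3). Qed.

Local Notation kappa := (unit_vol N : R).

(** The power of the dilation factor by which the mass scales; for [N >= 3] and [p > 1] it is
    positive exactly when [p < N / (N - 2)]. *)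
Definition theta : R := 2 / (p - 1) - N%:R + 2.

Hypothesis theta0 : 0 < theta.

Lemma solpde_homo gamma v : solpde p c r gamma v ->
  let V s := v (c + s *: evec R i0) in
  forall s t, 0 <= s -> s <= t -> t < r -> V t <= V s.
Proof.
move=> sv V s t s0 st tr; have P := solpde_profile p1 i0 r0 sv.
move: s0; rewrite le_eqVlt => /predU1P[s0|s0]; last exact: (profile_homo P).
subst s; move: st; rewrite le_eqVlt => /predU1P[->//|t0].
by apply: (profile_le0 P); rewrite t0.
Qed.

Lemma solpde_radialE gamma v x : solpde p c r gamma v -> eball c r x ->
  v x = v (c + enorm (x - c) *: evec R i0).
Proof.
move=> sv xr; apply: (solpde_radial p1 i0 r0 sv); first exact: ltW.
by rewrite addrAC subrr add0r enorm_evec // enorm_ge0.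
Qed.

(** Pulling out a factor requires integrability of the partial integrals; it comes from the solution
    being radial and nonincreasing. *)
Lemma solpde_integralZ gamma v k : 0 <= k -> solpde p c r gamma v ->
  integral_on (eball c r) (fun x => k * pospow p (v x)) =
  k * integral_on (eball c r) (fun x => pospow p (v x)).
Proof.
move=> k0 sv; have [d E] := integral_on_radial c r0.
pose H q := pospow p (v (c + Num.sqrt q *: evec R i0)).
have vH x : eball c r x -> pospow p (v x) = H (dot (x - c) (x - c)).
  by move=> xr; rewrite /H -enormE -(solpde_radialE sv xr).
have dH : decr (r ^+ 2) (ballprof H r).
  apply: ballprof_decr => [q _ _|q q' q0 qq' qr]; first exact: pospow_ge0.
  apply: pospow_homo => //; apply: (solpde_homo sv); rewrite ?sqrtr_ge0 ?ler_wsqrtr //.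
  by rewrite -[ltRHS](ger0_norm (ltW r0)) -sqrtr_sqr ltr_sqrt // exprn_gt0.
rewrite (E _ (fun q => k * H q)) => [|x /vH -> //]; rewrite (E _ H) //.
have [_ _ _ IZ] := radint_facts N d; rewrite -(IZ _ _ _ k0 dH); congr radint.
by apply/funext => q; rewrite /ballprof; case: ifP; rewrite ?mulr0.
Qed.

Lemma scaled_profile k tau b : 0 < k -> 0 < tau -> k * tau ^+ 2 = k `^ p ->
  profile p N.-1 b (fun s => k * U (tau * s)) (fun s => k * tau * U1 (tau * s)).
Proof. by move=> k0 t0 kt; apply: profile_scale => //; exact: (gp_profile gp). Qed.

(** The flux is the primitive of [s^(N-1)] times the nonlinearity that vanishes at 0, as
    [radial_flux] requires. *)
Lemma scaled_integral (x0 : 'rV[R]_N) b k tau : 0 < b -> 0 < k -> 0 < tau ->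
  k * tau ^+ 2 = k `^ p ->
  integral_on (eball x0 b) (fun x => pospow p (k * U (tau * enorm (x - x0)))) =
  N%:R * kappa * flux N.-1 (fun s => k * tau * U1 (tau * s)) b.
Proof.
move=> b0 k0 t0 kt; have [d E] := integral_on_radial x0 b0.
have P b' := scaled_profile b' k0 t0 kt.
pose h s := pospow p (k * U (tau * s)).
rewrite (E _ (h \o Num.sqrt)); last by move=> x _; rewrite /h /= -enormE.
apply: (@radial_flux _ _ _ _ h) => //; first by rewrite (ltn_trans _ N3).
- by move=> s _; exact: pospow_ge0.
- move=> s t s0 st; apply: pospow_homo => //.
  move: s0; rewrite le_eqVlt => /predU1P[s0|s0].
    subst s; move: st; rewrite le_eqVlt => /predU1P[->//|t1].
    by apply: (profile_le0 (P (t + 1))); rewrite t1 ltrDl ltr01.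
  by apply: (profile_homo (P (t + 1))) => //; rewrite ltrDl ltr01.
- by move=> s s0; apply: (flux_derive (P (s + 1))); rewrite s0 ltrDl ltr01.
- have [_ _ _ V10] := P 1; move=> e e0; have [d' d'0 dP] := V10 e e0.
  exists (Num.min d' 1); first by rewrite lt_min d'0 ltr01.
  move=> s; rewrite lt_min => /and3P[s0 sd s1].
  rewrite /flux normrN normrM; apply: le_lt_trans (dP s _); last by rewrite s0.
  by rewrite ler_piMl // ger0_norm ?exprn_ge0 ?exprn_ile1 ?ltW.
Qed.

(* The solution whose positivity set, extended by the global profile, is the ball
   of radius [r / rho]. *)
Definition amp rho : R := (rho / r) `^ (2 / (p - 1)).
Definition sol rho (x : 'rV[R]_N) : R := amp rho * U (rho / r * enorm (x - c)).
Definition bdval rho : R := amp rho * U rho.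
Definition mass rho : R := N%:R * kappa * ((rho / r) `^ theta * flux N.-1 U1 rho).

Let pm1 : p - 1 != 0. Proof. by rewrite subr_eq0 gt_eqF. Qed.

Lemma amp_gt0 rho : 0 < rho -> 0 < amp rho.
Proof. by move=> rho0; rewrite powR_gt0 // divr_gt0. Qed.

Lemma ampE rho : 0 < rho -> amp rho * (rho / r) ^+ 2 = amp rho `^ p.
Proof.
move=> rho0; have t0 : 0 < rho / r by rewrite divr_gt0.
rewrite /amp -powR_mulrn ?ltW // -powRD ?(gt_eqF t0) ?implybT // -powRrM.
by congr powR; field.
Qed.

Lemma massE rho : 0 < rho ->
  N%:R * kappa * flux N.-1 (fun s => amp rho * (rho / r) * U1 (rho / r * s)) r = mass rho.
Proof.
move=> rho0; have t0 : 0 < rho / r by rewrite divr_gt0.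
rewrite /mass; congr (_ * _).
have tn : (rho / r) `^ theta * (rho / r) ^+ N.-1 = amp rho * (rho / r).
  rewrite /amp -powR_mulrn ?ltW // -powRD ?(gt_eqF t0) ?implybT //.
  rewrite -[X in _ = _ * X](powRr1 (ltW t0)) -powRD ?(gt_eqF t0) ?implybT //.
  by congr powR; rewrite /theta (N1E i0); ring.
rewrite /flux -tn divfK ?lt0r_neq0 // expr_div_n; field.
by rewrite expf_neq0 // lt0r_neq0.
Qed.

Lemma sol_integral rho : 0 < rho ->
  integral_on (eball c r) (fun x => pospow p (sol rho x)) = mass rho.
Proof.
by move=> rho0; rewrite scaled_integral ?massE ?amp_gt0 ?divr_gt0 ?ampE.
Qed.

Lemma sol_affine rho x : 0 < rho ->
  sol rho x = 0 + amp rho * radial_sol U ((rho / r) *: (x - c) + 0).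
Proof.
move=> rho0; rewrite add0r /sol /radial_sol addr0 subr0 enormZ gtr0_norm //.
by rewrite divr_gt0.
Qed.

Lemma sol_solpde rho : 0 < rho ->
  C2beta beta c r (sol rho) /\ solpde p c r (bdval rho) (sol rho).
Proof.
move=> rho0; have t0 : 0 < rho / r by rewrite divr_gt0.
have E : sol rho = fun x => 0 + amp rho * radial_sol U ((rho / r) *: (x - c) + 0).
  by apply/funext => x; exact: sol_affine.
have C2 : C2beta beta 0 (rho / r * r) (radial_sol U : 'rV[R]_N -> R).
  exact: (radial_sol_C2beta p1 beta01 n1 hu su gp uU).
have [wc C2' _ _ _] := affine_C2beta c t0 0 (amp rho) C2.
split; first by rewrite E; exact: affine_C2beta.
split.
- by rewrite E.
- by rewrite E.
- move=> x xr; have [_ D _ _ _] := C2.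
  rewrite {1}E (affine_lap t0 0 (amp rho) D xr).
  rewrite -mulrN (radial_sol_lap p1 su gp uU) (sol_affine x rho0) add0r.
  by rewrite pospowZ ?amp_gt0 // -ampE //; ring.
- move=> x xr; rewrite /sol /bdval; move: xr; rewrite /esphere /= => ->.
  by rewrite divfK // lt0r_neq0.
Qed.

Lemma eq_on_closed (v w : 'rV[R]_N -> R) : {within ecball c r, continuous v} ->
  {within ecball c r, continuous w} -> (forall x, eball c r x -> v x = w x) ->
  forall x, ecball c r x -> v x = w x.
Proof.
move=> /within_epsP vc /within_epsP wc vw x xr.
apply/eqP; rewrite -subr_eq0 -normr_le0; apply/ler_addgt0Pr => e e0; rewrite add0r.
have e2 : 0 < e / 2 by rewrite divr_gt0.
have [d d0 dP] := vc x _ xr e2; have [d' d'0 d'P] := wc x _ xr e2.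
pose t := Num.min (Num.min (d / (r + 1)) (d' / (r + 1))) 1 / 2.
have r1 : 0 < r + 1 by rewrite ltr_wpDl // ltW.
have m0 : 0 < Num.min (Num.min (d / (r + 1)) (d' / (r + 1))) 1.
  by rewrite !lt_min ltr01 andbT; apply/andP; split; exact: divr_gt0.
have t0 : 0 < t by rewrite divr_gt0.
have : t < Num.min (Num.min (d / (r + 1)) (d' / (r + 1))) 1 by rewrite /t; lra.
rewrite !lt_min !ltr_pdivlMr // => /andP[/andP[td td'] t1].
(* Pulling [x] towards the centre moves it into the open ball even when it lies on the sphere. *)
pose y := x - t *: (x - c).
have xr' : enorm (x - c) <= r by [].
have yx : enorm (y - x) <= t * r.
  by rewrite /y addrAC subrr add0r enormN enormZ gtr0_norm // ler_pM2l.
have yr : enorm (y - c) < r.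
  rewrite (_ : y - c = (1 - t) *: (x - c)); last by apply/rowP => i; rewrite !mxE; ring.
  rewrite enormZ gtr0_norm ?subr_gt0 //; apply: (@le_lt_trans _ _ ((1 - t) * r)).
    by rewrite ler_pM2l // subr_gt0.
  by rewrite gtr_pMl //; lra.
clearbody y.
have A := dP y (ltW yr); have B := d'P y (ltW yr).
have {}A : `|v y - v x| < e / 2 by apply: A; apply: le_lt_trans yx _; lra.
have {}B : `|w y - w x| < e / 2 by apply: B; apply: le_lt_trans yx _; lra.
have E4 (a b z : R) : a - b = (z - b) - (z - a) by ring.
rewrite (E4 _ _ (w y)) -{2}(vw y yr).
by apply: le_trans (ler_normB _ _) _; lra.
Qed.

Lemma integral_on_eq (A : set 'rV[R]_N) (f g : 'rV[R]_N -> R) :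
  (forall x, A x -> f x = g x) -> integral_on A f = integral_on A g.
Proof.
move=> fg; rewrite /integral_on (_ : (fun x => _) = (fun x => if `[< A x >] then g x else 0)) //.
by apply/funext => x; case: asboolP => // /fg.
Qed.

(** Nonzero mass forces [v c > 0], since [v c] is the maximum. The value at the centre determines
    the amplitude, hence [rho], and profiles with equal value at 0 coincide; continuity carries the
    equality to the sphere. *)
Lemma solpde_classify gamma v : solpde p c r gamma v ->
  integral_on (eball c r) (fun x => pospow p (v x)) != 0 ->
  exists2 rho, 0 < rho & [/\ gamma = bdval rho,
    integral_on (eball c r) (fun x => pospow p (v x)) = mass rho &
    forall x, ecball c r x -> v x = sol rho x].
Proof.
move=> sv I0; have P := solpde_profile p1 i0 r0 sv.
have vc : 0 < v c.
  rewrite ltNge; apply/negP => vc0; move/eqP: I0; apply.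
  rewrite (integral_on_eq (g := fun x => 0 * pospow p (v x))).
    by rewrite (solpde_integralZ (lexx 0) sv) mul0r.
  move=> x xr; rewrite mul0r pospow_le0 // (solpde_radialE sv xr).
  apply: le_trans vc0; have := solpde_homo sv (lexx 0) (enorm_ge0 (x - c)) xr.
  by rewrite scale0r addr0.
have U0 : 0 < U 0 by apply: (gp_pos gp); rewrite lexx ltr01.
pose k := v c / U 0; have k0 : 0 < k by rewrite divr_gt0.
(* The root of [k * tau^2 = k^p]; setting [rho = tau * r] makes [amp rho] equal to [k]. *)
pose tau := k `^ ((p - 1) / 2); have t0 : 0 < tau by rewrite powR_gt0.
pose rho := tau * r; have rho0 : 0 < rho by rewrite mulr_gt0.
have taur : rho / r = tau by rewrite /rho mulfK // lt0r_neq0.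
have ak : amp rho = k.
  rewrite /amp taur /tau -powRrM (_ : _ * _ = 1) ?powRr1 ?(ltW k0) //.
  by field.
have Q := scaled_profile r (amp_gt0 rho0) (divr_gt0 rho0 r0) (ampE rho0).
have V0 : v (c + 0 *: evec R i0) = amp rho * U (rho / r * 0).
  by rewrite scale0r addr0 mulr0 ak /k divfK // lt0r_neq0.
have vsol x : eball c r x -> v x = sol rho x.
  move=> xr; rewrite (solpde_radialE sv xr) /sol.
  have := enorm_ge0 (x - c); rewrite le_eqVlt => /predU1P[<-|x0]; first exact: V0.
  by have [] := profile_unique p1 P Q V0 (s := enorm (x - c)); rewrite ?x0.
have [_ sols] := sol_solpde rho0.
have vsol' x : ecball c r x -> v x = sol rho x.
  by apply: eq_on_closed vsol x; [have [] := sv | have [] := sols].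
exists rho => //; split => //.
- have xs : esphere c r (c + r *: evec R i0).
    by rewrite /esphere /= addrAC subrr add0r enorm_evec // ltW.
  have [_ _ _ bdv] := sv; have [_ _ _ bds] := sols.
  by rewrite -(bdv _ xs) -(bds _ xs); apply: vsol'; rewrite /ecball /= xs.
- by rewrite (integral_on_eq (g := fun x => pospow p (sol rho x))) ?sol_integral // => x /vsol ->.
Qed.

Lemma gflux_gt0 (s : R) : 0 < s -> 0 < flux N.-1 U1 s.
Proof.
move=> s0; apply: (flux_gt0 (gp_profile gp (s + 1))); last by rewrite s0 ltrDl ltr01.
by apply: (gp_pos gp); rewrite lexx ltr01.
Qed.

Let Nk0 : 0 < N%:R * kappa.
Proof. by rewrite mulr_gt0 // ltr0n (ltn_trans _ N3). Qed.

Lemma mass_mono rho rho' : 0 < rho -> rho < rho' -> mass rho < mass rho'.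
Proof.
move=> h0 h; have h0' := lt_trans h0 h; rewrite /mass ltr_pM2l //.
apply: (@lt_le_trans _ _ ((rho' / r) `^ theta * flux N.-1 U1 rho)).
  rewrite ltr_pM2r ?gflux_gt0 //; apply: gt0_ltr_powR; rewrite ?nnegrE ?divr_ge0 ?ltW //.
  by rewrite ltr_pM2r ?invr_gt0.
rewrite ler_pM2l ?powR_gt0 ?divr_gt0 //.
apply: (flux_homo (gp_profile gp (rho' + 1)) h0 (ltW h)).
by rewrite ltrDl ltr01.
Qed.

Lemma mass_inj rho rho' : 0 < rho -> 0 < rho' -> mass rho = mass rho' -> rho = rho'.
Proof.
move=> h h' E; have [lt|lt|//] := ltgtP rho rho'.
  by have := mass_mono h lt; rewrite E ltxx.
by have := mass_mono h' lt; rewrite E ltxx.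
Qed.

Lemma mass_lt rho : 0 < rho -> (mass rho < mass 1) = (rho < 1).
Proof.
move=> h; have [lt|lt|->] := ltgtP rho 1; last by rewrite ltxx.
  exact: mass_mono.
by apply/negbTE; rewrite -leNgt ltW // mass_mono.
Qed.

Lemma mass_gt rho : 0 < rho -> (mass 1 < mass rho) = (1 < rho).
Proof.
move=> h; have [lt|lt|->] := ltgtP rho 1; last by rewrite ltxx.
  by apply/negbTE; rewrite -leNgt ltW // mass_mono.
exact: mass_mono.
Qed.

(** The number [a] solves the equation with the flux frozen at its limit [m]. If [a >= 1] it is the
    solution; otherwise [flux <= m] gives [mass a <= I <= mass 1] and the intermediate value theorem
    finishes. *)
Lemma mass_surj I : 0 < I -> exists2 rho, 0 < rho & mass rho = I.
Proof.
move=> I0; have m0 := gp_m gp.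
pose y := I / (N%:R * kappa * m).
have y0 : 0 < y by rewrite divr_gt0 // mulr_gt0.
pose a := r * y `^ theta^-1; have a0 : 0 < a by rewrite mulr_gt0 // powR_gt0.
have ath : (a / r) `^ theta = y.
  rewrite /a mulrAC divff ?lt0r_neq0 // mul1r -powRrM mulVf ?lt0r_neq0 //.
  by rewrite powRr1 // ltW.
have Ia : N%:R * kappa * ((a / r) `^ theta * m) = I.
  rewrite ath (mulrC y) mulrA mulrC /y divfK //.
  by rewrite lt0r_neq0 // mulr_gt0.
have [a1|a1] := leP 1 a; first by exists a => //; rewrite /mass (gp_flux gp a1).
have le : mass a <= I.
  rewrite -Ia /mass ler_pM2l // ler_pM2l ?powR_gt0 ?divr_gt0 //.
  exact: (gp_flux_le gp).
have ge : I <= mass 1.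
  rewrite -Ia /mass (gp_flux gp (lexx 1)) ler_pM2l // ler_pM2r //.
  apply: ge0_ler_powR; rewrite ?nnegrE ?divr_ge0 ?ltW //.
  by rewrite ltr_pM2r ?invr_gt0.
have cm : {within `[a, 1], continuous mass}.
  apply: derivable_within_continuous => s; rewrite in_itv /= => /andP[as1 _].
  have s0 := lt_le_trans a0 as1.
  have D1 : is_derive s 1 (flux N.-1 U1) _ := flux_derive (gp_profile gp (s + 1)) (_ : 0 < s < s + 1).
  have sr0 : 0 < r^-1 * s by rewrite mulr_gt0 // invr_gt0.
  have D2 := is_derive1_comp (is_derive1_powR theta sr0) (is_derive_lin r^-1 s).
  have D3 := is_derive_scale (N%:R * kappa) (is_derive_mult D2 (D1 _)).
  have -> : mass = fun s => N%:R * kappa * ((r^-1 * s) `^ theta * flux N.-1 U1 s).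
    by apply/funext => t; rewrite /mass /= (mulrC t).
  by case: D3 => //; rewrite s0 ltrDl ltr01.
have [z] : exists2 z, z \in `[a, 1] & mass z = I.
  apply: IVT => //; first exact: ltW.
  rewrite (min_l (le_trans le ge)) (max_r (le_trans le ge)).
  by rewrite le ge.
by rewrite in_itv /= => /andP[az _] E; exists z => //; apply: lt_le_trans az.
Qed.

Lemma gp_neg s : 1 < s -> U s < 0.
Proof.
move=> s1; rewrite (gp_out gp (ltW s1)) oppr_lt0 mulr_gt0 ?divr_gt0 ?(gp_m gp) //.
  by rewrite ltr0n -ltnS prednK // (ltn_trans _ n1).
have s0 : 0 < s by apply: lt_trans s1.
rewrite subr_gt0 invf_lt1 ?exprn_gt0 // exprn_egt1 //.
by rewrite -lt0n -ltnS prednK // (ltn_trans _ n1).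
Qed.

Lemma gp_1 : U 1 = 0.
Proof. by rewrite (gp_out gp (lexx 1)) expr1n invr1 subrr mulr0 oppr0. Qed.

Lemma bdval_gt0 rho : 0 < rho -> (0 < bdval rho) = (rho < 1).
Proof.
move=> h; rewrite /bdval pmulr_rgt0 ?amp_gt0 //.
have [lt|lt|->] := ltgtP rho 1; last by rewrite gp_1 ltxx.
  by rewrite (gp_pos gp) // ltW.
by apply/negbTE; rewrite -leNgt ltW // gp_neg.
Qed.

Lemma bdval_lt0 rho : 0 < rho -> (bdval rho < 0) = (1 < rho).
Proof.
move=> h; rewrite /bdval pmulr_rlt0 ?amp_gt0 //.
have [lt|lt|->] := ltgtP rho 1; last by rewrite gp_1 ltxx.
  by apply/negbTE; rewrite -leNgt ltW // (gp_pos gp) // ltW.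
exact: gp_neg.
Qed.

Lemma free_boundary rho : 0 < rho ->
  (exists x, eball c r x /\ sol rho x <= 0) <-> 1 < rho.
Proof.
move=> h; have t0 : 0 < rho / r by rewrite divr_gt0.
split.
  move=> [x [xr]]; rewrite /sol pmulr_rle0 ?amp_gt0 // => Ux.
  have s1 : 1 <= rho / r * enorm (x - c).
    rewrite leNgt; apply/negP => s1; move: Ux; rewrite leNgt (gp_pos gp) //.
    by rewrite mulr_ge0 ?enorm_ge0 // ltW.
  apply: le_lt_trans s1 _; rewrite -[ltRHS](divfK (lt0r_neq0 r0)).
  by rewrite ltr_pM2l.
move=> rho1; exists (c + (r / rho) *: evec R i0).
have en : enorm (c + (r / rho) *: evec R i0 - c) = r / rho.
  by rewrite addrAC subrr add0r enorm_evec // divr_ge0 // ltW.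
split; first by rewrite /eball /= en ltr_pdivrMr // ltr_pMr.
rewrite /sol en mulrA divfK ?lt0r_neq0 // divff ?lt0r_neq0 //.
by rewrite gp_1 mulr0.
Qed.

Lemma solFI_exists I : 0 < I -> exists gamma v, solFI beta p I c r gamma v.
Proof.
move=> /mass_surj[rho h <-]; exists (bdval rho), (sol rho).
have [C2 [_ _ slap sbd]] := sol_solpde h.
by split => //; exact: sol_integral.
Qed.

Lemma solFI_solpde I gamma v : solFI beta p I c r gamma v -> solpde p c r gamma v.
Proof. by move=> [[]]. Qed.

Lemma solFI_classify I gamma v : 0 < I -> solFI beta p I c r gamma v ->
  exists2 rho, 0 < rho & [/\ gamma = bdval rho, I = mass rho &
    forall x, ecball c r x -> v x = sol rho x].
Proof.
move=> I0 sv; have [_ _ _ IE] := sv.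
have [|rho h [A B C]] := solpde_classify (solFI_solpde sv); first by rewrite IE gt_eqF.
by exists rho => //; split => //; rewrite -IE.
Qed.

Lemma solFI_unique I g1 v1 g2 v2 : 0 < I -> solFI beta p I c r g1 v1 ->
  solFI beta p I c r g2 v2 -> g1 = g2 /\ forall x, ecball c r x -> v1 x = v2 x.
Proof.
move=> I0 /(solFI_classify I0)[a a0 [-> Ia va]] /(solFI_classify I0)[b b0 [-> Ib vb]].
have ab : a = b by apply: mass_inj => //; rewrite -Ia.
by rewrite ab; split => // x xr; rewrite va // vb // ab.
Qed.

Lemma mass_out rho : 1 < rho -> mass rho = rho `^ theta * mass 1.
Proof.
move=> rho1; have h : 0 < rho by apply: lt_trans rho1.
rewrite /mass (gp_flux gp (ltW rho1)) (gp_flux gp (lexx 1)).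
rewrite powRM ?invr_ge0 ?(ltW r0) ?(ltW h) // div1r; ring.
Qed.

(** Outside the unit radius the value of [U] and the mass are both proportional to [m]; eliminating
    [m] leaves only the mass and [rho]. *)
Lemma bdval_out rho : 1 < rho -> bdval rho =
  1 / (N%:R * (N%:R - 2) * kappa * r ^+ (N - 2)) * mass rho * (1 - rho ^+ (N - 2)).
Proof.
move=> rho1; have h : 0 < rho by apply: lt_trans rho1.
have t0 : 0 < rho / r by rewrite divr_gt0.
have N2 : (2 <= N)%N by exact: ltnW.
have tn : amp rho = (rho / r) `^ theta * (rho / r) ^+ (N - 2).
  rewrite /amp -powR_mulrn ?ltW // -powRD ?(gt_eqF t0) ?implybT //.
  by congr powR; rewrite /theta natrB //; ring.
have N2E : (N.-1).-1 = (N - 2)%N by rewrite -!subn1 -subnDA.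
have N2R : N%:R - 2 != 0 :> R by rewrite -natrB // pnatr_eq0 -lt0n subn_gt0.
have NR : N%:R != 0 :> R by rewrite pnatr_eq0 -lt0n (ltn_trans _ N3).
rewrite /bdval (gp_out gp (ltW rho1)) /mass (gp_flux gp (ltW rho1)) tn N2E natrB //.
rewrite expr_div_n; field.
by rewrite NR N2R (lt0r_neq0 kappa0) !expf_neq0 // lt0r_neq0.
Qed.

(** * Passage between the two problems *)

Section Plambda.
Variable lambda : R.
Hypothesis lambda0 : 0 < lambda.
Let L := lambda `^ (p - 1)^-1.
Let L0 : 0 < L. Proof. exact: powR_gt0. Qed.
(** Both [L * lambda] and [L^p] equal [I], which is why one affine substitution matches the equation
    and the mass constraint. *)
Let LL : L * lambda = lambda `^ (p / (p - 1)).
Proof.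
rewrite -[X in _ * X](powRr1 (ltW lambda0)) -powRD ?(gt_eqF lambda0) ?implybT //.
by congr powR; field.
Qed.
Let Lp : L `^ p = lambda `^ (p / (p - 1)).
Proof. by rewrite -powRrM mulrC. Qed.

Lemma affine1_C2beta a k (w : 'rV[R]_N -> R) : C2beta beta c r w ->
  C2beta beta c r (fun x => a + k * w x) /\
  forall x, eball c r x -> lap (fun x => a + k * w x) x = k * lap w x.
Proof.
move=> hw; have E : (fun x => a + k * w x) = (fun x => a + k * w (1 *: (x - c) + c)).
  by apply/funext => x; rewrite scale1r subrK.
rewrite -{1}(mul1r r) in hw; split; first by rewrite E; exact: affine_C2beta.
move=> x xr; have [_ D _ _ _] := hw.
by rewrite E (affine_lap ltr01 a k D xr) !mulr1 scale1r subrK.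
Qed.

Lemma solPlam_solFI alpha psi : solPlam beta p lambda c r alpha psi ->
  solFI beta p (lambda `^ (p / (p - 1))) c r (L * alpha)
    (fun x => L * (alpha + lambda * psi x)).
Proof.
move=> [hC hlap hbd hI].
have E : (fun x => L * (alpha + lambda * psi x)) = (fun x => L * alpha + L * lambda * psi x).
  by apply/funext => x; rewrite mulrDr mulrA.
have [C2 lapE] := affine1_C2beta (L * alpha) (L * lambda) hC.
have lapv x : eball c r x -> - lap (fun x => L * (alpha + lambda * psi x)) x =
    pospow p (L * (alpha + lambda * psi x)).
  by move=> xr; rewrite {1}E lapE // -mulrN hlap // pospowZ // Lp LL.
have bd x : esphere c r x -> L * (alpha + lambda * psi x) = L * alpha.
  by move=> xr; rewrite hbd // mulr0 addr0.
have sv : solpde p c r (L * alpha) (fun x => L * (alpha + lambda * psi x)).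
  by have [cv C2' _ _ _] := C2; split => //; rewrite E.
split; [by rewrite E | exact: lapv | exact: bd |].
have Lpn : L `^ p != 0 by rewrite gt_eqF // powR_gt0.
have Li : 0 <= (L `^ p)^-1 by rewrite invr_ge0 powR_ge0.
(* Homogeneity is available for the rescaled function [sv], so the known mass 1 is recovered from it
   with the inverse factor. *)
have := solpde_integralZ Li sv.
rewrite (integral_on_eq (g := fun x => pospow p (alpha + lambda * psi x))); last first.
  by move=> x _; rewrite pospowZ // mulKf.
by rewrite hI => H; rewrite -Lp -[LHS](mulVKf Lpn) -H mulr1.
Qed.

Lemma solFI_solPlam gamma v : solFI beta p (lambda `^ (p / (p - 1))) c r gamma v ->
  solPlam beta p lambda c r (gamma / L) (fun x => (v x - gamma) / (L * lambda)).
Proof.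
move=> sv; have [hC hlap hbd hI] := sv.
have Ln : L != 0 by rewrite gt_eqF.
have ln : lambda != 0 by rewrite gt_eqF.
have E : (fun x => (v x - gamma) / (L * lambda)) =
    (fun x => - gamma / (L * lambda) + (L * lambda)^-1 * v x).
  by apply/funext => x; field; rewrite ln.
have vE x : gamma / L + lambda * ((v x - gamma) / (L * lambda)) = L^-1 * v x.
  by field; rewrite Ln.
have [C2 lapE] := affine1_C2beta (- gamma / (L * lambda)) (L * lambda)^-1 hC.
split.
- by rewrite E.
- move=> x xr; rewrite vE {1}E lapE // -mulrN hlap // pospowZ ?invr_gt0 //.
  by rewrite LL -Lp -(powR_inv1 (ltW L0)) -powRrM mulN1r powRN.
- by move=> x xr; rewrite hbd // subrr mul0r.
- rewrite (integral_on_eq (g := fun x => (lambda `^ (p / (p - 1)))^-1 * pospow p (v x))).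
    rewrite (solpde_integralZ _ (solFI_solpde sv)) ?invr_ge0 ?powR_ge0 // hI mulVf //.
    by rewrite gt_eqF // powR_gt0.
  move=> x _; rewrite vE pospowZ ?invr_gt0 //; congr (_ * _).
  by rewrite -Lp -(powR_inv1 (ltW L0)) -powRrM mulN1r powRN.
Qed.

Lemma solPlam_exists : exists alpha psi, solPlam beta p lambda c r alpha psi.
Proof.
have [gamma [v /solFI_solPlam sv]] := solFI_exists (powR_gt0 (p / (p - 1)) lambda0).
by eexists; eexists; exact: sv.
Qed.

Lemma solPlam_unique a1 f1 a2 f2 : solPlam beta p lambda c r a1 f1 ->
  solPlam beta p lambda c r a2 f2 -> a1 = a2 /\ forall x, ecball c r x -> f1 x = f2 x.
Proof.
move=> /solPlam_solFI s1 /solPlam_solFI s2.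
have [A B] := solFI_unique (powR_gt0 (p / (p - 1)) lambda0) s1 s2.
have a12 : a1 = a2 by move/mulfI: A; apply; rewrite gt_eqF.
split => // x xr; have := B x xr; move/mulfI; rewrite (gt_eqF L0) => /(_ isT).
by rewrite a12 => /addrI /mulfI; apply; rewrite gt_eqF.
Qed.

Lemma solPlam_gamma alpha psi gamma v : solPlam beta p lambda c r alpha psi ->
  solFI beta p (lambda `^ (p / (p - 1))) c r gamma v -> gamma = lambda `^ (p - 1)^-1 * alpha.
Proof.
move=> /solPlam_solFI s1 s2.
by have [] := solFI_unique (powR_gt0 (p / (p - 1)) lambda0) s2 s1.
Qed.

End Plambda.

End Classification.

(** * Thresholds and the explicit multiplier *)

Theorem theorem9p1 (R : realType) (N : nat) (hN : (3 <= N)%N)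
  (beta : R) (hbeta : 0 < beta < 1)
  (p : R) (hp : 1 < p < N%:R / (N%:R - 2))
  (c : 'rV[R]_N) (RN : R) (hRN : 0 < RN) (hvol : volume (eball c RN) = 1)
  (u : 'rV[R]_N -> R) (hu : LaneEmden beta p u) :
  let pN : R := N%:R / (N%:R - 2) in
  let omegaN := volume (eball (0 : 'rV[R]_N) 1) in
  let Ip := integral_on (eball (0 : 'rV[R]_N) 1) (fun x => u x `^ p) in
  let Istar := Ip / RN `^ (2 / (p - 1) - N%:R + 2) in
  let lamstar := Istar `^ ((p - 1) / p) in
  let cN := 1 / (N%:R * (N%:R - 2) * omegaN * RN ^+ (N - 2)) in
  (* existence and uniqueness for (F_I) *)
  (forall I : R, 0 < I ->
     (exists (gamma : R) (v : 'rV[R]_N -> R), solFI beta p I c RN gamma v) /\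
     (forall g1 v1 g2 v2, solFI beta p I c RN g1 v1 -> solFI beta p I c RN g2 v2 ->
        g1 = g2 /\ (forall x, ecball c RN x -> v1 x = v2 x))) /\
  (* existence and uniqueness for (P_lambda) *)
  (forall lambda : R, 0 < lambda ->
     (exists (alpha : R) (psi : 'rV[R]_N -> R), solPlam beta p lambda c RN alpha psi) /\
     (forall a1 f1 a2 f2, solPlam beta p lambda c RN a1 f1 -> solPlam beta p lambda c RN a2 f2 ->
        a1 = a2 /\ (forall x, ecball c RN x -> f1 x = f2 x))) /\
  (* characterization, with I = lambda^(p/(p-1)) *)
  (forall (lambda : R), 0 < lambda ->
   forall (alpha : R) (psi : 'rV[R]_N -> R) (gamma : R) (v : 'rV[R]_N -> R),
     let I := lambda `^ (p / (p - 1)) in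
     solPlam beta p lambda c RN alpha psi -> solFI beta p I c RN gamma v ->
     ((0 < alpha <-> 0 < gamma) /\ (0 < gamma <-> I < Istar) /\
      (I < Istar <-> lambda < lamstar)) /\
     (((exists x, eball c RN x /\ v x <= 0) <-> gamma < 0) /\
      (gamma < 0 <-> Istar < I) /\ (Istar < I <-> lamstar < lambda)) /\
     (lamstar < lambda ->
        alpha = cN * lambda * (1 - (lambda / lamstar) `^ (p / (pN - p))))).
Proof.
move=> pN omegaN Ip Istar lamstar cN.
have [hC hpos hlap hbd] := hu; have [p1 pN1] := andP hp.
have N0 : (0 < N)%N by apply: leq_trans hN.
pose i0 := Ordinal N0.
have n1 : (1 < N.-1)%N by rewrite -ltnS prednK.
have N2R : 0 < N%:R - 2 :> R by rewrite subr_gt0 ltr_nat.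
have kappa0 : 0 < unit_vol N :> R.
  rewrite lt_neqAle unit_vol_ge0 andbT; apply/eqP => k0.
  by move: hvol; rewrite volume_ball // -k0 mulr0 => /eqP; rewrite eq_sym oner_eq0.
(* Subcriticality [p < N / (N - 2)] is rewritten as [N - 2 < 2 / (p - 1)]. *)
have theta0 : 0 < theta p (R := R) (N := N).
  have : p * (N%:R - 2) < N%:R by rewrite -ltr_pdivlMr.
  move=> H; have : N%:R - 2 < 2 / (p - 1) by rewrite ltr_pdivlMr ?subr_gt0 //; lra.
  by rewrite /theta; lra.
have uE x : eball 0 1 x -> u x `^ p = pospow p (u x).
  by move=> xr; rewrite pospowE // ltW // hpos.
have su : solpde p 0 1 0 u.
  by have [cu Du _ _ _] := hC; split => // x xr; rewrite hlap // uE.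
have P := solpde_profile p1 i0 ltr01 su.
have en (s : R) : 0 <= s -> enorm (0 + s *: evec R i0 - 0) = s.
  by move=> s0; rewrite subr0 add0r enorm_evec.
have [||U [U1 [m [gp uU]]]] := global_profile_exists p1 n1 P.
- by move=> s /andP[s0 s1]; apply: hpos; rewrite /eball /= en.
- move=> eps e0; have [cu _ _ _ _] := hC.
  have xs : esphere 0 1 (0 + 1 *: evec R i0) by rewrite /esphere /= en.
  have [|d d0 dP] := (within_epsP _ _).1 cu (0 + 1 *: evec R i0) eps _ e0.
    by rewrite /ecball /= xs.
  exists (Num.min d 1); first by rewrite lt_min d0 ltr01.
  move=> s /andP[s1 s2].
  have [sd s0] : 1 - s < d /\ 0 < s.
    have : 1 - s < Num.min d 1 by lra.
    by rewrite lt_min => /andP[? ?]; split => //; lra.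
  have := dP (0 + s *: evec R i0); rewrite (hbd _ xs) subr0 => H.
  apply: le_lt_trans (ler_norm _) _; apply: H.
    by rewrite /ecball /= en ?ltW.
  rewrite !add0r -scalerBl enormZ enormE dot_evec sqrtr1 mulr1 distrC gtr0_norm //.
  by rewrite subr_gt0.
have uU0 (s : R) : 0 <= s < 1 -> U s = u (0 + s *: evec R i0).
  by move=> /andP[_ s1]; have [-> _] := uU s s1.
have pm1 : p - 1 != 0 by rewrite subr_eq0 gt_eqF.
have p0 : 0 < p by apply: lt_trans p1.
have IpE : Ip = N%:R * unit_vol N * m.
  rewrite /Ip (integral_on_eq (g := fun x => pospow p (1 * U (1 * enorm (x - 0))))).
    rewrite (scaled_integral p1 hN gp) ?ltr01 ?expr1n ?mulr1 ?powR1 //.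
    rewrite -(gp_flux gp (lexx 1)); congr (_ * flux _ _ _); apply/funext => s.
    by rewrite !mul1r.
  move=> x xr; rewrite uE // !mul1r; congr pospow.
  exact: (radial_sol_in p1 su uU0).
have IstarE : Istar = mass p U1 (N := N) RN 1.
  rewrite /Istar IpE /mass (gp_flux gp (lexx 1)) div1r.
  have -> : RN^-1 `^ theta p (N := N) = (RN `^ (2 / (p - 1) - N%:R + 2))^-1.
    by rewrite -(powR_inv1 (ltW hRN)) -powRrM mulN1r powRN.
  ring.
split; last split.
- move=> I I0; split.
    exact: (solFI_exists p1 hbeta hN hC su gp uU0).
  move=> g1 v1 g2 v2; exact: (solFI_unique p1 hbeta hN hC su gp uU0).
- move=> lambda l0; split.
    exact: (solPlam_exists p1 hbeta hN hC su gp uU0).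
  move=> a1 f1 a2 f2; exact: (solPlam_unique p1 hbeta hN hC su gp uU0).
move=> lambda l0 alpha psi gamma v I sP sF.
have I0 : 0 < I by exact: powR_gt0.
have [rho h [gE IE vE]] := solFI_classify p1 hbeta hN hC su gp uU0 hRN I0 sF.
have aE := solPlam_gamma p1 hbeta hN hC su gp uU0 hRN kappa0 theta0 l0 sP sF.
have L0 : 0 < lambda `^ (p - 1)^-1 by exact: powR_gt0.
have Is0 : 0 < Istar.
  rewrite IstarE /mass (gp_flux gp (lexx 1)) !mulr_gt0 ?powR_gt0 ?(gp_m gp) ?divr_gt0 //.
  by rewrite ltr0n.
have e0 : 0 < (p - 1) / p by rewrite divr_gt0 ?subr_gt0.
(* Inverting the power lets both thresholds be compared through the same increasing map. *)
have lamE : lambda = I `^ ((p - 1) / p).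
  rewrite /I -powRrM (_ : _ * _ = 1) ?powRr1 ?(ltW l0) //.
  by field; rewrite pm1 (lt0r_neq0 p0).
have Ilt (x y : R) : 0 < x -> 0 < y -> (x `^ ((p - 1) / p) < y `^ ((p - 1) / p)) = (x < y).
  move=> x0 y0; apply/idP/idP => [|xy]; last first.
    by apply: gt0_ltr_powR; rewrite ?nnegrE ?ltW.
  apply: contraTT; rewrite -!leNgt => yx.
  by apply: ge0_ler_powR; rewrite ?nnegrE // ltW.
have g1 : (0 < gamma) = (rho < 1) by rewrite gE (bdval_gt0 hN gp hRN h).
have g2 : (gamma < 0) = (1 < rho) by rewrite gE (bdval_lt0 hN gp hRN h).
(* The boundary value and the mass are both compared with their values at [rho = 1], so all the
   equivalences reduce to the position of [rho] relative to 1. *)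
have i1 : (I < Istar) = (rho < 1) by rewrite IE IstarE (mass_lt hN gp hRN kappa0 theta0 h).
have i2 : (Istar < I) = (1 < rho) by rewrite IE IstarE (mass_gt hN gp hRN kappa0 theta0 h).
have l1 : (lambda < lamstar) = (I < Istar) by rewrite lamE /lamstar Ilt.
have l2 : (lamstar < lambda) = (Istar < I) by rewrite lamE /lamstar Ilt.
split; [|split].
- have al : (0 < alpha) = (0 < gamma) by rewrite aE pmulr_rgt0.
  by rewrite al l1 i1 g1; split; [|split].
- rewrite g2 l2 i2; split; [|by split].
  rewrite -(free_boundary i0 gp c hRN h); split=> -[x [xr vx]]; exists x; split => //.
    by rewrite -vE // /ecball /= ltW.
  by rewrite vE // /ecball /= ltW.
- rewrite l2 i2 => rho1.
  (* Since [theta * (p - 1) = N - p (N - 2)] and [pN - p] is this number divided by [N - 2], the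
     combined exponent [theta * (p - 1) / (pN - p)] is [N - 2]. *)
  have rE : (lambda / lamstar) `^ (p / (pN - p)) = rho ^+ (N - 2).
    have -> : lambda / lamstar = (rho `^ theta p (R := R) (N := N)) `^ ((p - 1) / p).
      rewrite lamE /lamstar IE (mass_out gp hRN rho1) -IstarE powRM ?powR_ge0 ?(ltW Is0) //.
      by rewrite mulfK // gt_eqF // powR_gt0.
    rewrite -!powRrM -powR_mulrn ?(ltW h) //; congr powR.
    have N2n : N%:R - 2 != 0 :> R by exact: lt0r_neq0.
    have d0 : N%:R - p * (N%:R - 2) != 0.
      by rewrite subr_eq0 gt_eqF // -ltr_pdivlMr.
    rewrite /theta /pN natrB 1?ltnW //; field.
    by rewrite N2n pm1 (lt0r_neq0 p0) mulNr d0.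
  have LL : lambda `^ (p - 1)^-1 * lambda = I.
    rewrite -[X in _ * X](powRr1 (ltW l0)) -powRD ?(gt_eqF l0) ?implybT //.
    by congr powR; field.
  apply: (mulfI (lt0r_neq0 L0)); rewrite -aE rE gE (bdval_out hN gp hRN kappa0 rho1) -IE -LL.
  rewrite /cN /omegaN volume_ball // expr1n !mul1r; ring.
Qed.
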